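(* Let $C,D$ be rank $N$ Okada arc-diagrams. In the Okada algebra $\mathbf{O}_N(X,Y)$, $$E_CE_D=\Big(\prod_{(a,w,a)\in\mathrm{Loops}(C,D)}x_a\Big)\Big(\prod_{\mathbb{w}\in\mathrm{Walks}(C,D)}\ \prod_{p}y_{\mathrm{height}_{\mathbb{w}}(p)}\Big)E_{C\cdot D},$$ where the last product is over all positions $p\ge 0$ at which there occurs a paired up-step $\mathtt{U}$ of $\mathbb{w}$ such that $\mathrm{lpair}_{\mathbb{w}}(p)$ is even.
   Context: Okada algebra: for a field $\mathbb{K}$ and $X=(x_1,\dots,x_{N-1})$, $Y=(y_1,\dots,y_{N-2})$ in $\mathbb{K}$, $\mathbf{O}_N(X,Y)$ is the unital associative algebra generated by $E_1,\dots,E_{N-1}$ with relations $E_i^2=x_iE_i$, $E_iE_j=E_jE_i$ ($|i-j|\ge2$), $E_{i+1}E_iE_{i+1}=y_iE_{i+1}$ ($1\le i\le N-2$). Okada arc-diagrams. Let $[N]=\{1,\dots,N\}$, $\overline{[N]}=\{\bar1,\dots,\bar N\}$, $|i|=|\bar i|=i$, ordered by $1<\dots<N<\bar N<\dots<\bar1$. A non-crossing arc-diagram of rank $N$ is a perfect matching of $[N]\cup\overline{[N]}$ (pairs are arcs) with no arcs $\{a,b\},\{c,d\}$ with $a<c<b<d$. Arc $\{a<b\}$ is nested in $\{c<d\}$ if $c<a<b<d$. An Okada arc-diagram is a non-crossing arc-diagram with integer labels on arcs such that the label of $\{a,b\}$ is at least $1$, at most $\min(|a|,|b|)$ and of the same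 parity as $\min(|a|,|b|)$, and an arc nested in another has a strictly larger label. Composition $C\circ D$: identify each node $\bar i$ of $C$ with node $i$ of $D$ and concatenate arcs; its connected components are paths (joining two nodes among the left nodes $[N]$ of $C$ and the right nodes $\overline{[N]}$ of $D$) and closed loops. Product $C\cdot D$: discard the loops of $C\circ D$, replace each path by an arc labelled by the minimum of the labels of the arcs composing it. $A_i$ has arcs $\{a,\bar a\}$ labelled $a$ for $a\ne i,i+1$ and arcs $\{i,i+1\}$, $\{\bar i,\overline{i+1}\}$ labelled $i$. For $\sigma\in\mathfrak{S}_N$ let $c_i=\#\{k<i:\sigma^{-1}(k)>\sigma^{-1}(i)\}$; for $g_i=A_i$ or $E_i$ set $g_\sigma=\prod_{i=1}^N(g_{i-1}g_{i-2}\cdots g_{i-c_i})$, factors ordered with $i$ increasing. Then $\sigma\mapsto A_\sigma$ is a bijection onto rank $N$ Okada arc-diagrams; put $E_D:=E_\sigma$ for $D=A_\sigma$. Walks. A walk $\mathbb{w}=(a,w,b)$ is a lattice walk from $(0,a)$ to $(k,b)$, where $w$ is a word of length $k$ in steps $\mathtt{U}=(+1,+1)$ and $\mathtt{D}=(+1,-1)$. A $\mathtt{U}$-step occurs at $p$ if the walk has a step from $(p,h)$ to $(p+1,h+1)$; then $\mathrm{height}_{\mathbb{w}}(p)=h$. It is paired with $q$ if the walk has a $\mathtt{D}$-step from $(q-1,h+1)$ to $(q,h)$ with $q>p$ and $q$ is minimal with this property (parenthesis matching); then $\mathrm{lpair}_{\mathbb{w}}(p)=(q-p)/2$. Walk of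 a path of $C\circ D$: let $i_1$ be its leftmost and lowest endpoint (the endpoint of smallest index among its endpoints on the left side of $C$ if there is one, otherwise its endpoint of smallest absolute value on the right side of $D$). Traverse the path from $i_1$, listing its arcs $\alpha_1,\dots,\alpha_n$, where $\alpha_k$ goes from node $i_k$ to node $j_k$ and has label $\ell_k$. The walk is $(|i_1|,w,|j_n|)$ with $w=\mathtt{D}^{|i_1|-\ell_1}\mathtt{U}^{|j_1|-\ell_1}\cdots\mathtt{D}^{|i_n|-\ell_n}\mathtt{U}^{|j_n|-\ell_n}$. Walk of a loop of $C\circ D$: let $\ell_1$ be the minimal label among its arcs. If some arc of $C$ in the loop has label $\ell_1$, choose among these the one with endpoints $u,v$ for which $\max(|u|,|v|)$ is maximal, and let $i_1$ (resp. $j_1$) be its endpoint of larger (resp. smaller) absolute value; otherwise choose among the arcs of $D$ in the loop with label $\ell_1$ the one for which $\min(|u|,|v|)$ is minimal and let $i_1$ (resp. $j_1$) be its endpoint of smaller (resp. larger) absolute value. Traverse the loop starting with this arc $\alpha_1$ from $i_1$ to $j_1$, listing the arcs $\alpha_k$ from $i_k$ to $j_k$ with labels $\ell_k$, $k=1,\dots,n$. The walk is $(\ell_1,w,\ell_1)$ with $w=\mathtt{U}^{|j_1|-\ell_1}\mathtt{D}^{|i_2|-\ell_2}\mathtt{U}^{|j_2|-\ell_2}\cdots\mathtt{D}^{|i_n|-\ell_n}\mathtt{U}^{|j_n|-\ell_n}\mathtt{D}^{|i_1|-\ell_1}$. $\mathrm{Walks}(C,D)$ is the collection (with multiplicity)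 of the walks of all paths and all loops of $C\circ D$; $\mathrm{Loops}(C,D)$ is the sub-collection of the walks of the loops. *)

(* Defs.v *)
From HB Require Import structures.
From mathcomp Require Import all_boot fingroup perm all_algebra.
From mathcomp Require Import generic_quotient ring_quotient.
From mathcomp Require Import finmap.
From mathcomp.classical Require Import boolp.
From mathcomp.multinomials Require Import monalg.

Set Implicit Arguments.
Unset Strict Implicit.
Unset Printing Implicit Defensive.

Import GRing.Theory.

Local Open Scope ring_scope.
Local Open Scope quotient_scope.

(** * The Okada algebra

    Quotient of the free associative algebra on N - 1 letters by the two-sided
    ideal generated by the defining relations.  Letters and parameters are
    0-based: the letter i : 'I_N.-1 is E_{i+1}, and X`_i, Y`_i are x_{i+1},
    y_{i+1}. *)

Section OkadaAlgebra.
Context (K : fieldType) (N : nat).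
Context (X : N.-1.-tuple K) (Y : N.-2.-tuple K).

Local Notation free_alg := {malg K[{fmonom 'I_N.-1}]}.

Definition letter (i : 'I_N.-1) : free_alg := << fmu i >>.

Inductive okada_relator : free_alg -> Prop :=
| Relator_sq i :
    okada_relator (letter i ^+ 2 - X`_i *: letter i)
| Relator_comm (i j : 'I_N.-1) : (i.+2 <= j)%N || (j.+2 <= i)%N ->
    okada_relator (letter i * letter j - letter j * letter i)
| Relator_down (i j : 'I_N.-1) : j = i.+1 :> nat ->
    okada_relator (letter j * letter i * letter j - Y`_i *: letter j).

Inductive okada_ideal : free_alg -> Prop :=
| Ideal_gen r : okada_relator r -> okada_ideal r
| Ideal_0 : okada_ideal 0
| Ideal_B u v : okada_ideal u -> okada_ideal v -> okada_ideal (u - v)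
| Ideal_Ml a u : okada_ideal u -> okada_ideal (a * u)
| Ideal_Mr u a : okada_ideal u -> okada_ideal (u * a).

Definition okada_idealb (u : free_alg) : bool := `[< okada_ideal u >].

Lemma okada_idealP u : reflect (okada_ideal u) (u \in (okada_idealb : pred _)).
Proof. exact: asboolP. Qed.

Fact okada_ideal_zmod_closed : zmod_closed okada_idealb.
Proof.
split=> [|u v /okada_idealP Iu /okada_idealP Iv]; apply/okada_idealP.
  exact: Ideal_0.
exact: Ideal_B.
Qed.

HB.instance Definition _ :=
  GRing.isZmodClosed.Build free_alg okada_idealb okada_ideal_zmod_closed.

Local Notation okada_quot := 
  (Quotient.quot (GRing.ZmodClosed.clone _ okada_idealb _)).

Definition okada_alg : Type := okada_quot.
HB.instance Definition _ := GRing.Zmodule.on okada_alg.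

Definition okada_pi (u : free_alg) : okada_alg :=
  \pi_(okada_quot) u.

Lemma okada_piP u v : okada_pi u = okada_pi v <-> okada_ideal (u - v).
Proof.
split=> [eq_uv|/okada_idealP].
  by apply/okada_idealP; rewrite Quotient.idealrBE; apply/eqP.
by rewrite Quotient.idealrBE => /eqP.
Qed.

Lemma okada_pi_surj (x : okada_alg) : exists u, okada_pi u = x.
Proof. by exists (repr (x : okada_quot)); rewrite /okada_pi reprK. Qed.

Lemma okada_piB : {morph okada_pi : u v / u - v}.
Proof. exact: (raddfB \pi_(okada_quot)). Qed.

Definition okada_rep (x : okada_alg) : free_alg := repr (x : okada_quot).

Lemma okada_repK : cancel okada_rep okada_pi.
Proof. by move=> x; rewrite /okada_pi /okada_rep reprK. Qed.

Definition okada_one : okada_alg := okada_pi 1.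
Definition okada_mul (x y : okada_alg) : okada_alg :=
  okada_pi (okada_rep x * okada_rep y).
Definition okada_scale (c : K) (x : okada_alg) : okada_alg :=
  okada_pi (c *: okada_rep x).

Lemma okada_repB u : okada_ideal (okada_rep (okada_pi u) - u).
Proof. by apply/okada_piP; rewrite okada_repK. Qed.

Lemma okada_ideal_D u v : okada_ideal u -> okada_ideal v -> okada_ideal (u + v).
Proof.
move=> Iu Iv; rewrite -[v]opprK -[- v]sub0r; apply: Ideal_B => //.
exact/Ideal_B/Iv/Ideal_0.
Qed.

Lemma okada_piD : {morph okada_pi : u v / u + v}.
Proof. exact: (raddfD \pi_(okada_quot)). Qed.

Lemma okada_pi0 : okada_pi 0 = 0.
Proof. by rewrite -(subrr 0) okada_piB subrr. Qed.

Lemma okada_piM : {morph okada_pi : u v / u * v >-> okada_mul u v}.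
Proof.
move=> u v; apply/esym/okada_piP.
set u' := okada_rep _; set v' := okada_rep _.
rewrite (_ : _ - _ = (u' - u) * v' + u * (v' - v)).
  by apply: okada_ideal_D; [apply: Ideal_Mr|apply: Ideal_Ml];
    exact: okada_repB.
by rewrite mulrBl mulrBr addrA subrK.
Qed.

Lemma okada_piZ c u : okada_pi (c *: u) = okada_scale c (okada_pi u).
Proof.
apply/esym/okada_piP; rewrite -scalerBr -mul_malgC.
exact/Ideal_Ml/okada_repB.
Qed.

Let lift3 (P : okada_alg -> okada_alg -> okada_alg -> Prop) :
  (forall u v w, P (okada_pi u) (okada_pi v) (okada_pi w)) ->
  forall x y z, P x y z.
Proof.
move=> PP x y z.
by rewrite -[x]okada_repK -[y]okada_repK -[z]okada_repK.
Qed.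

Fact okada_mulA : associative okada_mul.
Proof. by apply: lift3 => u v w; rewrite -!okada_piM mulrA. Qed.

Fact okada_mul1r : left_id okada_one okada_mul.
Proof.
by move=> x; rewrite -[x]okada_repK /okada_one -okada_piM mul1r.
Qed.

Fact okada_mulr1 : right_id okada_one okada_mul.
Proof.
by move=> x; rewrite -[x]okada_repK /okada_one -okada_piM mulr1.
Qed.

Fact okada_mulDl : left_distributive okada_mul +%R.
Proof.
by apply: lift3 => u v w; rewrite -!(okada_piM, okada_piD) mulrDl.
Qed.

Fact okada_mulDr : right_distributive okada_mul +%R.
Proof.
by apply: lift3 => u v w; rewrite -!(okada_piM, okada_piD) mulrDr.
Qed.

Lemma mcoeff1_letter i : (letter i)@_(@mone {fmonom 'I_N.-1}) = 0.
Proof.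
by rewrite mcoeffU1 -fdeg_eq0 fdegU.
Qed.

Lemma okada_ideal_mcoeff1 u : okada_ideal u -> u@_(@mone {fmonom 'I_N.-1}) = 0.
Proof.
elim=> {u} [r||u v _ Iu _ Iv|a u _ Iu|u a _ Iu].
- case=> *; rewrite ?expr2 raddfB /= ?mcoeffZ !rmorphM /= ?rmorphM /=;
  by rewrite !mcoeff1_letter !(mulr0, mul0r) subr0.
- exact: raddf0.
- by rewrite raddfB /= Iu Iv subr0.
- by rewrite rmorphM /= Iu mulr0.
- by rewrite rmorphM /= Iu mul0r.
Qed.

Fact okada_one_neq0 : okada_one != 0.
Proof.
rewrite /okada_one -okada_pi0; apply/eqP/okada_piP => /okada_ideal_mcoeff1.
by rewrite subr0 mcoeff1 eqxx => /eqP; rewrite oner_eq0.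
Qed.

HB.instance Definition _ := GRing.Zmodule_isNzRing.Build okada_alg
  okada_mulA okada_mul1r okada_mulr1 okada_mulDl okada_mulDr okada_one_neq0.

Fact okada_scaleA a b x :
  okada_scale a (okada_scale b x) = okada_scale (a * b) x.
Proof. by rewrite -[x]okada_repK -!okada_piZ scalerA. Qed.

Fact okada_scale1r : left_id 1 okada_scale.
Proof. by move=> x; rewrite -[x]okada_repK -okada_piZ scale1r. Qed.

Fact okada_scaleDr : right_distributive okada_scale +%R.
Proof.
move=> a x y; rewrite -[x]okada_repK -[y]okada_repK.
by rewrite -!(okada_piZ, okada_piD) scalerDr.
Qed.

Fact okada_scaleDl x : {morph okada_scale^~ x : a b / a + b}.
Proof.
by move=> a b; rewrite -[x]okada_repK -!(okada_piZ, okada_piD) scalerDl.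
Qed.

HB.instance Definition _ := GRing.Zmodule_isLmodule.Build K okada_alg
  okada_scaleA okada_scale1r okada_scaleDr okada_scaleDl.

Fact okada_scaleAl a (x y : okada_alg) : a *: (x * y) = (a *: x) * y.
Proof.
rewrite -[x]okada_repK -[y]okada_repK.
rewrite -[LHS]/(okada_scale _ (okada_mul _ _)).
rewrite -[RHS]/(okada_mul (okada_scale _ _) _).
by rewrite -!(okada_piM, okada_piZ) scalerAl.
Qed.

HB.instance Definition _ :=
  GRing.Lmodule_isLalgebra.Build K okada_alg okada_scaleAl.

(* monalg provides no left-right algebra over a noncommutative monoid. *)
Lemma malg_scaleAr a (u v : free_alg) : a *: (u * v) = u * (a *: v).
Proof.
apply/malgP=> k; rewrite mcoeffZ.
rewrite (mcoeffMlw _ (fsubset_refl _) (fsubset_refl _)).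
rewrite (mcoeffMlw _ (fsubset_refl _) (msuppZ_le _ _)).
rewrite mulr_sumr; apply: eq_bigr => k1 _.
rewrite mulr_sumr; apply: eq_bigr => k2 _.
by rewrite mcoeffZ mulrnAr mulrCA.
Qed.

Fact okada_scaleAr a (x y : okada_alg) : a *: (x * y) = x * (a *: y).
Proof.
rewrite -[x]okada_repK -[y]okada_repK.
rewrite -[LHS]/(okada_scale _ (okada_mul _ _)).
rewrite -[RHS]/(okada_mul _ (okada_scale _ _)).
by rewrite -!(okada_piM, okada_piZ) malg_scaleAr.
Qed.

HB.instance Definition _ :=
  GRing.Lalgebra_isAlgebra.Build K okada_alg okada_scaleAr.

HB.instance Definition _ :=
  GRing.isZmodMorphism.Build free_alg okada_alg okada_pi okada_piB.
HB.instance Definition _ :=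
  GRing.isMonoidMorphism.Build free_alg okada_alg okada_pi
    (conj (erefl : okada_pi 1 = 1) okada_piM).
HB.instance Definition _ :=
  GRing.isScalable.Build K free_alg okada_alg *:%R okada_pi okada_piZ.

(* E_i, with i counted from 1 to N - 1; the value at other i is irrelevant. *)
Definition okada_gen (i : nat) : okada_alg :=
  if i is j.+1 then
    if insub j is Some j' then okada_pi (letter j') else 0
  else 0.

Lemma okada_genE (i : 'I_N.-1) : okada_gen i.+1 = okada_pi (letter i).
Proof. by rewrite /okada_gen valK. Qed.

Lemma okada_gen_sq (i : 'I_N.-1) :
  okada_gen i.+1 ^+ 2 = X`_i *: okada_gen i.+1.
Proof.
rewrite okada_genE -rmorphXn -linearZ.
exact/okada_piP/Ideal_gen/Relator_sq.
Qed.

Lemma okada_gen_comm (i j : 'I_N.-1) : (i.+2 <= j)%N || (j.+2 <= i)%N ->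
  okada_gen i.+1 * okada_gen j.+1 = okada_gen j.+1 * okada_gen i.+1.
Proof.
move=> far_ij; rewrite !okada_genE -!rmorphM.
exact/okada_piP/Ideal_gen/Relator_comm.
Qed.

Lemma okada_gen_down (i j : 'I_N.-1) : j = i.+1 :> nat ->
  okada_gen j.+1 * okada_gen i.+1 * okada_gen j.+1 = Y`_i *: okada_gen j.+1.
Proof.
move=> def_j; rewrite !okada_genE -linearZ.
transitivity (okada_pi (letter j * letter i * letter j)).
  by rewrite 2!rmorphM.
exact/okada_piP/Ideal_gen/Relator_down.
Qed.

End OkadaAlgebra.

(** * Okada arc-diagrams *)

(* inl i is the left node i + 1 and inr i the right node \bar{i + 1}. *)
Definition node N : Type := ('I_N + 'I_N)%type.
HB.instance Definition _ N := Finite.on (node N).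

Definition node_abs N (u : node N) : nat :=
  match u with inl i | inr i => i.+1 end.

(* The rank of a node in 1 < ... < N < \bar N < ... < \bar 1. *)
Definition node_pos N (u : node N) : nat :=
  match u with inl i => i | inr i => (N.*2.-1 - i)%N end.

Definition opp_node N (u : node N) : node N :=
  match u with inl i => inr i | inr i => inl i end.

(* A labelled arc-diagram maps each node u to the pair made of the other
   endpoint and of the label of the arc through u. *)
Definition diagram N := {ffun node N -> node N * nat}.

Section Diagrams.
Context (N : nat).
Implicit Types (C D : diagram N) (u v : node N) (s : 'S_N).

Definition mate D u : node N := (D u).1.
Definition label D u : nat := (D u).2.

Definition is_matching D : bool :=
  [forall u, [&& mate D u != u, mate D (mate D u) == u
                & label D (mate D u) == label D u]].

Definition noncrossing D : bool :=
  [forall u, forall v,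
    ~~ [&& (node_pos u < node_pos v)%N, (node_pos v < node_pos (mate D u))%N
         & (node_pos (mate D u) < node_pos (mate D v))%N]].

Definition label_bounded D : bool :=
  [forall u, let m := minn (node_abs u) (node_abs (mate D u)) in
    (1 <= label D u <= m)%N && (odd (label D u) == odd m)].

Definition label_nested D : bool :=
  [forall u, forall v,
    [&& (node_pos v < node_pos u)%N, (node_pos u < node_pos (mate D u))%N
      & (node_pos (mate D u) < node_pos (mate D v))%N]
    ==> (label D v < label D u)%N].

Definition okada_diagram D : bool :=
  [&& is_matching D, noncrossing D, label_bounded D & label_nested D].

Definition diagram1 : diagram N := [ffun u => (opp_node u, node_abs u)].

(* The node with absolute value a on the same side as u, for 1 <= a <= N. *)
Definition same_side u (a : nat) : node N :=
  match u with inl i => inl (insubd i a.-1) | inr i => inr (insubd i a.-1) end.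

Definition A_gen (i : nat) : diagram N :=
  [ffun u => if node_abs u == i then (same_side u i.+1, i)
             else if node_abs u == i.+1 then (same_side u i, i)
             else (opp_node u, node_abs u)].

(** ** Composition

    The arc ends of C o D are the nodes of C, embedded by inl, and the nodes of
    D, embedded by inr.  The node \bar i of C is glued to the node i of D. *)

Definition arc_end : Type := (node N + node N)%type.
HB.instance Definition _ := Finite.on arc_end.

Definition glue (e : arc_end) : arc_end :=
  match e with
  | inl (inr i) => inr (inl i)
  | inr (inl i) => inl (inr i)
  | _ => e
  end.

Definition outer (e : arc_end) : bool :=
  match e with inl (inl _) | inr (inr _) => true | _ => false end.

Definition outer_end u : arc_end :=
  match u with inl _ => inl u | inr _ => inr u end.

Definition end_node (e : arc_end) : node N := match e with inl u | inr u => u end.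

Definition end_abs (e : arc_end) : nat := node_abs (end_node e).

Section Composition.
Context (C D : diagram N).

Definition other_end (e : arc_end) : arc_end :=
  match e with inl u => inl (mate C u) | inr u => inr (mate D u) end.

Definition end_label (e : arc_end) : nat :=
  match e with inl u => label C u | inr u => label D u end.

(* An arc traversed from i_k to j_k is represented by its initial end i_k; then
   j_k is other_end i_k and i_{k+1} is next_end i_k.  As glue fixes the outer
   nodes, next_end bounces at the ends of a path, so that its orbits are the
   loops, in either direction, and the paths, traversed back and forth. *)
Definition next_end (e : arc_end) : arc_end := glue (other_end e).

(* i_1, ..., i_n for the path that starts at the outer node u. *)
Definition path_ends u : seq arc_end :=
  let r := orbit next_end (outer_end u) in
  take (find (fun e => outer (other_end e)) r).+1 r.

Definition path_last u : node N :=
  end_node (other_end (last (outer_end u) (path_ends u))).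

Definition ends_label_min (e : arc_end) (r : seq arc_end) : nat :=
  foldr (fun f => minn (end_label f)) (end_label e) r.

Definition diagram_mul : diagram N :=
  [ffun u => (path_last u, ends_label_min (outer_end u) (path_ends u))].

(** ** Walks *)

(* The walk (a, w, b) is ((a, w), b), where true is U and false is D. *)
Definition walk : Type := (nat * seq bool * nat)%type.

Definition arc_word (e : arc_end) : seq bool :=
  nseq (end_abs e - end_label e)%N false ++
  nseq (end_abs (other_end e) - end_label e)%N true.

Definition path_walk u : walk :=
  (node_abs u, flatten (map arc_word (path_ends u)), node_abs (path_last u)).

(* Of the two endpoints u and v of a path, u is the leftmost and lowest. *)
Definition starts_before u v : bool :=
  match u, v with
  | inl i, inl j | inr i, inr j => (i < j)%N
  | inl _, inr _ => true
  | inr _, inl _ => false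
  end.

Definition path_walks : seq walk :=
  [seq path_walk u | u <- enum {: node N} & starts_before u (path_last u)].

Definition on_loop (e : arc_end) : bool :=
  all (fun f => ~~ outer f) (orbit next_end e).

Definition loop_label (e : arc_end) : nat :=
  ends_label_min e (orbit next_end e).

Definition in_left (e : arc_end) : bool := if e is inl _ then true else false.

Definition arc_max (e : arc_end) : nat := maxn (end_abs e) (end_abs (other_end e)).
Definition arc_min (e : arc_end) : nat := minn (end_abs e) (end_abs (other_end e)).

(* e is the end i_1 of the loop through e; this selects both the arc where the
   traversal begins and the direction of the traversal. *)
Definition is_loop_start (e : arc_end) : bool :=
  let r := orbit next_end e in
  let min_arc f := end_label f == loop_label e in
  [&& on_loop e, min_arc e &
    if in_left e then
      (end_abs (other_end e) < end_abs e)%N &&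
      all (fun f => in_left f && min_arc f ==> (arc_max f <= arc_max e)%N) r
    else
      [&& (end_abs e < end_abs (other_end e))%N,
          ~~ has (fun f => in_left f && min_arc f) r
        & all (fun f => min_arc f ==> (arc_min e <= arc_min f)%N) r]].

Definition loop_walk (e : arc_end) : walk :=
  (loop_label e,
   nseq (end_abs (other_end e) - end_label e)%N true ++
   flatten (map arc_word (behead (orbit next_end e))) ++
   nseq (end_abs e - end_label e)%N false,
   loop_label e).

(* The collections Loops(C, D) and Walks(C, D), with multiplicities. *)
Definition Loops : seq walk :=
  [seq loop_walk e | e <- enum {: arc_end} & is_loop_start e].

Definition Walks : seq walk := path_walks ++ Loops.

End Composition.

(** ** The elements indexed by permutations *)

(* c_{i+1}, as i : 'I_N stands for i + 1 in {1, ..., N}. *)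
Definition inv_code s (i : 'I_N) : nat :=
  #|[set k : 'I_N | (k < i)%N && (s^-1%g i < s^-1%g k)%N]|.

(* The product of the g_{i-1} g_{i-2} ... g_{i-c_i} over 1 <= i <= N, with the
   generators g counted from 1. *)
Definition perm_prod (T : Type) (one : T) (mul : T -> T -> T) (g : nat -> T) s
  : T :=
  \big[mul/one]_(i < N) \big[mul/one]_(k < inv_code s i) g (i - k)%N.

Definition A_perm s : diagram N := perm_prod diagram1 diagram_mul A_gen s.

Definition E_perm (K : fieldType) (X : N.-1.-tuple K) (Y : N.-2.-tuple K) s
  : okada_alg X Y :=
  perm_prod 1 *%R (okada_gen X Y) s.

(* E_D is E_s for the permutation s such that A_s = D, which exists and is
   unique when D is an Okada arc-diagram. *)
Definition E_diagram (K : fieldType) (X : N.-1.-tuple K) (Y : N.-2.-tuple K) D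
  : okada_alg X Y :=
  if [pick s : 'S_N | A_perm s == D] is Some s then E_perm X Y s else 0.

End Diagrams.

Definition walk_start (W : walk) : nat := W.1.1.
Definition walk_word (W : walk) : seq bool := W.1.2.

(* The ordinate of the walk after p steps; the subtraction is exact for the
   walks above, which never go below ordinate 1. *)
Definition height (W : walk) (p : nat) : nat :=
  (walk_start W + count id (take p (walk_word W))
   - count negb (take p (walk_word W)))%N.

Definition up_at (W : walk) (p : nat) : bool := nth false (walk_word W) p.

(* The step that ends at abscissa q is a D-step from height h + 1 to h. *)
Definition down_to (W : walk) (h q : nat) : bool :=
  [&& ~~ nth true (walk_word W) q.-1, height W q.-1 == h.+1 & height W q == h].

(* The abscissa with which the U-step at p is paired, if any. *)
Definition pair_of (W : walk) (p : nat) : option nat :=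
  ohead [seq q <- iota p.+1 (size (walk_word W) - p)%N | down_to W (height W p) q].

Definition paired_evenly (W : walk) (p : nat) : bool :=
  up_at W p &&
  (if pair_of W p is Some q then ~~ odd (q - p)%N./2 else false).

(* Main.v *)
From HB Require Import structures.
From mathcomp Require Import all_boot fingroup perm all_algebra.
From mathcomp Require Import zify ring.
Require Import Defs.

Set Implicit Arguments.
Unset Strict Implicit.
Unset Printing Implicit Defensive.

Import GRing.Theory.

(** Give every composition C o D the scalar that the formula predicts: x_l for
    every loop with smallest label l, and y_h for every up-step at height h, in
    the walk of a path or of a loop, whose pairing distance is even.  Call it
    the weight of C o D.  The theorem says that E_C E_D is the weight of C o D
    times E_(C . D).

    The weight does not depend on the choices made in the definition of walks.
    Reversing a walk reflects it and keeps the distances and the heights, and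
    starting a loop elsewhere rotates a word that is paired cyclically.  Hence
    every path and loop may be traversed in the direction given by the parity
    of the position of its nodes in the order 1 < ... < N < \bar N < ... < \bar 1:
    arcs and gluings both change that parity, so that this orientation is
    compatible with all compositions ([mate_positive], [weight_walks]).

    The weight is a 2-cocycle ([weight_cocycle]).  In a triple composition
    C o D o F, replace every path of C o D by the single arc of C . D.  The walk
    of the path, from height a to height b with smallest label l, becomes
    D^(a - l) U^(b - l).  Since labels have the parity of the nodes, this walk
    arises by deleting factors UUDD, and such a deletion changes every other
    pairing distance by 0 or 2 and removes exactly one even pair ([reduces_UUDD],
    [reduces_dives]).  So the weight of C o D o F is the weight of C o D times
    the weight of (C . D) o F ([weight_contraction], [weight_nesting]), and
    symmetrically for D o F; the two endpoints and the smallest label of the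
    paths show in passing that the product of diagrams is associative.  That
    every walk reduces in this way is checked for the products by one
    generator and then propagates ([tidy_gen], [tidy_composite]).

    The cocycle turns products of generators into scalars: a word w in the
    indices 1, ..., N - 1 has a diagram, a product of the E_i and a weight, which
    accumulates the weights of the successive products by one generator.  The
    defining relations of the algebra scale the weights and the products by the
    same constants ([rewrites_sq], [rewrites_comm], [rewrites_down]), and they
    suffice to bring every word into the normal form attached to a permutation
    ([normal_form]).  Normal words have weight 1 ([word_weight_normal]), because
    the generator always meets a strand with the largest possible label, and
    each Okada diagram is the diagram of exactly one normal word
    ([diag_normal_inj], [diag_normal_surj]).  Now if v and w are the normal words
    of C and D, then v w rewrites to the normal word of C . D with constant the
    weight of v w, which by the cocycle identity is the weight of C o D. *)

(** * Words of up- and down-steps *)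

Section StepWords.
Implicit Types (w v : seq bool) (st : seq bool) (h l a b : nat).

Definition flip_top (c : bool) st := if st is b :: st' then (c (+) b) :: st' else [::].

(** The stack of a parenthesis matcher.  Each open up-step carries the parity of the
    number of pairs in the balanced words read directly after it, so that it is
    evenly paired exactly when its bit is set at the matching down-step; closing
    it adds these pairs and one more to the step below.  A down-step on the empty stack is unpaired. *)
Fixpoint after st w : seq bool :=
  if w is s :: w' then
    if s then after (false :: st) w'
    else if st is b :: st' then after (flip_top (~~ b) st') w' else after [::] w'
  else st.

(** The heights of the evenly paired up-steps, listed when they are closed; the
    up-steps already open are those of the stack. *)
Fixpoint evens h st w : seq nat :=
  if w is s :: w' then
    if s then evens h.+1 (false :: st) w'
    else if st is b :: st' then
      nseq b h.-1 ++ evens h.-1 (flip_top (~~ b) st') w'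
    else evens h.-1 [::] w'
  else [::].

Fixpoint level h w : nat :=
  if w is s :: w' then level (if s then h.+1 else h.-1) w' else h.

Fixpoint above l h w : bool :=
  if w is s :: w' then
    if s then (l <= h) && above l h.+1 w' else (l < h) && above l h.-1 w'
  else l <= h.

Lemma after_cat st w1 w2 : after st (w1 ++ w2) = after (after st w1) w2.
Proof. by elim: w1 st => //= -[] w IH [|b st] //=. Qed.

Lemma level_cat h w1 w2 : level h (w1 ++ w2) = level (level h w1) w2.
Proof. by elim: w1 h => //=. Qed.

Lemma evens_cat h st w1 w2 :
  evens h st (w1 ++ w2) = evens h st w1 ++ evens (level h w1) (after st w1) w2.
Proof.
by elim: w1 h st => //= -[] w IH h [|b st] //=; rewrite IH ?catA.
Qed.

Lemma above_start l h w : above l h w -> l <= h.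
Proof. by case: w => //= -[] w /andP[]// /ltnW. Qed.

Lemma above_cat l h w1 w2 :
  above l h (w1 ++ w2) = above l h w1 && above l (level h w1) w2.
Proof.
elim: w1 h => /= [|s w1 IH] h.
  by case E: (above l h w2); rewrite ?andbF ?andbT // (above_start E).
by case: s; rewrite IH andbA.
Qed.

Lemma level_down h n : level h (nseq n false) = h - n.
Proof. by elim: n h => [|n IH] h /=; rewrite ?subn0 // IH; lia. Qed.

Lemma level_up h n : level h (nseq n true) = h + n.
Proof. by elim: n h => [|n IH] h /=; rewrite ?addn0 // IH; lia. Qed.

Lemma above_down l h n : above l h (nseq n false) = (l + n <= h).
Proof. by elim: n h => [|n IH] h /=; rewrite ?addn0 // IH; lia. Qed.

Lemma above_up l h n : above l h (nseq n true) = (l <= h).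
Proof. by elim: n h => [|n IH] h //=; rewrite IH; lia. Qed.

(** ** Evenly paired steps of a walk *)

(** The number of letters up to the down-step that first reaches d + 1 below the
    start.  Started after an up-step with d = 0, it measures the distance to its
    pair. *)
Fixpoint first_return d w : option nat :=
  if w is s :: w' then
    if s then omap S (first_return d.+1 w')
    else if d is d'.+1 then omap S (first_return d' w') else Some 1
  else None.

Definition even_return w :=
  if first_return 0 w is Some t then ~~ odd t.+1./2 else false.

Fixpoint up_evens h w : seq nat :=
  if w is s :: w' then
    if s then nseq (even_return w') h ++ up_evens h.+1 w' else up_evens h.-1 w'
  else [::].

(** The contribution of the up-steps on the stack, closed while reading the word;
    c corrects the bit on top. *)
Fixpoint pending h c st w : seq nat :=
  if st is b :: st' then
    if first_return 0 w is Some t then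
      let k := odd t.-1./2 (+) (c (+) b) in
      nseq k h.-1 ++ pending h.-1 (~~ k) st' (drop t w)
    else [::]
  else [::].

Lemma first_return_gt0 d w t : first_return d w = Some t -> 0 < t <= size w.
Proof.
elim: w d t => //= -[] w IH [|d] t /=.
- by case E: (first_return _ _) => [u|] //= [<-]; have := IH _ _ E; lia.
- by case E: (first_return _ _) => [u|] //= [<-]; have := IH _ _ E; lia.
- by case=> <-.
- by case E: (first_return _ _) => [u|] //= [<-]; have := IH _ _ E; lia.
Qed.

Lemma first_return_odd d w t : first_return d w = Some t -> odd t = ~~ odd d.
Proof.
elim: w d t => //= -[] w IH [|d] t /=.
- by case E: (first_return _ _) => [u|] //= [<-] /=; rewrite (IH _ _ E) /= ?negbK.
- by case E: (first_return _ _) => [u|] //= [<-] /=; rewrite (IH _ _ E) /= ?negbK.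
- by case=> <-.
- by case E: (first_return _ _) => [u|] //= [<-] /=; rewrite (IH _ _ E) /= ?negbK.
Qed.

Lemma first_returnS d w : first_return d.+1 w =
  if first_return d w is Some t then omap (addn t) (first_return 0 (drop t w))
  else None.
Proof.
elim: w d => //= -[] w IH [|d] /=.
- rewrite (IH 1); case: (first_return 1 w) => //= t.
  by case: (first_return _ _).
- rewrite (IH d.+2); case: (first_return d.+2 w) => //= t.
  by case: (first_return _ _).
- by rewrite drop0; case: (first_return _ _).
- rewrite (IH d); case: (first_return d w) => //= t.
  by case: (first_return _ _).
Qed.

(** The machine lists pairs at the down-step, the definition of the walk at the
    up-step; the induction carries the pairs still to be closed. *)
Lemma evensE h c st w :
  perm_eq (evens h (flip_top c st) w) (up_evens h w ++ pending h c st w).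
Proof.
elim: w h c st => [|s w IH] h c st /=; first by case: st.
case: s; last first.
  case: st => [|b st] /=; first exact: (IH _ false [::]).
  rewrite drop0 perm_sym perm_catCA perm_cat2l.
  by rewrite perm_sym; exact: IH.
have /= := IH h.+1 false (false :: flip_top c st).
move/perm_trans; apply; rewrite /= /even_return /=.
case E: (first_return 0 w) => [t|] /=; last first.
  case: st => [|b st] /=; first by rewrite cats0.
  by rewrite first_returnS E /= cats0.
have /andP[t0 _] := first_return_gt0 E; have := first_return_odd E => /= t_odd.
have -> : ~~ odd t.+1./2 = odd t.-1./2.
  by lia.
rewrite addbF -catA perm_sym perm_catC -!catA perm_cat2l perm_sym perm_catC perm_cat2r.
case: st => [|b st] //=; rewrite first_returnS E /=.
case F: (first_return 0 (drop t w)) => [u|] //=.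
have /andP[u0 _] := first_return_gt0 F; have := first_return_odd F => /= u_odd.
rewrite drop_drop [u + t]addnC.
suff -> : odd u.-1./2 (+) (~~ odd t.-1./2 (+) (c (+) b)) =
          odd (t + u)./2 (+) (c (+) b) by [].
rewrite addbA; congr (_ (+) _).
by lia.
Qed.

Lemma heightE a w b p : above 0 a w -> p <= size w ->
  height (a, w, b) p = level a (take p w).
Proof.
rewrite /height /walk_start /walk_word /=.
elim: w a p => [|s w IH] a [|p] /=; rewrite ?addn0 ?subn0 //.
case: s => /=; rewrite ?leq0n /= ltnS => /= up le_p.
  by rewrite -IH // addnA addn1.
move: up => /andP[a0 up]; rewrite -IH //; lia.
Qed.

Lemma pair_ofE a w b r d v h : above 0 a w -> v = drop r w -> r <= size w ->
  level a (take r w) = h + d.+1 ->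
  ohead [seq q <- iota r.+1 (size v) | down_to (a, w, b) h q] =
  omap (addn r) (first_return d v).
Proof.
move=> up; elim: v r d => //= s v IH r d Ev le_r lev.
have lt_r: r < size w by rewrite -subn_gt0 -size_drop -Ev.
have Ev': v = drop r.+1 w by rewrite -add1n -drop_drop -Ev /= drop0.
have Es: nth true w r = s by rewrite -[r]addn0 -nth_drop -Ev.
have lev': level a (take r.+1 w) = if s then h + d.+2 else h + d.
  rewrite (take_nth true) // -cats1 level_cat lev Es /=.
  by case: s {Es Ev} => /=; lia.
rewrite {1}/down_to /= Es !heightE // lev lev'.
case: s {Es Ev} lev' => /= lev'.
  rewrite (IH r.+1 d.+1) //.
  by case: first_return => //= u; rewrite addSnnS.
case: d lev lev' => [|d] lev lev' /=.
  by rewrite addn0 addn1 !eqxx /= addn1.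
have -> : (h + d.+1 == h) = false by lia.
rewrite andbF (IH r.+1 d) //.
by case: first_return => //= u; rewrite addSnnS.
Qed.

Lemma paired_evenlyE a w b p : above 0 a w -> p < size w ->
  paired_evenly (a, w, b) p = nth false w p && even_return (drop p.+1 w).
Proof.
move=> up lt_p; rewrite /paired_evenly /up_at /walk_word /=.
case Ep: (nth false w p) => //=; rewrite /pair_of /walk_word /=.
rewrite -/(walk_word (a, w, b)).
have Hp := heightE b up (ltnW lt_p); have Hp1 := heightE b up lt_p.
have EpT: nth true w p = true by rewrite (set_nth_default false).
have lev: level a (take p.+1 w) = (height (a, w, b) p).+1.
  by rewrite (take_nth true) // -cats1 level_cat -Hp EpT.
rewrite /walk_word /=.
rewrite (_ : size w - p = (size (drop p.+1 w)).+1); last by rewrite size_drop; lia.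
rewrite /= {1}/down_to /= EpT /=.
rewrite (pair_ofE b (d := 0) up) //; last by rewrite lev addn1.
rewrite /even_return; case: first_return => //= t.
by congr (~~ odd _); lia.
Qed.

(** The product attached to a walk is read off by the stack machine, provided that
    the truncated heights are exact. *)
Lemma even_steps_prod (T : Type) (one : T) (op : Monoid.com_law one) (y : nat -> T) a w b :
  above 0 a w ->
  \big[op/one]_(p < size w | paired_evenly (a, w, b) p) y (height (a, w, b) p) =
  \big[op/one]_(h <- evens a [::] w) y h.
Proof.
move=> up; have := evensE a false [::] w; rewrite /= cats0 => E.
rewrite (perm_big _ E) /=.
transitivity (\big[op/one]_(p < size w | nth false w p && even_return (drop p.+1 w))
   y (level a (take p w))).
  apply: eq_big => [p|p _]; first exact: paired_evenlyE.
  by rewrite heightE // ltnW.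
elim: w a {up E} => [|s w IH] a /=; first by rewrite big_ord0 big_nil.
rewrite big_mkcond big_ord_recl /= drop0 -big_mkcond /= IH.
case: s => /=; last by rewrite Monoid.mul1m.
by rewrite big_cat; case: even_return => /=; rewrite ?big_cons ?big_nil ?Monoid.mulm1.
Qed.

(** ** Equivalence of words *)

(** The walk of an arc of label l between nodes of absolute values a and b. *)
Definition dive a l b := nseq (a - l) false ++ nseq (b - l) true.

Lemma evens_down h n :
  evens h [::] (nseq n false) = [::].
Proof. by elim: n h => //= n IH h; apply: IH. Qed.

Lemma evens_up h n st : evens h st (nseq n true) = [::].
Proof. by elim: n h st => //= n IH h. Qed.

Lemma evens_dive a l b : evens a [::] (dive a l b) = [::].
Proof. by rewrite /dive evens_cat evens_up evens_down. Qed.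

Lemma level_dive a l b : l <= a -> l <= b -> level a (dive a l b) = b.
Proof. by move=> la lb; rewrite level_cat level_down level_up; lia. Qed.

Lemma above_dive k a l b : k <= l -> l <= a -> l <= b -> above k a (dive a l b).
Proof.
by move=> kl la lb; rewrite above_cat above_down above_up level_down; lia.
Qed.

(** The word w acts on every stack as w' does, but closes the additional even
    pairs at the heights in L.  Quantifying over stacks is what makes the relation
    a congruence. *)
Definition reduces a w L w' := level a w = level a w' /\
  forall st, after st w = after st w' /\ perm_eq (evens a st w) (L ++ evens a st w').

Lemma reduces_refl a w : reduces a w [::] w.
Proof. by split. Qed.

Lemma reduces_cat a w1 w2 L1 L2 v1 v2 :
  reduces a w1 L1 v1 -> reduces (level a w1) w2 L2 v2 ->
  reduces a (w1 ++ w2) (L1 ++ L2) (v1 ++ v2).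
Proof.
move=> [lev1 red1] [lev2 red2]; split; first by rewrite !level_cat lev2 lev1.
move=> st; have [aft1 ev1] := red1 st; have [aft2 ev2] := red2 (after st w1).
rewrite !after_cat aft2 aft1; split=> //; rewrite !evens_cat -aft1 -lev1.
rewrite (perm_trans (perm_cat ev1 ev2)) // -!catA perm_cat2l.
by rewrite perm_catCA.
Qed.

Lemma reduces_trans a w1 w2 w3 L1 L2 :
  reduces a w1 L1 w2 -> reduces a w2 L2 w3 -> reduces a w1 (L1 ++ L2) w3.
Proof.
move=> [lev1 red1] [lev2 red2]; split; first by rewrite lev1.
move=> st; have [aft1 ev1] := red1 st; have [aft2 ev2] := red2 st.
split; first by rewrite aft1.
by rewrite (perm_trans ev1) // -catA perm_cat2l.
Qed.

Lemma reduces_evens a w L w' :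
  reduces a w L w' -> evens a [::] w' = [::] -> perm_eq L (evens a [::] w).
Proof. by case=> _ red nil; have [_] := red [::]; rewrite nil cats0 perm_sym. Qed.

Lemma reduces_perm a w L L' w' :
  perm_eq L L' -> reduces a w L w' -> reduces a w L' w'.
Proof.
move=> eqL [lev red]; split=> // st; have [-> ev] := red st; split=> //.
by rewrite (perm_trans ev) // perm_cat2r.
Qed.

Lemma reduces_normal a w L w' : reduces a w L w' -> evens a [::] w' = [::] ->
  reduces a w (evens a [::] w) w'.
Proof. by move=> red /(reduces_evens red)/reduces_perm; apply. Qed.

(** If a word reduces to w1 and to a dive, so does w1: both have the same action on
    stacks, and the even pairs of w1 are those that remain. *)
Lemma reduces_dive a w w1 L L' l b :
  reduces a w L w1 -> reduces a w L' (dive a l b) ->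
  reduces a w1 (evens a [::] w1) (dive a l b).
Proof.
move=> [lev1 red1] [lev2 red2]; split; first by rewrite -lev1.
move=> st; have [aft1 ev1] := red1 st; have [aft2 ev2] := red2 st.
split; first by rewrite -aft1.
rewrite -(perm_cat2l L) catA.
have [_ ev1'] := red1 [::]; have [_] := red2 [::].
rewrite evens_dive cats0 => ev2'; rewrite perm_sym in ev1.
rewrite (perm_trans ev1) // (perm_trans ev2) // perm_cat2r.
by rewrite perm_sym in ev2'; rewrite (perm_trans ev2').
Qed.

(** In UUDD the inner pair has distance 1 and the outer one distance 2, so that one
    even pair disappears; the distance of each pair around the factor changes by 2. *)
Lemma reduces_UUDD a : reduces a [:: true; true; false; false] [:: a] [::].
Proof. by split=> // -[|b st]; split=> //=; rewrite addbF. Qed.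

Lemma nseqS_rcons T (x : T) n : nseq n.+1 x = rcons (nseq n x) x.
Proof. by rewrite -cats1 -[[:: x]]/(nseq 1 x) -nseqD addn1. Qed.

(** An even peak is a nest of factors UUDD. *)
Lemma reduces_peak a n : ~~ odd n ->
  exists L, reduces a (nseq n true ++ nseq n false) L [::].
Proof.
move=> ev; have ->: n = n./2.*2 by lia.
elim: n./2 a => [|k IH] a; first by exists [::]; apply: reduces_refl.
have [L red] := IH a.+2; exists (L ++ [:: a]).
have E : nseq k.+1.*2 true ++ nseq k.+1.*2 false =
   [:: true; true] ++ (nseq k.*2 true ++ nseq k.*2 false) ++ [:: false; false].
  have -> : nseq k.+1.*2 false = nseq k.*2 false ++ [:: false; false].
    by rewrite doubleS -(addn2 k.*2) nseqD.
  by rewrite doubleS /= -!catA.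
rewrite E; apply: (reduces_trans (w2 := [:: true; true] ++ [::] ++ [:: false; false])).
  apply: (@reduces_cat _ _ _ [::] _ _ _ (reduces_refl _ _)).
  rewrite -[L]cats0; apply: reduces_cat => //; exact: reduces_refl.
exact: reduces_UUDD.
Qed.

(** Two arcs in a row merge into one with the smaller label.  Between the two
    minima stands a peak above the larger label, which can be deleted when its
    height is even. *)
Lemma reduces_dives a l1 c l2 b : l1 <= a -> l1 <= c -> l2 <= c -> l2 <= b ->
  ~~ odd (c - maxn l1 l2) ->
  exists L, reduces a (dive a l1 c ++ dive c l2 b) L (dive a (minn l1 l2) b).
Proof.
move=> l1a l1c l2c l2b ev; have [L red] := reduces_peak (maxn l1 l2) ev.
exists L; rewrite /dive -!catA.
set n := c - _ in red ev.
have -> : nseq (c - l1) true = nseq (maxn l1 l2 - l1) true ++ nseq n true.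
  by rewrite -nseqD; congr nseq; rewrite /n; lia.
have -> : nseq (c - l2) false = nseq n false ++ nseq (maxn l1 l2 - l2) false.
  by rewrite -nseqD; congr nseq; rewrite /n; lia.
have -> : nseq (a - minn l1 l2) false ++ nseq (b - minn l1 l2) true =
   (nseq (a - l1) false ++ nseq (maxn l1 l2 - l1) true) ++ [::] ++
   (nseq (maxn l1 l2 - l2) false ++ nseq (b - l2) true).
  rewrite -!catA /=; case: (leqP l1 l2) => l12; rewrite subnn /=.
    by rewrite -nseqD; congr (_ ++ _); congr nseq; lia.
  by rewrite catA -nseqD; congr (_ ++ _); congr nseq; lia.
set A := nseq (a - l1) _; set B := nseq (maxn _ _ - l1) _.
set M := nseq (maxn _ _ - l2) _; set Q := nseq (b - l2) _.
rewrite (_ : A ++ _ = (A ++ B) ++ (nseq n true ++ nseq n false) ++ (M ++ Q));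
  last by rewrite -!catA.
apply: (@reduces_cat _ _ _ [::] _ _ _ (reduces_refl _ _)).
rewrite -[L]cats0 level_cat level_down level_up.
rewrite (_ : _ + _ = maxn l1 l2); last by lia.
by apply: reduces_cat => //; apply: reduces_refl.
Qed.

(** ** Dyck words and closed words *)

Inductive dyck : seq bool -> Prop :=
| Dyck_nil : dyck [::]
| Dyck_cons u v : dyck u -> dyck v -> dyck (true :: u ++ false :: v).

Lemma above_le k l h w : k <= l -> above l h w -> above k h w.
Proof.
move=> kl; elim: w h => /= [|[] w IH] h; first by lia.
  by case/andP=> ? /IH ->; rewrite andbT; lia.
by case/andP=> ? /IH ->; rewrite andbT; lia.
Qed.

(** Cut at the first step below the starting level. *)
Lemma above_split l h w : l < h -> above l h w -> level h w = l ->
  exists u v, [/\ w = u ++ false :: v, above h h u, level h u = h & above l h.-1 v].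
Proof.
have [n] := ubnP (size w); elim: n w h => // n IH [|s w] h /= sz lh.
  by move=> _ E; lia.
case: s => /andP[_ up] lev; last by exists [::], w; split=> //=; rewrite leqnn.
have [||u1 [v1 [E1 up1 lev1 up1']]] := IH w h.+1 _ _ up lev; try by lia.
case: (ltngtP l h) lh => // {}lh _.
have szv : size v1 < n by move: sz; rewrite E1 size_cat /=; lia.
have lev1' : level h v1 = l by rewrite -lev E1 level_cat lev1.
have [u2 [v2 [E2 up2 lev2 up2']]] := IH v1 h szv lh up1' lev1'.
exists (true :: u1 ++ false :: u2), v2; split=> //.
- by rewrite E1 E2 /= -catA.
- by rewrite /= leqnn above_cat (above_le _ up1) //= lev1 /= leqnn.
- by rewrite /= level_cat lev1.
Qed.

Lemma above_dyck l w : above l l w -> level l w = l -> dyck w.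
Proof.
have [n] := ubnP (size w); elim: n w l => // n IH [|s w] l /= sz.
  by move=> *; constructor.
case: s => [/andP[_ up] lev|/andP[]]; last by rewrite ltnn.
have [//|u [v [E up1 lev1 up1']]] := above_split _ up lev.
have lev' : level l v = l by rewrite -[RHS]lev E level_cat lev1.
by rewrite E; constructor; [apply: (IH u l.+1)|apply: (IH v l)] => //;
  move: sz; rewrite E size_cat /=; lia.
Qed.

Lemma dyck_even w : dyck w -> ~~ odd (size w).
Proof. by elim=> // u v _ IHu _ IHv /=; rewrite size_cat /= oddD /=; case: odd IHu; case: odd IHv. Qed.

Lemma flip_topD c d st : flip_top c (flip_top d st) = flip_top (c (+) d) st.
Proof. by case: st => //= b st; rewrite addbA. Qed.

Lemma dyck_after st w : dyck w -> after st w = flip_top (odd (size w)./2) st.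
Proof.
move=> dw; elim: dw st => [|u v du IHu dv IHv] st /=; first by case: st.
rewrite after_cat IHu /= IHv flip_topD; congr flip_top.
rewrite size_cat /=; have := dyck_even du; have := dyck_even dv; lia.
Qed.

Lemma dyck_level h w : dyck w -> level h w = h.
Proof. by move=> dw; elim: dw h => //= u v _ IHu _ IHv h; rewrite level_cat IHu /= IHv. Qed.

Lemma dyck_evens h st w : dyck w -> evens h st w = evens h [::] w.
Proof.
move=> dw; elim: dw h st => //= u v du IHu dv IHv h st.
rewrite !evens_cat /= !dyck_after // !dyck_level //=.
by rewrite (IHu _ (false :: st)) (IHu _ [:: false]) (IHv _ (flip_top _ st)).
Qed.

(** The walk traversed backwards. *)
Definition rflip w := map negb (rev w).

Lemma rflip_cat w1 w2 : rflip (w1 ++ w2) = rflip w2 ++ rflip w1.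
Proof. by rewrite /rflip rev_cat map_cat. Qed.

Lemma rflip_cons s w : rflip (s :: w) = rcons (rflip w) (~~ s).
Proof. by rewrite /rflip rev_cons map_rcons. Qed.

Lemma rflip_nseq n s : rflip (nseq n s) = nseq n (~~ s).
Proof. by rewrite /rflip rev_nseq map_nseq. Qed.

Lemma rflip_dive a l b : rflip (dive a l b) = dive b l a.
Proof. by rewrite rflip_cat !rflip_nseq. Qed.

Lemma dyck_cat u v : dyck u -> dyck v -> dyck (u ++ v).
Proof. by move=> du dv; elim: du => //= a b da _ db IH; rewrite -catA /=; constructor. Qed.

Lemma dyck_rflip w : dyck w -> dyck (rflip w).
Proof.
elim=> [|u v _ IHu _ IHv]; first by constructor.
rewrite rflip_cons rflip_cat rflip_cons -cats1 cat_rcons -catA /=.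
by apply: dyck_cat => //; constructor => //; constructor.
Qed.

(** Reflection exchanges the two steps of a pair and keeps its distance and height. *)
Lemma evens_rflip h w : dyck w -> perm_eq (evens h [::] (rflip w)) (evens h [::] w).
Proof.
move=> dw; elim: dw h => [|u v du IHu dv IHv] h //=.
rewrite rflip_cons rflip_cat rflip_cons -cats1 cat_rcons -catA /=.
have [du' dv'] := (dyck_rflip du, dyck_rflip dv).
rewrite !evens_cat /= !evens_cat /= !(dyck_after, dyck_level) //=.
rewrite (dyck_evens _ [:: _] du') (dyck_evens _ [:: _] du).
rewrite size_map size_rev cats0 perm_catC -catA.
by rewrite perm_cat // perm_cat2l.
Qed.

Lemma level_rflip h w : above 0 h w -> level (level h w) (rflip w) = h.
Proof.
elim: w h => //= s w IH h up; rewrite rflip_cons -cats1 level_cat IH.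
  by case: s up => //= /andP[]; lia.
by case: s up => //= /andP[].
Qed.

Lemma above_rflip l h w : above l h w -> above l (level h w) (rflip w).
Proof.
elim: w h => //= s w IH h up; rewrite rflip_cons -cats1 above_cat.
have up': above l (if s then h.+1 else h.-1) w by case: s up => /andP[].
rewrite IH // level_rflip /=; last exact: above_le up'.
by case: s up {up'} => /= /andP[]; lia.
Qed.

Lemma size_after l h st w : above l h w -> size st + l <= h ->
  size (after st w) + l <= level h w.
Proof.
elim: w h st => //= -[] w IH h st /andP[lh up] sz; first by apply: IH => //=; lia.
case: st sz => [|b st] /= sz; apply: IH => //=; first by lia.
by case: st sz => //= *; lia.
Qed.

(** The word of a loop is paired around the circle: the up-steps left open by a
    first turn are closed by the second one. *)
Definition cyclic_evens a w := evens a (after [::] w) w.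

(** From a lowest point on, the cyclic pairing is the ordinary one: the word q ++ p
    never closes a step that it has not opened. *)
Lemma cyclic_evens_rot a l p q : level a p = l -> above l a p ->
  level l q = a -> above l l q ->
  perm_eq (cyclic_evens a (p ++ q)) (evens l [::] (q ++ p)).
Proof.
move=> levp upp levq upq; rewrite /cyclic_evens after_cat.
have szq := size_after (st := [::]) upq (leqnn _).
have nilp st : size st + l <= a -> after st p = [::].
  by move/(size_after upp); rewrite levp; case: after => //= *; lia.
rewrite (nilp [::]); last exact: above_start upp.
by rewrite !evens_cat nilp -1?levq // levq levp perm_catC.
Qed.

Lemma lowest_split a w : above 0 a w ->
  exists p q, w = p ++ q /\ above (level a p) a w.
Proof.
elim: w a => [|s w IH] a /=; first by exists [::], [::]; split=> //=.
case: s => /= [/IH[p [q [-> up]]]|/andP[a0 /IH[p [q [-> up]]]]]; last first.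
  exists (false :: p), q; split=> //=; rewrite up andbT.
  by have := above_start up; lia.
have [le_a|gt_a] := leqP (level a.+1 p) a.
  by exists (true :: p), q; split=> //=; rewrite up le_a.
by exists [::], (true :: p ++ q); split=> //=; rewrite leqnn (above_le _ up) // ltnW.
Qed.

(** The cyclic pairing does not depend on the starting point, as every starting
    point compares with the lowest one. *)
Lemma cyclic_evensC a w1 w2 : above 0 a (w1 ++ w2) -> level a (w1 ++ w2) = a ->
  perm_eq (cyclic_evens a (w1 ++ w2)) (cyclic_evens (level a w1) (w2 ++ w1)).
Proof.
move=> up lev; have [p [q [E up']]] := lowest_split up.
have [r [[E1 E2]|[E1 E2]]] : exists r, (w1 = p ++ r /\ q = r ++ w2) \/
    (p = w1 ++ r /\ w2 = r ++ q).
  have : take (size p) (w1 ++ w2) = p by rewrite E take_size_cat.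
  have : drop (size p) (w1 ++ w2) = q by rewrite E drop_size_cat.
  rewrite take_cat drop_cat; case: ltnP => [_ <- Ep|le_p].
    by exists (drop (size p) w1); left; rewrite -{1}Ep cat_take_drop.
  move=> Eq Ep; exists (take (size p - size w1) w2); right.
  by rewrite -{1}Eq cat_take_drop.
- move: up lev up' {E}; rewrite E1 -catA !above_cat !level_cat.
  set l := level a p; set b := level l r => up lev /and3P[u1 u2 u3].
  have c1 := @cyclic_evens_rot a l p (r ++ w2).
  have c2 := @cyclic_evens_rot b l (w2 ++ p) r.
  rewrite (perm_trans (c1 _ _ _ _)) ?level_cat ?above_cat ?u2 ?u3 ?lev //.
  by rewrite perm_sym [w2 ++ p ++ r]catA -[(r ++ w2) ++ p]catA c2 //
    ?level_cat ?above_cat ?lev ?u3.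
- move: up lev up' {E}; rewrite E1 E2 catA !above_cat !level_cat.
  set b := level a w1; set l := level b r => up lev /andP[/andP[u1 u2] u3].
  have c1 := @cyclic_evens_rot a l (w1 ++ r) q.
  have c2 := @cyclic_evens_rot b l r (q ++ w1).
  rewrite (perm_trans (c1 _ _ _ _)) ?level_cat ?above_cat ?u1 ?u2 ?lev //.
  by rewrite perm_sym -[(r ++ q) ++ w1]catA [q ++ w1 ++ r]catA c2 //
    ?level_cat ?above_cat ?lev ?u3.
Qed.

Lemma cyclic_evens_rflip a w : above 0 a w -> level a w = a ->
  perm_eq (cyclic_evens a (rflip w)) (cyclic_evens a w).
Proof.
move=> up lev; have [p [q [E]]] := lowest_split up.
move: lev; rewrite {}E {w up} level_cat above_cat rflip_cat.
set l := level a p => lev /andP[u1 u2].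
rewrite perm_sym (perm_trans (cyclic_evens_rot (l := l) _ _ _ _)) // perm_sym.
have levr : level a (rflip q) = l by rewrite -{1}lev level_rflip // (above_le _ u2).
have levr' : level l (rflip p) = a by rewrite level_rflip // (above_le _ u1).
rewrite (perm_trans (cyclic_evens_rot (l := l) levr _ levr' _)) //.
- by rewrite -{1}lev above_rflip.
- exact: above_rflip.
rewrite -rflip_cat; apply: evens_rflip; apply: (above_dyck (l := l)).
  by rewrite above_cat u2 lev.
by rewrite level_cat lev.
Qed.

Lemma reduces_cyclic a w L w' : reduces a w L w' ->
  perm_eq (cyclic_evens a w) (L ++ cyclic_evens a w').
Proof.
case=> _ red; rewrite /cyclic_evens.
by have [-> _] := red [::]; have [] := red (after [::] w').
Qed.

(** Pair w up to a Dyck word by a climb and a descent.  Reversal preserves the even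
    pairs of Dyck words, and the pairs that come from the closure are the same for
    w and for the dive to which w reduces, so that they cancel. *)
Lemma evens_reverse a l b w : l <= a -> l <= b -> above l a w ->
  reduces a w (evens a [::] w) (dive a l b) ->
  reduces b (rflip w) (evens b [::] (rflip w)) (dive b l a) ->
  perm_eq (evens b [::] (rflip w)) (evens a [::] w).
Proof.
move=> la lb up red red'.
(* The closed-up word has the even pairs of v and those of the closed-up dive. *)
have closure c d v : l <= c -> l <= d -> reduces c v (evens c [::] v) (dive c l d) ->
   perm_eq (evens l [::] (nseq (c - l) true ++ v ++ nseq (d - l) false))
     (evens c [::] v ++
      evens l [::] (nseq (c - l) true ++ dive c l d ++ nseq (d - l) false)).
  move=> lc ld [lev redv].
  rewrite !(evens_cat _ _ (nseq _ true)) evens_up /= !evens_cat level_up subnKC //.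
  rewrite lev; have [-> ev] := redv (after [::] (nseq (c - l) true)).
  by rewrite catA perm_cat2r -evens_cat.
have lev : level a w = b by case: red => ->; rewrite level_dive.
have := closure _ _ _ la lb red; have := closure _ _ _ lb la red'.
set W' := nseq (b - l) true ++ _; set Z' := nseq (b - l) true ++ dive _ _ _ ++ _.
set W := nseq (a - l) true ++ w ++ _; set Z := nseq (a - l) true ++ dive _ _ _ ++ _.
have EW : W' = rflip W by rewrite /W !rflip_cat !rflip_nseq -catA.
have EZ : Z' = rflip Z by rewrite /Z' /Z /dive !rflip_cat !rflip_nseq -!catA.
have dW : dyck W.
  apply: (above_dyck (l := l)); last first.
    by rewrite !level_cat level_up subnKC // lev level_down; lia.
  by rewrite !above_cat above_up level_up subnKC // lev above_down leqnn up subnKC /=.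
have dZ : dyck Z.
  apply: (above_dyck (l := l)); last first.
    by rewrite level_cat level_up subnKC // level_cat level_dive // level_down; lia.
  rewrite above_cat above_up level_up subnKC // above_cat level_dive //.
  by rewrite above_down leqnn above_dive // subnKC /=.
rewrite EW EZ => e1 e2.
rewrite -(perm_cat2r (evens l [::] Z)).
rewrite -(permPr e2) -(permPr (evens_rflip l dW)) (permPr e1) perm_cat2l.
by rewrite perm_sym evens_rflip.
Qed.

End StepWords.

(** * Strands of a glued diagram *)

(** Arcs glued along their ends: opp exchanges the two ends of an arc, glu the two
    ends that are identified, and glu e = e when e is a free end of a path.  A
    strand visits the ends from which its arcs are entered.  The predicate
    positive singles out one of the two directions on every strand. *)
Record tangle := Tangle {
  tend :> finType;
  opp : tend -> tend;
  glu : tend -> tend;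
  tabs : tend -> nat;
  tlab : tend -> nat;
  positive : pred tend;
  oppK : involutive opp;
  gluK : involutive glu;
  tabs_glu e : tabs (glu e) = tabs e;
  tlab_opp e : tlab (opp e) = tlab e;
  tlab_abs e : tlab e <= tabs e;
  positive_opp e : positive (opp e) = ~~ positive e;
  positive_glu e : glu e != e -> positive (glu e) = ~~ positive e
}.
Arguments opp {t}. Arguments glu {t}. Arguments tabs {t}. Arguments tlab {t}.
Arguments positive {t}.

Lemma orbit_cons (T : finType) (f : T -> T) x p :
  fcycle f (x :: p) -> x \notin p -> orbit f x = x :: p.
Proof.
move=> cyc xp; have [k] := fcycle_consEflatten cyc.
case: k => [|k] /= E; first by rewrite E cats0.
have Eo : orbit f x = x :: behead (orbit f x) by rewrite /orbit -orderSpred.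
move: E; rewrite {1}Eo => -[Ep]; case/negP: xp.
by rewrite Ep !mem_cat in_orbit orbT.
Qed.

Section Tangle.
Variable G : tangle.
Implicit Types (e f s : G) (r : seq G).

(** The orbits of nxt are the oriented loops, and the paths run back and forth. *)
Definition nxt e := glu (opp e).
Definition exposed e := glu e == e.
Definition halts e := exposed (opp e).

Lemma nxt_inj : injective nxt.
Proof. by move=> e f /(can_inj (@gluK G))/(can_inj (@oppK G)). Qed.

Lemma nxt_opp e : nxt (opp e) = glu e.
Proof. by rewrite /nxt oppK. Qed.

Lemma exposed_glu e : exposed (glu e) = exposed e.
Proof. by rewrite /exposed gluK eq_sym. Qed.

Lemma nxt_halt e : halts e -> nxt e = opp e.
Proof. by move=> /eqP. Qed.

Lemma positive_nxt e : ~~ halts e -> positive (nxt e) = positive e.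
Proof. by move=> ne; rewrite positive_glu // positive_opp negbK. Qed.

Lemma tabs_nxt e : tabs (nxt e) = tabs (opp e).
Proof. exact: tabs_glu. Qed.

(** The ends met on the way from e up to the end of a path. *)
Inductive route : G -> seq G -> Prop :=
| Route_halt e : halts e -> route e [:: e]
| Route_step e r : ~~ halts e -> route (nxt e) r -> route e (e :: r).

Lemma route_det e r r' : route e r -> route e r' -> r = r'.
Proof.
move=> Rr; elim: Rr r' => {e r} [e he|e r he _ IH] r' Rr'.
  by inversion Rr' => //; rewrite he in H.
inversion Rr' as [? he'|? ? _ Rn]; first by rewrite he' in he.
by rewrite (IH _ Rn).
Qed.

Lemma route_cons e r : route e r -> r = e :: behead r.
Proof. by case. Qed.

Definition chain e := take (find halts (orbit nxt e)).+1 (orbit nxt e).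

Lemma chain_route e : has halts (orbit nxt e) -> route e (chain e).
Proof.
move=> he; rewrite /chain; have := he; rewrite has_find size_orbit.
set k := find _ _ => ltk; rewrite take_traject //.
have nthE i : i < fingraph.order nxt e -> nth e (orbit nxt e) i = iter i nxt e.
  by move=> lti; rewrite nth_traject.
have: halts (iter k nxt e) by rewrite -nthE // nth_find.
have: forall i, i < k -> ~~ halts (iter i nxt e).
  by move=> i ltik; rewrite -nthE ?(ltn_trans ltik) // before_find.
clear he ltk nthE; clearbody k; elim: k e => [|k IH] e before at_k; first exact: Route_halt.
rewrite trajectS; apply: Route_step; first exact: (before 0).
apply: IH; last by rewrite -iterSr.
by move=> i ltik; rewrite -iterSr before.
Qed.

Definition loop e := ~~ has exposed (orbit nxt e).

Lemma orbit_sym e f : (f \in orbit nxt e) = (e \in orbit nxt f).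
Proof. by rewrite -!fconnect_orbit fconnect_sym //; exact: nxt_inj. Qed.

Lemma orbit_eq e f : f \in orbit nxt e -> orbit nxt f =i orbit nxt e.
Proof.
rewrite -fconnect_orbit => cef g; rewrite -!fconnect_orbit.
exact/esym/(same_connect (fconnect_sym nxt_inj)).
Qed.

Lemma has_halts e : has halts (orbit nxt e) = has exposed (orbit nxt e).
Proof.
apply/hasP/hasP => -[f fe].
  by move=> hf; exists (opp f) => //; rewrite -(nxt_halt hf) mem_orbit.
move=> ff; exists (opp f); last by rewrite /halts oppK.
have E: nxt (opp f) = f by rewrite nxt_opp; apply/eqP.
by rewrite -(orbit_eq fe) orbit_sym -{1}E mem_orbit // in_orbit.
Qed.

Lemma loop_orbit e f : f \in orbit nxt e -> loop f = loop e.
Proof. by move=> /orbit_eq/eq_has_r E; rewrite /loop E. Qed.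

Lemma exposed_nloop e : exposed e -> ~~ loop e.
Proof. by move=> fe; rewrite negbK; apply/hasP; exists e => //; apply: in_orbit. Qed.

Lemma chain_nloop e : ~~ loop e -> route e (chain e).
Proof. by rewrite negbK -has_halts; apply: chain_route. Qed.

Lemma chain_exposed e : exposed e -> route e (chain e).
Proof. by move=> /exposed_nloop/chain_nloop. Qed.

Lemma route_chain e r : route e r -> chain e = r.
Proof.
move=> R; apply: (route_det _ R); apply: chain_route.
elim: R => {e r} [e he|e r he _ IH]; first by apply/hasP; exists e => //; apply: in_orbit.
have/hasP[f fe hf] := IH; apply/hasP; exists f => //.
by rewrite -(@orbit_eq e (nxt e)) // mem_orbit // in_orbit.
Qed.

Lemma loop_halts e f : loop e -> f \in orbit nxt e -> ~~ halts f.
Proof.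
by rewrite /loop -has_halts => /hasPn/(_ f).
Qed.

Lemma loop_positive e f : loop e -> f \in orbit nxt e -> positive f = positive e.
Proof.
move=> le; rewrite -fconnect_orbit => /iter_findex <-.
elim: (findex _ _ _) => //= i IH; rewrite positive_nxt //.
by rewrite (loop_halts le) // -fconnect_orbit fconnect_iter.
Qed.

Lemma route_positive e r f : route e r -> f \in r -> positive f = positive e.
Proof.
elim=> {e r} [e he|e r he _ IH]; first by rewrite inE => /eqP ->.
rewrite inE => /orP[/eqP-> //|].
by move=> /IH ->; rewrite positive_nxt.
Qed.

Lemma route_last e r : route e r -> halts (last e r).
Proof. by elim=> //= {}e {}r he R; rewrite {1}(route_cons R) /=; rewrite {2}(route_cons R). Qed.

Lemma route_path e r : route e r -> fpath nxt e (behead r).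
Proof. by elim=> //= {}e {}r he R IH; rewrite (route_cons R) /= eqxx. Qed.

Lemma route_bound e r f : route e r -> f \in behead r -> ~~ exposed f.
Proof.
elim=> {e r} [e he|e r he R IH] //=; rewrite (route_cons R) inE.
by case/orP=> [/eqP->|//]; rewrite exposed_glu.
Qed.

Lemma route_rev_cat e r t : route e r -> route (opp e) t ->
  route (opp (last e r)) (map opp (rev (behead r)) ++ t).
Proof.
move=> R; elim: R t => {e r} [e he|e r he R IH] t Rt //=.
have Rn : route (opp (nxt e)) (opp (nxt e) :: t).
  apply: Route_step; first by rewrite /halts oppK exposed_glu.
  by rewrite nxt_opp /nxt gluK.
have := IH _ Rn.
by rewrite (route_cons R) /= rev_cons map_rcons cat_rcons.
Qed.

Lemma route_rev e r : exposed e -> route e r ->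
  route (opp (last e r)) (map opp (rev r)).
Proof.
move=> fe R; rewrite (route_cons R) rev_cons map_rcons -cats1 /=.
have Re: route (opp e) [:: opp e] by apply: Route_halt; rewrite /halts oppK.
by have := route_rev_cat R Re; rewrite {1}(route_cons R).
Qed.

Definition target e := opp (last e (chain e)).

Lemma target_exposed e : exposed e -> exposed (target e).
Proof. by move=> /chain_exposed/route_last. Qed.

Lemma positive_target e : exposed e -> positive (target e) = ~~ positive e.
Proof.
move=> /chain_exposed R; rewrite /target positive_opp (route_positive R) //.
by rewrite (route_cons R) /= mem_last.
Qed.

Lemma chain_target e : exposed e -> chain (target e) = map opp (rev (chain e)).
Proof. by move=> fe; apply/route_chain/route_rev => //; apply: chain_exposed. Qed.

Lemma targetK e : exposed e -> target (target e) = e.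
Proof.
move=> fe; rewrite {1}/target chain_target //.
rewrite (route_cons (chain_exposed fe)) rev_cons map_rcons last_rcons.
exact: oppK.
Qed.

(** The orbit of a free end follows its path to the other free end and back; the
    two halves have no common element because positive separates them. *)
Lemma orbit_exposed e : exposed e -> orbit nxt e = chain e ++ chain (target e).
Proof.
move=> fe; have R := chain_exposed fe; have R' := chain_exposed (target_exposed fe).
have E : chain e ++ chain (target e) = e :: behead (chain e) ++ chain (target e).
  by rewrite {1}(route_cons R).
rewrite E; apply: orbit_cons; last first.
  rewrite mem_cat negb_or; apply/andP; split.
    by apply/negP=> /(route_bound R); rewrite fe.
  apply/negP=> /(route_positive R'); rewrite positive_target //.
  by case: positive.
have lastE : last e (behead (chain e)) = last e (chain e).
  by rewrite {2}(route_cons R).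
have lastE' : last (target e) (behead (chain (target e))) = opp e.
  rewrite -(congr1 opp (targetK fe)) {1}[in RHS]/target oppK.
  by rewrite {2}(route_cons R').
rewrite /= rcons_cat cat_path (route_path R) /= lastE.
rewrite {1}(route_cons R') /= rcons_path (route_path R') lastE' /= andbC.
rewrite /nxt oppK -/(exposed e) fe /=.
by rewrite -/(nxt _) (nxt_halt (route_last R)) eqxx.
Qed.

Lemma route_sub_orbit e r : route e r -> {subset r <= orbit nxt e}.
Proof.
elim=> {e r} [e he|e r he R IH] f; first by rewrite inE => /eqP ->; apply: in_orbit.
rewrite inE => /orP[/eqP->|]; first exact: in_orbit.
by move=> /IH; rewrite (@orbit_eq e (nxt e)) // mem_orbit // in_orbit.
Qed.

Lemma nloop_source e : ~~ loop e -> positive e ->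
  exists s, [/\ exposed s, positive s & e \in chain s].
Proof.
rewrite negbK => /hasP[s se fs] pe.
have inch t : exposed t -> positive t -> t \in orbit nxt e -> e \in chain t.
  move=> ft pt; rewrite orbit_sym orbit_exposed // mem_cat => /orP[//|].
  move/(route_positive (chain_exposed (target_exposed ft))).
  by rewrite positive_target // pe pt.
case ps: (positive s); first by exists s; rewrite inch.
exists (target s); rewrite target_exposed // positive_target // ps; split=> //.
apply: inch; rewrite ?target_exposed ?positive_target ?ps //.
rewrite -(orbit_eq se) orbit_exposed // mem_cat.
by rewrite (route_cons (chain_exposed (target_exposed fs))) mem_head orbT.
Qed.

Lemma chain_source s t e : exposed s -> exposed t -> positive s -> positive t ->
  e \in chain s -> e \in chain t -> s = t.
Proof.
move=> fs ft ps pt es et.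
have es' := route_sub_orbit (chain_exposed fs) es.
have et' := route_sub_orbit (chain_exposed ft) et.
have : s \in orbit nxt t by rewrite -(orbit_eq et') orbit_sym.
rewrite orbit_exposed // mem_cat => /orP[|].
  rewrite (route_cons (chain_exposed ft)) inE => /orP[/eqP-> //|].
  by move=> /(route_bound (chain_exposed ft)); rewrite fs.
move/(route_positive (chain_exposed (target_exposed ft))).
by rewrite positive_target // ps pt.
Qed.

Lemma route_uniq e r : route e r -> ~~ loop e -> uniq r.
Proof.
move=> /route_chain <- _; rewrite /chain take_uniq //; exact: orbit_uniq.
Qed.

Definition loop_root e := [&& positive e, froots nxt e & loop e].

(** Every positive end lies on exactly one positive path or loop. *)
Lemma big_strands (R : Type) (one : R) (op : Monoid.com_law one) (F : G -> R) :
  \big[op/one]_(e | positive e) F e =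
  op (\big[op/one]_(s | positive s && exposed s) \big[op/one]_(e <- chain s) F e)
     (\big[op/one]_(s | loop_root s) \big[op/one]_(e <- orbit nxt s) F e).
Proof.
rewrite (bigID loop) /= Monoid.mulmC; congr (op _ _).
  pose src e := odflt e [pick s | [&& exposed s, positive s & e \in chain s]].
  rewrite (partition_big src (fun s => positive s && exposed s)) /=.
    apply: eq_bigr => s /andP[ps fs]; have R' := chain_exposed fs.
    rewrite big_uniq /=; last exact: route_uniq R' (exposed_nloop fs).
    apply: eq_bigl => e; apply/idP/idP.
      case/andP=> /andP[pe ne] /eqP <-; rewrite /src.
      case: pickP => [t /and3P[] //|no].
      by have [t [ft pt et]] := nloop_source ne pe; have := no t; rewrite ft pt et.
    move=> es; rewrite (route_positive R' es) ps /=.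
    rewrite (loop_orbit (route_sub_orbit R' es)) exposed_nloop //=.
    rewrite /src; case: pickP => [t /and3P[ft pt et]|no] /=.
      by apply/eqP/(chain_source (e := e)).
    by have := no s; rewrite fs ps es.
  move=> e /andP[pe ne]; rewrite /src; case: pickP => [t /and3P[-> -> _] //|no].
  by have [t [ft pt et]] := nloop_source ne pe; have := no t; rewrite ft pt et.
have sym := fconnect_sym nxt_inj.
rewrite (partition_big (froot nxt) loop_root) /=.
  apply: eq_bigr => s /and3P[ps rs ls]; rewrite big_uniq ?orbit_uniq //=.
  have rootE e : (froot nxt e == s) = (e \in orbit nxt s).
    by rewrite -{1}(eqP rs) root_connect // sym fconnect_orbit.
  apply: eq_bigl => e; rewrite rootE.
  apply/andP/idP => [[_ //]|es]; split=> //.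
  by rewrite (loop_positive ls es) ps (loop_orbit es).
move=> e /andP[pe le]; have ce : froot nxt e \in orbit nxt e.
  by rewrite -fconnect_orbit connect_root.
by rewrite /loop_root (loop_positive le ce) pe roots_root // (loop_orbit ce).
Qed.

(** ** Words and weights of strands *)

Definition arcw e := dive (tabs e) (tlab e) (tabs (opp e)).
Definition word r := flatten (map arcw r).
Definition low e r := foldr (fun f => minn (tlab f)) (tlab e) r.

Lemma tlab_abs_opp e : tlab e <= tabs (opp e).
Proof. by rewrite -tlab_opp tlab_abs. Qed.

Lemma leq_low l e r : (l <= low e r) = (l <= tlab e) && all (fun f => l <= tlab f) r.
Proof. by elim: r => [|f r IH] /=; rewrite ?andbT // leq_min IH andbCA. Qed.

Lemma low_mem e r r' e' : e \in r -> e' \in r' -> r =i r' -> low e r = low e' r'.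
Proof.
have low_all f (q : seq G) l : f \in q -> (l <= low f q) = all (fun g => l <= tlab g) q.
  by move=> fs; rewrite leq_low andb_idl // => /allP/(_ f fs).
move=> er er' eqr; apply/eqP; rewrite eqn_leq !low_all //.
apply/andP; split; first by rewrite -(eq_all_r eqr) -(low_all e).
by rewrite (eq_all_r eqr) -(low_all e').
Qed.

Lemma level_arcw e : level (tabs e) (arcw e) = tabs (opp e).
Proof. by rewrite level_dive ?tlab_abs ?tlab_abs_opp. Qed.

Lemma above_arcw l e : l <= tlab e -> above l (tabs e) (arcw e).
Proof. by move=> le; rewrite above_dive ?tlab_abs ?tlab_abs_opp. Qed.

Lemma word_cat r1 r2 : word (r1 ++ r2) = word r1 ++ word r2.
Proof. by rewrite /word map_cat flatten_cat. Qed.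

Lemma path_word l e r : fpath nxt e r -> all (fun f => l <= tlab f) (e :: r) ->
  level (tabs e) (word (e :: r)) = tabs (opp (last e r)) /\
  above l (tabs e) (word (e :: r)).
Proof.
rewrite /word /=; elim: r e => [|f r IH] e /=.
  by rewrite cats0 level_arcw andbT => _ /above_arcw.
case/andP=> /eqP ef pf /andP[le lf].
rewrite level_cat above_cat level_arcw above_arcw // -tabs_nxt ef.
exact: IH.
Qed.

Lemma word_cons e r : word (e :: r) = arcw e ++ word r.
Proof. by []. Qed.

Lemma word1 e : word [:: e] = arcw e.
Proof. by rewrite /word /= cats0. Qed.

Lemma rflip_word r : rflip (word r) = word (map opp (rev r)).
Proof.
elim: r => //= e r IH; rewrite rflip_cat IH rev_cons map_rcons -cats1 word_cat.
by congr (_ ++ _); rewrite /word /= cats0 /arcw rflip_dive tlab_opp oppK.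
Qed.

Definition strand_low e := low e (chain e).
Definition strand_evens e := evens (tabs e) [::] (word (chain e)).
Definition loop_low e := low e (orbit nxt e).
Definition loop_evens e := cyclic_evens (tabs e) (word (orbit nxt e)).

Lemma loop_word e : level (tabs e) (word (orbit nxt e)) = tabs e /\
  above (loop_low e) (tabs e) (word (orbit nxt e)).
Proof.
have := cycle_orbit nxt_inj e; have E : orbit nxt e = e :: behead (orbit nxt e).
  by rewrite /orbit -orderSpred.
rewrite E /= rcons_path => /andP[pe /eqP le].
have [| -> ->] := @path_word (loop_low e) e (behead (orbit nxt e)) pe.
  by have := leqnn (loop_low e); rewrite {2}/loop_low leq_low E => /andP[_].
by rewrite -tabs_nxt le.
Qed.

Lemma orbit_head e : orbit nxt e = e :: behead (orbit nxt e).
Proof. by rewrite /orbit -orderSpred. Qed.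

Lemma orbit_nxt e : orbit nxt (nxt e) = rot 1 (orbit nxt e).
Proof.
have cyc := cycle_orbit nxt_inj e; have uq := orbit_uniq nxt e.
rewrite (orbitE cyc uq) ?mem_orbit ?in_orbit //; move: cyc uq.
rewrite orbit_head; case: behead => [|f r].
  by case: index => [|n]; rewrite ?rot0 !rot_oversize.
by rewrite /=; case/andP=> /eqP -> _ /andP[]; rewrite inE eqxx => /norP[/negbTE-> _] _.
Qed.

Lemma loop_evens_nxt e : perm_eq (loop_evens e) (loop_evens (nxt e)).
Proof.
have [lev up] := loop_word e; have up0 := above_le (leq0n _) up.
have W1 : word [:: e] = arcw e by rewrite /word /= cats0.
rewrite /loop_evens orbit_nxt; move: lev up0.
rewrite orbit_head /rot /= drop0 take0 -[e :: _]cat1s !word_cat => lev up0.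
by have := cyclic_evensC up0 lev; rewrite W1 level_arcw tabs_nxt.
Qed.

Lemma loop_evens_orbit e f : f \in orbit nxt e -> perm_eq (loop_evens e) (loop_evens f).
Proof.
rewrite -fconnect_orbit => /iter_findex <-; elim: (findex _ _ _) => //= i IH.
by rewrite (perm_trans IH) // loop_evens_nxt.
Qed.

Lemma loop_low_orbit e f : f \in orbit nxt e -> loop_low e = loop_low f.
Proof.
move=> fe; apply: low_mem; rewrite ?in_orbit //.
by move=> g; rewrite (orbit_eq fe).
Qed.

Section Weight.
Variables (K : fieldType) (x y : nat -> K).
Local Open Scope ring_scope.

Definition evens_weight (L : seq nat) : K := \prod_(h <- L) y h.
Definition loop_weight e : K := x (loop_low e) * evens_weight (loop_evens e).

(** Each path and each loop is counted once, in its positive direction. *)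
Definition weight : K :=
  (\prod_(s | positive s && exposed s) evens_weight (strand_evens s)) *
  \prod_(s | loop_root s) loop_weight s.

Lemma loop_weight_orbit e f : f \in orbit nxt e -> loop_weight f = loop_weight e.
Proof.
move=> fe; rewrite /loop_weight (loop_low_orbit fe) /evens_weight.
by rewrite (perm_big _ (loop_evens_orbit fe)).
Qed.

End Weight.
End Tangle.

(** * Contraction of strands *)

Lemma big_inj_image (R : Type) (one : R) (op : Monoid.com_law one)
    (I J : finType) (h : I -> J) (P : pred J) (F : J -> R) :
  injective h -> (forall j, P j -> exists i, j = h i) ->
  \big[op/one]_(j | P j) F j = \big[op/one]_(i | P (h i)) F (h i).
Proof.
move=> inj_h onto; transitivity (\big[op/one]_(j in h @: [set i | P (h i)]) F j).
  apply: eq_bigl => j; apply/idP/imsetP => [Pj|[i]]; last by rewrite inE => Pi ->.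
  by have [i Ej] := onto j Pj; exists i; rewrite // inE -Ej.
rewrite big_imset; last by move=> i j _ _; apply: inj_h.
by apply: eq_bigl => i; rewrite inE.
Qed.

Lemma route_nloop (G : tangle) (e : G) r : route e r -> ~~ loop e.
Proof.
elim=> {e r} [e he|e r he _]; last first.
  by rewrite (@loop_orbit _ e (nxt e)) // mem_orbit // in_orbit.
by rewrite negbK -has_halts; apply/hasP; exists e => //; apply: in_orbit.
Qed.

Lemma route_path_cat (G : tangle) (e : G) p r : fpath (@nxt G) e p ->
  {in p, forall f : G, ~~ exposed f} -> ~~ halts (last e p) -> route (nxt (last e p)) r ->
  route e ((e :: p) ++ r).
Proof.
elim: p e => [|f p IH] e /=; first by move=> _ _ he; apply: Route_step.
case/andP=> /eqP ef pf nexposed nh R; apply: Route_step; last first.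
  by rewrite ef; apply: IH => // g gp; apply: nexposed; rewrite inE gp orbT.
by apply/negP=> he; have := nexposed f (mem_head _ _); rewrite -ef (nxt_halt he) -/(halts e) he.
Qed.

Lemma route_path_halt (G : tangle) (e : G) p : fpath (@nxt G) e p ->
  {in p, forall f : G, ~~ exposed f} -> halts (last e p) -> route e (e :: p).
Proof.
elim: p e => [|f p IH] e /=; first by move=> _ _; apply: Route_halt.
case/andP=> /eqP ef pf nexposed hl; apply: Route_step; last first.
  by rewrite ef; apply: IH => // g gp; apply: nexposed; rewrite inE gp orbT.
by apply/negP=> he; have := nexposed f (mem_head _ _); rewrite -ef (nxt_halt he) -/(halts e) he.
Qed.

Section Contraction.
Variables (T G : tangle) (inj : G -> T) (seg : G -> seq T).
Hypothesis inj_inj : injective inj.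
Hypothesis inj_glu : forall e, inj (glu e) = glu (inj e).
Hypothesis inj_exposed : forall t : T, exposed t -> exists e, t = inj e.
Hypothesis inj_pos : forall e, positive (inj e) = positive e.
Hypothesis inj_abs : forall e, tabs (inj e) = tabs e.
Hypothesis seg_cons : forall e, seg e = inj e :: behead (seg e).
Hypothesis seg_path : forall e, fpath (@nxt T) (inj e) (behead (seg e)).
Hypothesis seg_inner : forall e f, f \in behead (seg e) -> forall e', f <> inj e'.
Hypothesis seg_last : forall e, opp (last (inj e) (behead (seg e))) = inj (opp e).
Hypothesis seg_low : forall e, tlab e = low (inj e) (seg e).

Definition expand r := flatten (map seg r).

Lemma exposed_inj e : exposed (inj e) = exposed e.
Proof. by rewrite /exposed -inj_glu (inj_eq inj_inj). Qed.

Lemma seg_nxt e : nxt (last (inj e) (behead (seg e))) = inj (nxt e).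
Proof. by rewrite /nxt seg_last -inj_glu. Qed.

Lemma seg_halts e : halts (last (inj e) (behead (seg e))) = halts e.
Proof. by rewrite /halts seg_last exposed_inj. Qed.

Lemma seg_nexposed e : {in behead (seg e), forall f : T, ~~ exposed f}.
Proof. by move=> f fs; apply/negP=> /inj_exposed[e' /(seg_inner fs)]. Qed.

Lemma route_expand e r : route e r -> route (inj e) (expand r).
Proof.
elim=> {e r} [e he|e r he _ IH]; rewrite /expand /=.
  rewrite cats0 seg_cons; apply: route_path_halt; rewrite ?seg_halts //.
  exact: seg_nexposed.
rewrite seg_cons; apply: route_path_cat; rewrite ?seg_halts ?seg_nxt //.
exact: seg_nexposed.
Qed.

Lemma chain_expand e : exposed e -> chain (inj e) = expand (chain e).
Proof. by move=> /chain_exposed/route_expand/route_chain. Qed.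

Lemma loop_inj e : loop (inj e) -> loop e.
Proof. by apply: contraLR => /chain_nloop/route_expand/route_nloop. Qed.

Lemma path_expand e p : fpath (@nxt G) e p ->
  fpath (@nxt T) (inj e) (behead (expand (e :: p))) /\
  opp (last (inj e) (behead (expand (e :: p)))) = inj (opp (last e p)).
Proof.
have E f q : expand (f :: q) = inj f :: behead (expand (f :: q)).
  by rewrite /expand /= seg_cons.
elim: p e => [|f p IH] e.
  by rewrite /expand /= cats0 seg_last.
case/andP=> /eqP ef /IH[pf lf].
have -> : behead (expand (e :: f :: p)) = behead (seg e) ++ expand (f :: p).
  by rewrite {1}/expand /= {1}seg_cons.
by rewrite cat_path last_cat seg_path E /= seg_nxt ef eqxx.
Qed.

Lemma mem_expand t r : t \in expand r ->
  (exists2 e, e \in r & t = inj e) \/ (forall e, t <> inj e).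
Proof.
case/flattenP=> s /mapP[e er ->]; rewrite seg_cons inE => /orP[/eqP->|].
  by left; exists e.
by move=> /seg_inner; right.
Qed.

Lemma inj_expand e r : inj e \in expand r -> e \in r.
Proof. by case/mem_expand => [[f fr /inj_inj ->]|/(_ e)]. Qed.

Lemma expand_inj e r : e \in r -> inj e \in expand r.
Proof.
move=> er; apply/flattenP; exists (seg e); first exact: map_f.
by rewrite seg_cons mem_head.
Qed.

Lemma orbit_expand e : orbit (@nxt T) (inj e) = expand (orbit (@nxt G) e).
Proof.
have := cycle_orbit (@nxt_inj G) e; have := orbit_uniq (@nxt G) e.
rewrite (orbit_head e) /= rcons_path => /andP[ne uq] /andP[pe /eqP le].
have E f q : expand (f :: q) = inj f :: behead (expand (f :: q)).
  by rewrite /expand /= seg_cons.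
have [pe' le'] := path_expand pe.
rewrite E; apply: orbit_cons.
  by rewrite /= rcons_path pe' /= /nxt le' -inj_glu -/(nxt _) le.
rewrite /expand /= {1}seg_cons /= mem_cat negb_or; apply/andP; split.
  by apply/negP=> /seg_inner/(_ e).
by apply: contra ne => /inj_expand.
Qed.

Lemma loop_injE e : loop (inj e) = loop e.
Proof.
apply/idP/idP; first exact: loop_inj.
move=> le; apply/hasPn => t; rewrite orbit_expand => /mem_expand[[f fe ->]|nt].
  by rewrite exposed_inj; apply: (hasPn le).
by apply/negP=> /inj_exposed[f /nt].
Qed.

Lemma low_expand e r : e \in r -> low (inj e) (expand r) = low e r.
Proof.
have low_seg l f : all (fun g => l <= tlab g) (seg f) = (l <= tlab f).
  rewrite seg_low leq_low andb_idl // => /allP; apply.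
  by rewrite seg_cons mem_head.
have lowE l f q : f \in q -> (l <= low (inj f) (expand q)) = (l <= low f q).
  move=> fq; rewrite !leq_low !andb_idl.
  - by elim: q {fq} => //= g q IH; rewrite all_cat low_seg IH.
  - by move=> /allP/(_ f fq).
  - by move=> /allP/(_ (inj f)); apply; apply: expand_inj.
by move=> er; apply/eqP; rewrite eqn_leq -lowE // leqnn lowE // leqnn.
Qed.

Lemma target_inj e : exposed e -> target (inj e) = inj (target e).
Proof.
move=> fe; have R := chain_exposed fe; rewrite /target chain_expand //.
have [_] := path_expand (route_path R); rewrite -(route_cons R).
rewrite [in last e (chain e)](route_cons R) /= => <-.
by rewrite {2}(route_cons R) /expand /= {1}seg_cons {1}(route_cons R) /= seg_cons.
Qed.

Lemma strand_low_inj e : exposed e -> strand_low (inj e) = strand_low e.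
Proof.
move=> fe; rewrite /strand_low chain_expand // low_expand //.
by rewrite (route_cons (chain_exposed fe)) mem_head.
Qed.

Definition seg_evens e := evens (tabs e) [::] (word (seg e)).
Hypothesis seg_good : forall e, reduces (tabs e) (word (seg e)) (seg_evens e) (arcw e).

Lemma word_expand e p : fpath (@nxt G) e p ->
  reduces (tabs e) (word (expand (e :: p))) (flatten (map seg_evens (e :: p)))
    (word (e :: p)).
Proof.
elim: p e => [|f p IH] e.
  by rewrite /expand /word /= !cats0 => _; apply: seg_good.
case/andP=> /eqP ef /IH red.
have wE g q : word (g :: q) = arcw g ++ word q by [].
rewrite /expand wE /= word_cat; apply: reduces_cat => //.
by have [-> _] := seg_good e; rewrite level_arcw -tabs_nxt ef.
Qed.

Lemma word_expand_chain e : exposed e ->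
  reduces (tabs e) (word (chain (inj e))) (flatten (map seg_evens (chain e)))
    (word (chain e)).
Proof.
move=> fe; have R := chain_exposed fe; rewrite chain_expand // (route_cons R).
exact/word_expand/route_path.
Qed.

Lemma strand_evens_inj e : exposed e ->
  perm_eq (strand_evens (inj e)) (flatten (map seg_evens (chain e)) ++ strand_evens e).
Proof. by move=> /word_expand_chain[_ /(_ [::])[_]]; rewrite /strand_evens inj_abs. Qed.

Lemma loop_evens_inj e :
  perm_eq (loop_evens (inj e))
    (flatten (map seg_evens (orbit (@nxt G) e)) ++ loop_evens e).
Proof.
rewrite /loop_evens inj_abs orbit_expand; apply: reduces_cyclic.
rewrite orbit_head; apply: word_expand.
by have := cycle_orbit (@nxt_inj G) e; rewrite orbit_head /= rcons_path => /andP[].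
Qed.

Section Weight.
Variables (K : fieldType) (x y : nat -> K).
Local Open Scope ring_scope.
Local Notation ew := (evens_weight y).
Local Notation lw := (loop_weight x y).

Lemma evens_weight_cat L L' : ew (L ++ L') = ew L * ew L'.
Proof. by rewrite /evens_weight big_cat. Qed.

Lemma evens_weight_perm L L' : perm_eq L L' -> ew L = ew L'.
Proof. exact: perm_big. Qed.

Lemma evens_weight_flatten (I : Type) (f : I -> seq nat) r :
  ew (flatten (map f r)) = \prod_(i <- r) ew (f i).
Proof.
elim: r => [|i r IH]; first by rewrite big_nil /evens_weight big_nil.
by rewrite /= evens_weight_cat IH big_cons.
Qed.

Definition touches t := [exists e, inj e \in orbit (@nxt T) t].

Lemma touches_orbit t u : u \in orbit (@nxt T) t -> touches u = touches t.
Proof. by move=> tu; apply: eq_existsb => e; rewrite (orbit_eq tu). Qed.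

Lemma froot_orbit (H : tangle) (e : H) : froot (@nxt H) e \in orbit (@nxt H) e.
Proof. by rewrite -fconnect_orbit connect_root. Qed.

Lemma froot_eq (H : tangle) (e f : H) :
  (froot (@nxt H) e == froot (@nxt H) f) = (f \in orbit (@nxt H) e).
Proof. by rewrite root_connect ?fconnect_orbit //; apply/fconnect_sym/nxt_inj. Qed.

Lemma froots_froot (H : tangle) (e : H) : froots (@nxt H) (froot (@nxt H) e).
Proof. exact/roots_root/fconnect_sym/nxt_inj. Qed.

Lemma loop_root_froot (H : tangle) (e : H) :
  loop e -> positive e -> loop_root (froot (@nxt H) e).
Proof.
move=> le pe; rewrite /loop_root froots_froot (loop_orbit (froot_orbit e)) le.
by rewrite (loop_positive le (froot_orbit e)) pe.
Qed.

Lemma big_touching_loops :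
  \prod_(t | loop_root t && touches t) lw t =
  \prod_(e | loop_root e) lw (inj e).
Proof.
pose h e := froot (@nxt T) (inj e).
transitivity (\prod_(t in h @: [set e | loop_root e]) lw t).
  apply: eq_bigl => t; apply/andP/imsetP => [[/and3P[pt rt lt] /existsP[e et]]|].
    have le : loop e by rewrite -loop_injE (loop_orbit et).
    have pe : positive e by rewrite -inj_pos (loop_positive lt et).
    exists (froot (@nxt G) e); first by rewrite inE loop_root_froot.
    apply/eqP; rewrite /h -(eqP rt) froot_eq -(orbit_eq et) orbit_expand.
    exact/expand_inj/froot_orbit.
  case=> e; rewrite inE => /and3P[pe re le] ->; split.
    by rewrite /h loop_root_froot ?loop_injE ?inj_pos.
  by apply/existsP; exists e; rewrite orbit_sym froot_orbit.
rewrite big_imset /=; last first.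
  move=> e f; rewrite !inE => /and3P[_ re _] /and3P[_ rf _] /eqP.
  rewrite froot_eq orbit_expand => /inj_expand; rewrite -froot_eq.
  by rewrite (eqP re) (eqP rf) => /eqP.
rewrite (eq_bigl (fun e => loop_root e)); last by move=> e; rewrite inE.
by apply: eq_bigr => e _; apply: loop_weight_orbit; exact: froot_orbit.
Qed.

(** The arcs of G stand for the segments seg e of T.  Contracting them replaces the
    word of each strand by a reduced one; the even pairs lost are those of the
    segments, and the loops of T missed by G are lost as well. *)
Lemma weight_contraction :
  weight T x y = \prod_(e : G | positive e) ew (seg_evens e) *
    \prod_(t | loop_root t && ~~ touches t) lw t * weight G x y.
Proof.
rewrite /weight (@big_inj_image _ _ _ _ _ inj _ _ inj_inj) /=; last first.
  by move=> t /andP[_ /inj_exposed].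
rewrite (eq_bigl (fun e : G => positive e && exposed e)) /=; last first.
  by move=> e; rewrite inj_pos exposed_inj.
rewrite (bigID touches) /= big_touching_loops.
rewrite big_strands /=.
rewrite (eq_bigr (fun e => (\prod_(f <- chain e) ew (seg_evens f)) * ew (strand_evens e)));
  last first.
  move=> e /andP[_ fe]; rewrite (evens_weight_perm (strand_evens_inj fe)).
  by rewrite evens_weight_cat evens_weight_flatten.
have -> : \prod_(e | loop_root e) lw (inj e) = \prod_(e : G | loop_root e)
    ((\prod_(f <- orbit (@nxt G) e) ew (seg_evens f)) * lw e).
  apply: eq_bigr => e _; rewrite /loop_weight (evens_weight_perm (loop_evens_inj e)).
  rewrite evens_weight_cat evens_weight_flatten mulrCA.
  by rewrite /loop_low orbit_expand low_expand ?in_orbit.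
rewrite !big_split /=.
ring.
Qed.

End Weight.
End Contraction.

(** * Strands inside strands *)

(** The word of every path reduces to that of a single arc with the same ends and
    the same smallest label. *)
Definition tidy (G : tangle) := forall e : G, exposed e ->
  reduces (tabs e) (word (chain e)) (strand_evens e)
    (dive (tabs e) (strand_low e) (tabs (target e))).

Section Nesting.
Variables (T G0 G : tangle) (sub : G0 -> T) (inj : G -> T) (src : G -> option G0).
Hypothesis sub_inj : injective sub.
Hypothesis sub_opp : forall e, sub (opp e) = opp (sub e).
Hypothesis sub_glu : forall e, ~~ exposed e -> sub (glu e) = glu (sub e).
Hypothesis sub_pos : forall e, positive (sub e) = positive e.
Hypothesis sub_abs : forall e, tabs (sub e) = tabs e.
Hypothesis sub_lab : forall e, tlab (sub e) = tlab e.
Hypothesis inj_inj : injective inj.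
Hypothesis inj_glu : forall e, inj (glu e) = glu (inj e).
Hypothesis inj_pos : forall e, positive (inj e) = positive e.
Hypothesis inj_abs : forall e, tabs (inj e) = tabs e.
Hypothesis cover : forall t, (exists e, t = inj e) \/ (exists e, t = sub e).
Hypothesis srcS : forall e e0, src e = Some e0 ->
  [/\ inj e = sub e0, exposed e0, inj (opp e) = sub (target e0) & tlab e = strand_low e0].
Hypothesis srcN : forall e, src e = None ->
  [/\ forall e0, inj e <> sub e0, inj (opp e) = opp (inj e) & tlab e = tlab (inj e)].
Hypothesis src_exposed : forall e0, exposed e0 -> exists e, inj e = sub e0.
Hypothesis tidyG0 : tidy G0.

Definition inner_seg e := if src e is Some e0 then map sub (chain e0) else [:: inj e].

Lemma sub_nxt e : ~~ halts e -> sub (nxt e) = nxt (sub e).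
Proof. by move=> ne; rewrite /nxt sub_glu // sub_opp. Qed.

Lemma inj_sub_exposed e e0 : inj e = sub e0 -> exposed e0.
Proof.
case E: (src e) => [e1|] H; last by have [/(_ e0)] := srcN E.
have [] := srcS E; rewrite H => /sub_inj -> //.
Qed.

Lemma nesting_exposed t : exposed t -> exists e, t = inj e.
Proof.
have [//|[e0 ->] ft] := cover t; have [/src_exposed[e E]|nfe] := boolP (exposed e0).
  by exists e.
by case/negP: (nfe); rewrite /exposed -(inj_eq sub_inj) sub_glu.
Qed.

Lemma word_sub r : word (map sub r) = word r.
Proof.
by elim: r => //= e r IH; rewrite /word /= -!/(word _) IH /arcw sub_abs sub_lab -sub_opp sub_abs.
Qed.

Lemma low_sub e r : low (sub e) (map sub r) = low e r.
Proof. by elim: r => /= [|f r ->]; rewrite ?sub_lab. Qed.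

Lemma fpath_sub e r : route e r -> fpath (@nxt T) (sub e) (map sub (behead r)).
Proof.
elim=> {e r} //= e r he R IH; rewrite (route_cons R) /= -sub_nxt // eqxx.
exact: IH.
Qed.

Lemma inner_seg_cons e : inner_seg e = inj e :: behead (inner_seg e).
Proof.
rewrite /inner_seg; case E: (src e) => [e0|] //; have [-> fe _ _] := srcS E.
by rewrite (route_cons (chain_exposed fe)).
Qed.

Lemma inner_seg_path e : fpath (@nxt T) (inj e) (behead (inner_seg e)).
Proof.
rewrite /inner_seg; case E: (src e) => [e0|] //; have [-> fe _ _] := srcS E.
have R := chain_exposed fe; have := fpath_sub R.
by rewrite [in X in _ -> X](route_cons R).
Qed.

Lemma inner_seg_inner e t : t \in behead (inner_seg e) -> forall e', t <> inj e'.
Proof.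
rewrite /inner_seg; case E: (src e) => [e0|] //; have [_ fe _ _] := srcS E.
have R := chain_exposed fe; rewrite (route_cons R) /=.
case/mapP=> f fr -> e' /esym/inj_sub_exposed.
exact/negP/(route_bound R).
Qed.

Lemma inner_seg_last e : opp (last (inj e) (behead (inner_seg e))) = inj (opp e).
Proof.
rewrite /inner_seg; case E: (src e) => [e0|] /=; last by have [_ ->] := srcN E.
have [-> fe -> _] := srcS E; have R := chain_exposed fe.
by rewrite /target sub_opp (route_cons R) /= last_map.
Qed.

Lemma inner_seg_low e : tlab e = low (inj e) (inner_seg e).
Proof.
rewrite /inner_seg; case E: (src e) => [e0|] /=; last first.
  by have [_ _ ->] := srcN E; rewrite minnn.
by have [-> fe _ ->] := srcS E; rewrite low_sub.
Qed.

Lemma inner_seg_good e :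
  reduces (tabs e) (word (inner_seg e)) (seg_evens inner_seg e) (arcw e).
Proof.
rewrite /seg_evens /arcw -!inj_abs /inner_seg; case E: (src e) => [e0|]; last first.
  have [_ -> ->] := srcN E; rewrite /word /= cats0 /arcw.
  by rewrite evens_dive; apply: reduces_refl.
have [-> fe -> ->] := srcS E; rewrite word_sub !sub_abs; exact: tidyG0.
Qed.

Section Weight.
Variables (K : fieldType) (x y : nat -> K).
Local Open Scope ring_scope.
Local Notation ew := (evens_weight y).
Local Notation lw := (loop_weight x y).

Lemma prod_inner_evens :
  \prod_(e : G | positive e) ew (seg_evens inner_seg e) =
  \prod_(e : G0 | positive e && exposed e) ew (strand_evens e).
Proof.
pose F t := if [pick e | sub e == t] is Some e then ew (strand_evens e) else 1.
have F_sub e : F (sub e) = ew (strand_evens e).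
  rewrite /F; case: pickP => [f|/(_ e)]; last by rewrite eqxx.
  by move=> /eqP/sub_inj ->.
have F_inj e : ew (seg_evens inner_seg e) = F (inj e).
  rewrite /seg_evens /inner_seg; case E: (src e) => [e0|].
    have [Ei fe _ _] := srcS E.
    by rewrite Ei F_sub word_sub -inj_abs Ei sub_abs.
  have [ns _ _] := srcN E; rewrite /F; case: pickP => [f /eqP/esym/ns //|_].
  have [_ Eo El] := srcN E.
  rewrite /word /= cats0 /arcw -Eo -El !inj_abs evens_dive.
  by rewrite /evens_weight big_nil.
rewrite (eq_bigr _ (fun e _ => F_inj e)).
pose PT t := positive t && [exists e, inj e == t].
transitivity (\prod_(t | PT t) F t).
  rewrite (@big_inj_image _ _ _ _ _ inj _ _ inj_inj) /=; last first.
    by move=> t /andP[_ /existsP[e /eqP <-]]; exists e.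
  apply: eq_bigl => e; rewrite /PT inj_pos.
  by rewrite (_ : [exists f, _]) ?andbT //; apply/existsP; exists e.
rewrite (bigID (fun t => [exists e, sub e == t])) /= [X in _ * X]big1 ?mulr1; last first.
  move=> t /andP[_ /existsP ns]; rewrite /F; case: pickP => // f fe.
  by case: ns; exists f.
rewrite (@big_inj_image _ _ _ _ _ sub _ _ sub_inj) /=; last first.
  by move=> t /andP[_ /existsP[e /eqP <-]]; exists e.
apply: eq_big => [e|e _]; last exact: F_sub.
rewrite /PT sub_pos -andbA; congr (_ && _).
rewrite (_ : [exists f, sub f == sub e]) ?andbT; last by apply/existsP; exists e.
apply/existsP/idP => [[f /eqP/inj_sub_exposed //]|/src_exposed[f Ef]].
by exists f; rewrite Ef.
Qed.

Lemma orbit_sub e : loop e -> orbit (@nxt T) (sub e) = map sub (orbit (@nxt G0) e).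
Proof.
move=> le; have := cycle_orbit (@nxt_inj G0) e; have := orbit_uniq (@nxt G0) e.
have nh : {in orbit (@nxt G0) e, forall f : G0, ~~ halts f}.
  by move=> f /(loop_halts le).
have cyc_sub f r : {in f :: r, forall f : G0, ~~ halts f} -> fpath (@nxt G0) f r ->
    fpath (@nxt T) (sub f) (map sub r).
  elim: r f => //= g r IH f nfr /andP[/eqP fg pg].
  rewrite -sub_nxt ?nfr ?mem_head // fg eqxx; apply: IH => //.
  by move=> h hr; rewrite nfr // inE hr orbT.
move: nh; rewrite orbit_head; set r := behead _ => nh /= /andP[er _].
rewrite rcons_path => /andP[pr /eqP lr]; apply: orbit_cons; last first.
  by rewrite mem_map.
rewrite /= rcons_path last_map cyc_sub //= -sub_nxt ?lr ?eqxx // nh //.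
exact: mem_last.
Qed.

Lemma prod_inner_loops :
  \prod_(t | loop_root t && ~~ touches inj t) lw t = \prod_(e : G0 | loop_root e) lw e.
Proof.
pose h e := froot (@nxt T) (sub e).
have loop_sub e : loop e -> loop (sub e).
  move=> le; apply/hasPn=> t; rewrite orbit_sub // => /mapP[f fe ->].
  apply/negP=> /nesting_exposed[g /esym/inj_sub_exposed ff].
  by have := hasPn le f fe; rewrite ff.
have ntouch e : loop e -> ~~ touches inj (sub e).
  move=> le; apply/existsP=> -[f]; rewrite orbit_sub // => /mapP[g ge].
  by move=> /inj_sub_exposed fg; case/negP: le; apply/hasP; exists g.
transitivity (\prod_(t in h @: [set e | loop_root e]) lw t).
  apply: eq_bigl => t; apply/andP/imsetP => [[/and3P[pt rt lt] ntt]|[e]].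
    have [[e Et]|[e Et]] := cover t.
      by case/existsP: ntt; exists e; rewrite Et in_orbit.
    have le : loop e.
      case: (boolP (loop e)) => // nle; case/existsP: ntt.
      have R := chain_nloop nle; have := fpath_sub R; have := route_last R.
      rewrite [chain e](route_cons R) /= => hl.
      set r := behead (chain e) in hl * => pr.
      have [f Ef] := src_exposed hl; exists (glu f); rewrite inj_glu Ef sub_opp.
      rewrite -[glu _]/(nxt _) Et -fconnect_orbit.
      apply: (@connect_trans _ _ (sub (last e r))); last exact: fconnect1.
      by apply/connectP; exists (map sub r); rewrite ?last_map.
    have pe : positive e by rewrite -sub_pos -Et.
    exists (froot (@nxt G0) e); first by rewrite inE loop_root_froot.
    apply/eqP; rewrite /h -(eqP rt) froot_eq Et orbit_sub // mem_map //.
    exact: froot_orbit.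
  rewrite inE => /and3P[pe re le] ->; split.
    by rewrite /h loop_root_froot ?sub_pos ?loop_sub.
  by rewrite (touches_orbit _ (froot_orbit _)) ntouch.
rewrite big_imset /=; last first.
  move=> e f; rewrite !inE => /and3P[_ re le] /and3P[_ rf _] /eqP.
  rewrite froot_eq orbit_sub // mem_map // -froot_eq.
  by rewrite (eqP re) (eqP rf) => /eqP.
rewrite (eq_bigl (fun e => loop_root e)); last by move=> e; rewrite inE.
apply: eq_bigr => e /and3P[_ _ le].
rewrite (loop_weight_orbit _ _ (froot_orbit _)) /loop_weight /loop_low /loop_evens.
by rewrite orbit_sub // low_sub word_sub sub_abs.
Qed.

(** Here G0 is a part of T, and G arises from T by replacing each path of G0 by one
    arc.  The segments contribute the paths of G0, counted once, and the loops of T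
    missed by G are the loops of G0. *)
Lemma weight_nesting : weight T x y = weight G0 x y * weight G x y.
Proof.
rewrite (weight_contraction inj_inj inj_glu nesting_exposed inj_pos inj_abs
  inner_seg_cons inner_seg_path inner_seg_inner inner_seg_last inner_seg_low
  inner_seg_good) prod_inner_evens prod_inner_loops.
by [].
Qed.

End Weight.

Lemma nesting_target e : exposed e -> target (inj e) = inj (target e).
Proof.
exact: (target_inj inj_inj inj_glu nesting_exposed
  inner_seg_cons inner_seg_path inner_seg_inner inner_seg_last).
Qed.

Lemma nesting_low e : exposed e -> strand_low (inj e) = strand_low e.
Proof.
exact: (strand_low_inj inj_inj inj_glu nesting_exposed
  inner_seg_cons inner_seg_path inner_seg_inner inner_seg_last inner_seg_low).
Qed.

Lemma nesting_reduces e : exposed e ->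
  exists L, reduces (tabs e) (word (chain (inj e))) L (word (chain e)).
Proof.
move=> fe; eexists.
exact: (word_expand_chain inj_inj inj_glu nesting_exposed
  inner_seg_cons inner_seg_path inner_seg_inner inner_seg_last inner_seg_good fe).
Qed.

End Nesting.

(** * Parity and nesting in Okada diagrams *)

Section Nodes.
Variable N : nat.
Implicit Types u v w : node N.

Lemma node_pos_inj : injective (@node_pos N).
Proof.
move=> [i|i] [j|j] /= E; have Hi := ltn_ord i; have Hj := ltn_ord j.
- by congr inl; apply: val_inj.
- by lia.
- by lia.
- by congr inr; apply: val_inj => /=; lia.
Qed.

Lemma node_pos_lt u : node_pos u < N.*2.
Proof. by case: u => i /=; have := ltn_ord i; lia. Qed.

Lemma node_at p : p < N.*2 -> exists u : node N, node_pos u = p.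
Proof.
move=> lt_p; have [lt|ge] := ltnP p N; first by exists (inl (Ordinal lt)).
have lt' : N.*2.-1 - p < N by lia.
by exists (inr (Ordinal lt')) => /=; lia.
Qed.

(** Nodes alternate along the order of their positions; arcs and gluings join nodes
    of opposite parity. *)
Definition node_positive u := ~~ odd (node_pos u).

Lemma opp_node_positive u : node_positive (opp_node u) = ~~ node_positive u.
Proof. by rewrite /node_positive; case: u => i /=; have := ltn_ord i; lia. Qed.

Section Diagram.
Variable D : diagram N.
Hypothesis okD : okada_diagram D.

Lemma mate_neq u : mate D u != u.
Proof. by have /and4P[/forallP/(_ u)/and3P[]] := okD. Qed.

Lemma mateK : involutive (mate D).
Proof. by move=> u; have /and4P[/forallP/(_ u)/and3P[_ /eqP]] := okD. Qed.

Lemma label_mate u : label D (mate D u) = label D u.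
Proof. by have /and4P[/forallP/(_ u)/and3P[_ _ /eqP]] := okD. Qed.

Lemma noncross u v : node_pos u < node_pos v -> node_pos v < node_pos (mate D u) ->
  node_pos (mate D v) <= node_pos (mate D u).
Proof.
have /and4P[_ /forallP/(_ u)/forallP/(_ v) + _ _] := okD.
by move=> nc uv vu; rewrite leqNgt; apply: contra nc => ->; rewrite uv vu.
Qed.

Lemma label_gt0 u : 0 < label D u.
Proof. by have /and4P[_ _ /forallP/(_ u) /andP[/andP[]]] := okD. Qed.

Lemma label_abs u : label D u <= node_abs u.
Proof.
have /and4P[_ _ /forallP/(_ u) /andP[/andP[_]]] := okD.
by rewrite leq_min => /andP[].
Qed.

Lemma label_abs_mate u : label D u <= node_abs (mate D u).
Proof. by rewrite -label_mate label_abs. Qed.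

Lemma label_odd u : odd (label D u) = odd (minn (node_abs u) (node_abs (mate D u))).
Proof. by have /and4P[_ _ /forallP/(_ u) /andP[_ /eqP]] := okD. Qed.

Lemma label_nest u v : node_pos v < node_pos u -> node_pos u < node_pos (mate D u) ->
  node_pos (mate D u) < node_pos (mate D v) -> label D v < label D u.
Proof.
by have /and4P[_ _ _ /forallP/(_ u)/forallP/(_ v)/implyP + ? ? ?] := okD; apply; apply/and3P.
Qed.

Lemma mate_inj : injective (mate D).
Proof. exact: can_inj mateK. Qed.

(** Planarity and nesting are easier to transport in this form, which treats the
    two ends of an arc symmetrically: an arc encloses both ends of any other arc,
    or neither. *)
Definition encloses u v := (node_pos u < node_pos v) (+) (node_pos (mate D u) < node_pos v).

Lemma pos_neq u v : u != v -> node_pos u != node_pos v.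
Proof. by apply: contra => /eqP/node_pos_inj ->. Qed.

Lemma encloses_mate u v : v != u -> v != mate D u -> encloses u (mate D v) = encloses u v.
Proof.
wlog lt_u: u / node_pos u < node_pos (mate D u).
  move=> W vu vmu; have [|lt|E] := ltngtP (node_pos u) (node_pos (mate D u)).
  - by move=> lt; apply: W.
  - have := W (mate D u); rewrite mateK /encloses mateK => W'.
    by rewrite addbC W' 1?addbC.
  - by have := mate_neq u; rewrite -(node_pos_inj E) eqxx.
move=> vu vmu; rewrite /encloses.
have n1 := pos_neq vu; have n2 := pos_neq vmu.
have n3 : node_pos (mate D v) != node_pos u.
  by apply: pos_neq; apply: contra vmu => /eqP <-; rewrite mateK.
have n4 : node_pos (mate D v) != node_pos (mate D u).
  by apply: pos_neq; apply: contra vu => /eqP/mate_inj ->.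
have c1 := @noncross u v; have c2 := @noncross v u; have c3 := @noncross u (mate D v).
have c4 := @noncross (mate D v) u; rewrite mateK in c3 c4.
lia.
Qed.

(** The nodes strictly between the ends of an arc are paired among themselves, so
    their number is even. *)
Lemma mate_positive u : node_positive (mate D u) = ~~ node_positive u.
Proof.
(* A gap closed under mates splits at the mate of its first node into two gaps. *)
have even_gap n lo hi : hi - lo < n -> lo < hi -> hi <= N.*2 ->
    (forall v, lo < node_pos v < hi -> lo < node_pos (mate D v) < hi) -> odd (hi - lo).
  elim: n lo hi => // n IH lo hi lt_n lt_lo le_hi cl.
  have [->|ne] := eqVneq hi lo.+1; first by rewrite subSnn.
  have [|v Ev] := @node_at lo.+1; first by lia.
  have bv : lo < node_pos (mate D v) < hi by apply: cl; lia.
  have nv := pos_neq (mate_neq v).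
  have odd1 : odd (node_pos (mate D v) - node_pos v).
    apply: IH; try lia.
    move=> w bw; have := @encloses_mate v w; rewrite /encloses.
    have wv : w != v by apply/eqP=> Ew; move: bw; rewrite Ew; lia.
    have wv' : w != mate D v by apply/eqP=> Ew; move: bw; rewrite Ew; lia.
    have wv2 : node_pos (mate D w) != node_pos v.
      by apply: pos_neq; apply: contra wv' => /eqP <-; rewrite mateK.
    have wv3 : node_pos (mate D w) != node_pos (mate D v).
      by apply: pos_neq; apply: contra wv => /eqP/mate_inj ->.
    move=> /(_ wv wv'); lia.
  have odd2 : odd (hi - node_pos (mate D v)).
    apply: IH; try lia.
    move=> w bw; have := @encloses_mate v w; rewrite /encloses.
    have wv : w != v by apply/eqP=> Ew; move: bw; rewrite Ew; lia.
    have wv' : w != mate D v by apply/eqP=> Ew; move: bw; rewrite Ew; lia.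
    have wv2 : node_pos (mate D w) != node_pos v.
      by apply: pos_neq; apply: contra wv' => /eqP <-; rewrite mateK.
    have wv3 : node_pos (mate D w) != node_pos (mate D v).
      by apply: pos_neq; apply: contra wv => /eqP/mate_inj ->.
    have := cl w; move=> + /(_ wv wv'); lia.
  lia.
wlog lt_u: u / node_pos u < node_pos (mate D u).
  move=> W; have [|lt|E] := ltngtP (node_pos u) (node_pos (mate D u)); first exact: W.
    by have := W (mate D u); rewrite mateK => ->; rewrite ?negbK.
  by have := mate_neq u; rewrite -(node_pos_inj E) eqxx.
have := @even_gap _ (node_pos u) (node_pos (mate D u)) (ltnSn _) lt_u (ltnW (node_pos_lt _)).
rewrite /node_positive; have [wcl|] := boolP [forall w, (node_pos u < node_pos w < node_pos (mate D u)) ==>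
    (node_pos u < node_pos (mate D w) < node_pos (mate D u))].
  by move=> /(_ (fun w => implyP (forallP wcl w))); lia.
case/negP; apply/forallP=> w; apply/implyP=> bw.
have := @encloses_mate u w; rewrite /encloses.
have wv : w != u by apply/eqP=> Ew; move: bw; rewrite Ew; lia.
have wv' : w != mate D u by apply/eqP=> Ew; move: bw; rewrite Ew; lia.
have wv2 : node_pos (mate D w) != node_pos u.
  by apply: pos_neq; apply: contra wv' => /eqP <-; rewrite mateK.
have wv3 : node_pos (mate D w) != node_pos (mate D u).
  by apply: pos_neq; apply: contra wv => /eqP/mate_inj ->.
move=> /(_ wv wv'); lia.
Qed.

End Diagram.
End Nodes.

Lemma node_absE N (u : node N) :
  node_abs u = if node_pos u < N then (node_pos u).+1 else N.*2 - node_pos u.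
Proof. by case: u => k /=; have := ltn_ord k; case: ifP; lia. Qed.

Lemma odd_min_abs N (u v : node N) : node_positive v = ~~ node_positive u ->
  odd (minn (node_abs u) (node_abs v)) = odd (maxn (node_pos u) (node_pos v)).
Proof.
wlog le_uv: u v / node_pos u <= node_pos v.
  move=> W; have [le|lt] := orP (leq_total (node_pos u) (node_pos v)); first exact: W.
  by move=> E; rewrite minnC maxnC W ?E ?negbK.
rewrite /node_positive negbK => opp; rewrite (maxn_idPr le_uv).
have lu := node_pos_lt u; have lv := node_pos_lt v.
rewrite !node_absE; have [vN|Nv] := ltnP (node_pos v) N.
  by rewrite (leq_ltn_trans le_uv vN) (minn_idPl _) //= -opp negbK.
have oddv : odd (N.*2 - node_pos v) = odd (node_pos v).
  by rewrite oddB ?odd_double 1?ltnW.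
case: ltnP => uN; last by rewrite (minn_idPr _) // leq_sub2l.
by rewrite /minn; case: ifP => _ //=; rewrite -opp negbK.
Qed.

(** The smaller absolute value and the larger position have the same parity, which
    turns the parity condition on labels into one about positions. *)
Lemma odd_label N (D : diagram N) (u : node N) : okada_diagram D ->
  odd (label D u) = odd (maxn (node_pos u) (node_pos (mate D u))).
Proof. by move=> okD; rewrite label_odd // odd_min_abs // mate_positive. Qed.

(** * Compositions of two and of three diagrams *)

Notation odiag N := {D : diagram N | okada_diagram D}.

Section Composite.
Variable N : nat.

Section Two.
Variables C D : odiag N.
Local Notation C' := (val C).
Local Notation D' := (val D).

Fact other_endK : involutive (other_end C' D').
Proof. by case=> u /=; rewrite mateK //; apply: valP. Qed.

Fact glueK : involutive (@glue N).
Proof. by do 2!case. Qed.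

Fact end_abs_glue (e : arc_end N) : end_abs (glue e) = end_abs e.
Proof. by do 2!case: e => e. Qed.

Fact end_label_other e : end_label C' D' (other_end C' D' e) = end_label C' D' e.
Proof. by case: e => u /=; rewrite label_mate //; apply: valP. Qed.

Fact end_label_abs e : end_label C' D' e <= end_abs e.
Proof. by case: e => u; apply: label_abs; apply: valP. Qed.

Definition end_positive (e : arc_end N) := node_positive (end_node e).

Fact end_positive_other e : end_positive (other_end C' D' e) = ~~ end_positive e.
Proof. by case: e => u; apply: mate_positive; apply: valP. Qed.

Fact end_positive_glue e : glue e != e -> end_positive (glue e) = ~~ end_positive e.
Proof.
case: e => [[i|i]|[i|i]] /=; rewrite ?eqxx // => _.
  exact: (opp_node_positive (inr i)).
exact: (opp_node_positive (inl i)).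
Qed.

Definition composite : tangle := @Tangle (arc_end N) (other_end C' D') (@glue N)
  (@end_abs N) (end_label C' D') end_positive other_endK glueK end_abs_glue
  end_label_other end_label_abs end_positive_other end_positive_glue.

Lemma exposedE (e : composite) : exposed e = outer e.
Proof. by case: e => [[i|i]|[i|i]]; rewrite /exposed /= ?eqxx. Qed.

Lemma exposed_outer_end u : exposed (outer_end u : composite).
Proof. by rewrite exposedE; case: u. Qed.

Lemma outer_endK u : end_node (outer_end u : arc_end N) = u.
Proof. by case: u. Qed.

Lemma exposed_node (e : composite) : exposed e -> outer_end (end_node e) = e.
Proof. by rewrite exposedE; case: e => [[i|i]|[i|i]]. Qed.

Lemma path_endsE u : path_ends C' D' u = chain (outer_end u : composite).
Proof.
rewrite /path_ends /chain; congr (take _.+1 _).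
by apply: eq_find => e; rewrite /halts exposedE.
Qed.

Lemma path_lastE u : path_last C' D' u = end_node (target (outer_end u : composite)).
Proof. by rewrite /path_last path_endsE. Qed.

Lemma outer_end_path_last u :
  outer_end (path_last C' D' u) = target (outer_end u : composite).
Proof. by rewrite path_lastE exposed_node // target_exposed // exposed_outer_end. Qed.

Lemma mate_mul u : mate (diagram_mul C' D') u = path_last C' D' u.
Proof. by rewrite /mate ffunE. Qed.

Lemma label_mul u :
  label (diagram_mul C' D') u = strand_low (outer_end u : composite).
Proof. by rewrite /label ffunE path_endsE. Qed.

Lemma mate_mulE u : outer_end (mate (diagram_mul C' D') u) = target (outer_end u : composite).
Proof. by rewrite mate_mul outer_end_path_last. Qed.

Lemma prod_exposed (R : Type) (one : R) (op : Monoid.com_law one) (H : composite -> R) :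
  \big[op/one]_(s | positive s && exposed s) H s =
  \big[op/one]_(u | node_positive u) H (outer_end u : composite).
Proof.
have inj_outer : injective (fun u : node N => outer_end u : composite).
  by move=> u v /(congr1 (@end_node N)); rewrite !outer_endK.
rewrite (@big_inj_image _ _ _ _ _ (fun u : node N => outer_end u : composite) _ _ inj_outer).
  apply: eq_bigl => u; rewrite exposed_outer_end andbT.
  by rewrite /positive /= /end_positive outer_endK.
by move=> e /andP[_ fe]; exists (end_node e); rewrite exposed_node.
Qed.

End Two.

Section Three.
Variables C D F : odiag N.

Definition end3 : Type := (arc_end N + node N)%type.
HB.instance Definition _ := Finite.on end3.

Definition other_end3 (t : end3) : end3 :=
  match t with
  | inl e => inl (other_end (val C) (val D) e)
  | inr u => inr (mate (val F) u)
  end.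

Definition glue3 (t : end3) : end3 :=
  match t with
  | inl (inl (inr i)) => inl (inr (inl i))
  | inl (inr (inl i)) => inl (inl (inr i))
  | inl (inr (inr i)) => inr (inl i)
  | inr (inl i) => inl (inr (inr i))
  | _ => t
  end.

Definition node3 (t : end3) : node N := match t with inl e => end_node e | inr u => u end.

Definition label3 (t : end3) : nat :=
  match t with inl e => end_label (val C) (val D) e | inr u => label (val F) u end.

Fact other_end3K : involutive other_end3.
Proof. by case=> [e|u] /=; rewrite ?other_endK // mateK //; apply: valP. Qed.

Fact glue3K : involutive glue3.
Proof. by do 3?case. Qed.

Fact abs_glue3 t : node_abs (node3 (glue3 t)) = node_abs (node3 t).
Proof. by do 3?case: t => t. Qed.

Fact label3_other t : label3 (other_end3 t) = label3 t.
Proof. by case: t => [e|u] /=; rewrite ?end_label_other // label_mate //; apply: valP. Qed.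

Fact label3_abs t : label3 t <= node_abs (node3 t).
Proof. by case: t => [e|u] /=; rewrite ?end_label_abs // label_abs //; apply: valP. Qed.

Fact positive3_other t :
  node_positive (node3 (other_end3 t)) = ~~ node_positive (node3 t).
Proof.
case: t => [e|u] /=; first exact: end_positive_other.
by apply: mate_positive; apply: valP.
Qed.

Fact positive3_glue t : glue3 t != t ->
  node_positive (node3 (glue3 t)) = ~~ node_positive (node3 t).
Proof.
by case: t => [[[i|i]|[i|i]]|[i|i]] /=; rewrite ?eqxx // => _;
  [exact: (opp_node_positive (inr i))|exact: (opp_node_positive (inl i))
  |exact: (opp_node_positive (inr i))|exact: (opp_node_positive (inl i))].
Qed.

(** The triple composition C o D o F. *)
Definition composite3 : tangle := @Tangle end3 other_end3 glue3
  (fun t => node_abs (node3 t)) label3 (fun t => node_positive (node3 t))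
  other_end3K glue3K abs_glue3 label3_other label3_abs positive3_other positive3_glue.

Variables CD DF : odiag N.
Hypothesis defCD : val CD = diagram_mul (val C) (val D).
Hypothesis defDF : val DF = diagram_mul (val D) (val F).

(* The composition C o D as a part of C o D o F, and (C . D) o F as its contraction. *)
Definition subl (e : composite C D) : composite3 := inl e.
Definition injl (e : composite CD F) : composite3 :=
  match e with inl u => inl (outer_end u) | inr u => inr u end.
Definition srcl (e : composite CD F) : option (composite C D) :=
  match e with inl u => Some (outer_end u) | inr u => None end.

(* The composition D o F as a part of C o D o F, and C o (D . F) as its contraction. *)
Definition subr (e : composite D F) : composite3 :=
  match e with inl u => inl (inr u) | inr u => inr u end.
Definition injr (e : composite C DF) : composite3 :=
  match e with
  | inl u => inl (inl u)
  | inr u => subr (outer_end u)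
  end.
Definition srcr (e : composite C DF) : option (composite D F) :=
  match e with inl u => None | inr u => Some (outer_end u) end.

Fact subl_inj : injective subl. Proof. by move=> e f []. Qed.
Fact subl_opp e : subl (opp e) = opp (subl e). Proof. by []. Qed.
Fact subl_glu e : ~~ exposed e -> subl (glu e) = glu (subl e).
Proof. by rewrite exposedE; case: e => [[i|i]|[i|i]]. Qed.
Fact injl_inj : injective injl.
Proof. by case=> [[i|i]|[i|i]] [[j|j]|[j|j]] //= [->]. Qed.
Fact injl_glu e : injl (glu e) = glu (injl e).
Proof. by case: e => [[i|i]|[i|i]]. Qed.
Fact injl_pos e : positive (injl e) = positive e.
Proof. by case: e => [[i|i]|[i|i]]. Qed.
Fact injl_abs e : tabs (injl e) = tabs e.
Proof. by case: e => [[i|i]|[i|i]]. Qed.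
Fact coverl t : (exists e, t = injl e) \/ (exists e, t = subl e).
Proof. by case: t => [e|u]; [right; exists e|left; exists (inr u)]. Qed.
Fact srclS e e0 : srcl e = Some e0 ->
  [/\ injl e = subl e0, exposed e0, injl (opp e) = subl (target e0) & tlab e = strand_low e0].
Proof.
case: e => //= u [<-]; rewrite defCD; split=> //; first exact: exposed_outer_end.
  by rewrite mate_mulE.
by rewrite label_mul.
Qed.
Fact srclN e : srcl e = None ->
  [/\ forall e0, injl e <> subl e0, injl (opp e) = opp (injl e) & tlab e = tlab (injl e)].
Proof. by case: e. Qed.
Fact srcl_exposed e0 : exposed e0 -> exists e, injl e = subl e0.
Proof. by move=> fe; exists (inl (end_node e0)); rewrite /= exposed_node. Qed.

Fact subr_inj : injective subr.
Proof. by case=> e [f|f] //= [->]. Qed.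
Fact subr_opp e : subr (opp e) = opp (subr e). Proof. by case: e. Qed.
Fact subr_glu e : ~~ exposed e -> subr (glu e) = glu (subr e).
Proof. by rewrite exposedE; case: e => [[i|i]|[i|i]]. Qed.
Fact subr_pos e : positive (subr e) = positive e. Proof. by case: e. Qed.
Fact subr_abs e : tabs (subr e) = tabs e. Proof. by case: e. Qed.
Fact subr_lab e : tlab (subr e) = tlab e. Proof. by case: e. Qed.
Fact injr_inj : injective injr.
Proof. by case=> [[i|i]|[i|i]] [[j|j]|[j|j]] //= [->]. Qed.
Fact injr_glu e : injr (glu e) = glu (injr e).
Proof. by case: e => [[i|i]|[i|i]]. Qed.
Fact injr_pos e : positive (injr e) = positive e.
Proof. by case: e => [[i|i]|[i|i]]. Qed.
Fact injr_abs e : tabs (injr e) = tabs e.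
Proof. by case: e => [[i|i]|[i|i]]. Qed.
Fact coverr t : (exists e, t = injr e) \/ (exists e, t = subr e).
Proof.
case: t => [[u|u]|u]; first by left; exists (inl u).
  by right; exists (inl u).
by right; exists (inr u).
Qed.
Fact srcrS e e0 : srcr e = Some e0 ->
  [/\ injr e = subr e0, exposed e0, injr (opp e) = subr (target e0) & tlab e = strand_low e0].
Proof.
case: e => //= u [<-]; rewrite defDF; split=> //; first exact: exposed_outer_end.
  by rewrite mate_mulE.
by rewrite label_mul.
Qed.
Fact srcrN e : srcr e = None ->
  [/\ forall e0, injr e <> subr e0, injr (opp e) = opp (injr e) & tlab e = tlab (injr e)].
Proof. by case: e => //= u _; split=> //; case. Qed.
Fact srcr_exposed e0 : exposed e0 -> exists e, injr e = subr e0.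
Proof. by move=> fe; exists (inr (end_node e0)); rewrite /= exposed_node. Qed.

Hypothesis tidyCD : tidy (composite C D).
Hypothesis tidyDF : tidy (composite D F).

(** Both sides are the weight of the triple composition. *)
Lemma weight_cocycle (K : fieldType) (x y : nat -> K) :
  (weight (composite C D) x y * weight (composite CD F) x y =
   weight (composite D F) x y * weight (composite C DF) x y)%R.
Proof.
rewrite -(@weight_nesting composite3 _ _ subl injl srcl subl_inj subl_opp subl_glu
  (fun=> erefl) (fun=> erefl) (fun=> erefl) injl_inj injl_glu injl_pos injl_abs
  coverl srclS srclN srcl_exposed) //.
by rewrite -(@weight_nesting composite3 _ _ subr injr srcr subr_inj subr_opp subr_glu
  subr_pos subr_abs subr_lab injr_inj injr_glu injr_pos injr_abs
  coverr srcrS srcrN srcr_exposed).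
Qed.

Let targetl e := @nesting_target composite3 _ _ subl injl srcl subl_inj subl_opp subl_glu
  injl_inj injl_glu coverl srclS srclN srcl_exposed e.
Let targetr e := @nesting_target composite3 _ _ subr injr srcr subr_inj subr_opp subr_glu
  injr_inj injr_glu coverr srcrS srcrN srcr_exposed e.
Let lowl e := @nesting_low composite3 _ _ subl injl srcl subl_inj subl_opp subl_glu
  (fun=> erefl) injl_inj injl_glu coverl srclS srclN srcl_exposed e.
Let lowr e := @nesting_low composite3 _ _ subr injr srcr subr_inj subr_opp subr_glu
  subr_lab injr_inj injr_glu coverr srcrS srcrN srcr_exposed e.

Let injl_outer u : injl (outer_end u) = injr (outer_end u).
Proof. by case: u. Qed.

(** Both products read the ends and the smallest labels of the paths of the triple
    composition. *)
Lemma diagram_mulA_odiag :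
  diagram_mul (val CD) (val F) = diagram_mul (val C) (val DF).
Proof.
have fe u : exposed (outer_end u : composite CD F) by apply: exposed_outer_end.
have fe' u : exposed (outer_end u : composite C DF) by apply: exposed_outer_end.
have Et u : injl (target (outer_end u : composite CD F)) =
    injr (target (outer_end u : composite C DF)).
  by rewrite -targetl // -targetr // injl_outer.
apply/ffunP=> u; rewrite [LHS]surjective_pairing [RHS]surjective_pairing.
congr pair.
  rewrite -!/(mate _ _) !mate_mul !path_lastE.
  have := Et u; rewrite -[in X in X -> _](exposed_node (target_exposed (fe u))).
  rewrite -[in X in X -> _](exposed_node (target_exposed (fe' u))).
  by case: (end_node _) => i; case: (end_node _) => j //= [->].
by rewrite -!/(label _ _) !label_mul -lowl // -lowr // injl_outer.
Qed.

(** The word of a path in the triple composition reduces to the word of a path of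
    C o (D . F), and also, through (C . D) o F, to a dive. *)
Lemma tidy_composite : tidy (composite CD F) -> tidy (composite C DF).
Proof.
move=> tidyL e fe.
have E : e = outer_end (end_node e) by rewrite exposed_node.
pose f : composite CD F := outer_end (end_node e).
have ff : exposed f by apply: exposed_outer_end.
have Ef : injl f = injr e by rewrite [in RHS]E -injl_outer.
have [L redl] := @nesting_reduces composite3 _ _ subl injl srcl subl_inj subl_opp subl_glu
  (fun=> erefl) (fun=> erefl) injl_inj injl_glu injl_abs coverl srclS srclN
  srcl_exposed tidyCD _ ff.
have [L' redr] := @nesting_reduces composite3 _ _ subr injr srcr subr_inj subr_opp subr_glu
  subr_abs subr_lab injr_inj injr_glu injr_abs coverr srcrS srcrN
  srcr_exposed tidyDF _ fe.
have := reduces_trans redl (tidyL f ff); rewrite Ef.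
rewrite -[tabs f]injl_abs Ef injr_abs -(lowl ff) Ef lowr //.
rewrite -[tabs (target f)]injl_abs -targetl // Ef targetr // injr_abs.
exact: (reduces_dive redr).
Qed.

End Three.
End Composite.

(** * Okada diagrams through enclosing arcs *)

Section Encloses.
Variable N : nat.
Implicit Types u v s p : node N.

Lemma label_encloses (D : diagram N) s p : okada_diagram D ->
  p != s -> p != mate D s -> encloses D s p -> label D s < label D p.
Proof.
move=> okD ps pms; have := encloses_mate okD ps pms.
wlog lt_s: s ps pms / node_pos s < node_pos (mate D s).
  move=> W; have [lt|lt|E] := ltngtP (node_pos s) (node_pos (mate D s)).
  - exact: W.
  - have := W (mate D s); rewrite mateK // label_mate // /encloses mateK //.
    by rewrite ![(node_pos (mate D s) < _) (+) _]addbC; apply.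
  - by have := mate_neq okD s; rewrite -(node_pos_inj E) eqxx.
wlog lt_p: p ps pms / node_pos p < node_pos (mate D p).
  move=> W; have [lt|lt|E] := ltngtP (node_pos p) (node_pos (mate D p)).
  - exact: W.
  - have := W (mate D p); rewrite mateK // label_mate // => W' e1 e2.
    apply: W' => //.
    + by apply: contra pms => /eqP <-; rewrite mateK.
    + by apply: contra ps => /eqP/(mate_inj okD) ->.
    + by rewrite e1.
  - by have := mate_neq okD p; rewrite -(node_pos_inj E) eqxx.
have nps := pos_neq ps; have npms := pos_neq pms.
have n3 : node_pos (mate D p) != node_pos s.
  by apply: pos_neq; apply: contra pms => /eqP <-; rewrite mateK.
have n4 : node_pos (mate D p) != node_pos (mate D s).
  by apply: pos_neq; apply: contra ps => /eqP/(mate_inj okD) ->.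
rewrite /encloses => e1 e2; apply: (label_nest okD); lia.
Qed.

(** A criterion for Okada diagrams in which all conditions are invariant under the
    exchange of the two ends of an arc, so that diagrams given by case analysis can
    be checked up to symmetry. *)
Lemma okada_encloses (D : diagram N) :
  (forall u, mate D u != u) -> involutive (mate D) ->
  (forall u, label D (mate D u) = label D u) ->
  (forall s p, p != s -> p != mate D s -> encloses D s (mate D p) = encloses D s p) ->
  (forall u, 0 < label D u <= minn (node_abs u) (node_abs (mate D u)) /\
     odd (label D u) = odd (minn (node_abs u) (node_abs (mate D u)))) ->
  (forall s p, p != s -> p != mate D s -> encloses D s p -> label D s < label D p) ->
  okada_diagram D.
Proof.
move=> neq mK lm nc bd nest; apply/and4P; split.
- by apply/forallP=> u; rewrite neq mK lm !eqxx.
- apply/forallP=> u; apply/forallP=> v; apply/negP=> /and3P[h1 h2 h3].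
  have vu : v != u by apply/eqP=> E; move: h1; rewrite E ltnn.
  have vmu : v != mate D u by apply/eqP=> E; move: h2; rewrite E ltnn.
  have := nc _ _ vu vmu; rewrite /encloses; lia.
- by apply/forallP=> u /=; have [-> ->] := bd u; rewrite eqxx.
- apply/forallP=> u; apply/forallP=> v; apply/implyP=> /and3P[h1 h2 h3].
  apply: nest; rewrite ?/encloses; last by lia.
    by apply/eqP=> E; move: h1; rewrite E ltnn.
  by apply/eqP=> E; move: h2 h3; rewrite E; lia.
Qed.

End Encloses.

(** * Multiplication by a generator *)

Section Generator.
Variables (N i : nat).
Hypothesis i_bound : 0 < i < N.
Implicit Types u v s p : node N.

Fact lo_proof : i.-1 < N. Proof. by lia. Qed.
Fact hi_proof : i < N. Proof. by lia. Qed.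
Definition lo := Ordinal lo_proof.
Definition hi := Ordinal hi_proof.
(** The nodes \bar i and \overline{i+1}, joined by an arc of A_i; they are called
    the cap ends below. *)
Definition cap_lo : node N := inr lo.
Definition cap_hi : node N := inr hi.
Local Notation a := cap_lo.
Local Notation b := cap_hi.

Lemma lo_eq (k : 'I_N) : (k.+1 == i) = (k == lo).
Proof. by rewrite -val_eqE /=; lia. Qed.

Lemma hi_eq (k : 'I_N) : (k.+1 == i.+1) = (k == hi).
Proof. by rewrite -val_eqE. Qed.

Lemma insubd_lo (k : 'I_N) : insubd k i.-1 = lo.
Proof. by apply: val_inj; rewrite val_insubd lo_proof. Qed.

Lemma insubd_hi (k : 'I_N) : insubd k i = hi.
Proof. by apply: val_inj; rewrite val_insubd hi_proof. Qed.

Lemma hi_neq_lo : (hi == lo) = false.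
Proof. by rewrite -val_eqE /=; lia. Qed.

Lemma lo_neq_hi : (lo == hi) = false.
Proof. by rewrite eq_sym hi_neq_lo. Qed.

Lemma A_genE u : A_gen N i u =
  match u with
  | inl k => if k == lo then (inl hi, i) else if k == hi then (inl lo, i)
             else (inr k, k.+1)
  | inr k => if k == lo then (inr hi, i) else if k == hi then (inr lo, i)
             else (inl k, k.+1)
  end.
Proof.
by rewrite ffunE; case: u => k /=; rewrite lo_eq hi_eq insubd_lo insubd_hi.
Qed.

Lemma mate_gen_l (k : 'I_N) : mate (A_gen N i) (inl k) =
  if k == lo then inl hi else if k == hi then inl lo else inr k.
Proof. by rewrite /mate A_genE /=; case: eqP => //; case: eqP. Qed.

Lemma mate_gen_r (k : 'I_N) : mate (A_gen N i) (inr k) =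
  if k == lo then inr hi else if k == hi then inr lo else inl k.
Proof. by rewrite /mate A_genE /=; case: eqP => //; case: eqP. Qed.

Lemma label_gen u : label (A_gen N i) u =
  if (node_abs u == i) || (node_abs u == i.+1) then i else node_abs u.
Proof.
by rewrite /label A_genE; case: u => k; rewrite /= lo_eq hi_eq; case: eqP => //; case: eqP.
Qed.

Lemma okada_gen_diagram : okada_diagram (A_gen N i).
Proof.
apply: okada_encloses.
- case=> k; rewrite ?mate_gen_l ?mate_gen_r -!val_eqE /=; repeat case: ifP => /=;
    rewrite ?(inj_eq inl_inj) ?(inj_eq inr_inj) -?val_eqE /=; lia.
- case=> k; rewrite ?mate_gen_l ?mate_gen_r;
    (case: (eqVneq k lo) => [->|/negbTE kl] /=; last case: (eqVneq k hi) => [->|/negbTE kh] /=);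
    by rewrite ?mate_gen_l ?mate_gen_r ?hi_neq_lo ?eqxx ?kl ?kh.
- case=> k; rewrite ?mate_gen_l ?mate_gen_r !label_gen -!val_eqE /=;
    repeat case: ifP => /=; lia.
- move=> s p; have Hi := hi_proof.
  case: s => s; case: p => p; rewrite /encloses ?mate_gen_l ?mate_gen_r;
   have := ltn_ord s; have := ltn_ord p;
   rewrite -!val_eqE /=; repeat case: ifP => /=;
   rewrite ?(inj_eq inl_inj) ?(inj_eq inr_inj) -?val_eqE /=; lia.
- case=> k; rewrite ?mate_gen_l ?mate_gen_r label_gen /= -!val_eqE /=;
    repeat case: ifP => /=; lia.
- move=> s p; have Hi := hi_proof.
  case: s => s; case: p => p; rewrite /encloses ?mate_gen_l ?mate_gen_r !label_gen;
   have := ltn_ord s; have := ltn_ord p;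
   rewrite -!val_eqE /=; repeat case: ifP => /=;
   rewrite ?(inj_eq inl_inj) ?(inj_eq inr_inj) -?val_eqE /=; lia.
Qed.

Definition is_cap u := (u == a) || (u == b).

Lemma cap_neq : a != b.
Proof. by rewrite (inj_eq inr_inj) lo_neq_hi. Qed.

Definition other_cap u := if u == a then b else a.

Lemma other_cap_cap u : is_cap (other_cap u).
Proof. by rewrite /is_cap /other_cap; case: ifP; rewrite eqxx ?orbT. Qed.

Lemma other_cap_lo : other_cap a = b.
Proof. by rewrite /other_cap eqxx. Qed.

Lemma other_cap_hi : other_cap b = a.
Proof. by rewrite /other_cap eq_sym (negbTE cap_neq). Qed.

Lemma other_capK u : is_cap u -> other_cap (other_cap u) = u.
Proof.
rewrite /is_cap /other_cap; case: eqP => [-> _|_ /= /eqP->]; rewrite ?eqxx //.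
by rewrite eq_sym (negbTE cap_neq).
Qed.

Lemma cap_node_abs u : is_cap u -> node_abs u = i \/ node_abs u = i.+1.
Proof. by case/orP=> /eqP ->; [left=> /=; lia|right]. Qed.

Lemma label_gen_cap u : node_abs u = i \/ node_abs u = i.+1 -> label (A_gen N i) u = i.
Proof. by rewrite label_gen // => -[] ->; rewrite eqxx ?orbT. Qed.

Lemma other_cap_abs u : is_cap u ->
  node_abs u = i /\ node_abs (other_cap u) = i.+1 \/
  node_abs u = i.+1 /\ node_abs (other_cap u) = i.
Proof.
rewrite /is_cap /other_cap; case: (eqVneq u a) => [->|_] /=; first by left; lia.
by move/eqP=> ->; right=> /=; lia.
Qed.

Lemma label_gen_idle (k : 'I_N) : k != lo -> k != hi ->
  label (A_gen N i) (inl k) = k.+1 /\ label (A_gen N i) (inr k) = k.+1.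
Proof.
move=> kl kh; rewrite !label_gen // -![node_abs _]/(k.+1).
by rewrite lo_eq hi_eq (negbTE kl) (negbTE kh).
Qed.

Lemma pos_cap : [/\ node_pos a = N.*2 - i, node_pos b = (N.*2 - i).-1,
  node_abs a = i & node_abs b = i.+1].
Proof. by rewrite /=; split; lia. Qed.

Lemma odd_pos_cap : [/\ odd (node_pos a) = odd i, odd (node_pos b) = ~~ odd i &
  node_pos b < node_pos a].
Proof. by have [-> -> _ _] := pos_cap; split; lia. Qed.

End Generator.

(** ** Strands of the product by a generator *)

Definition gen_odiag N i (hi : 0 < i < N) : odiag N := exist _ (A_gen N i) (okada_gen_diagram hi).

Section GeneratorRoutes.
Variables (N i : nat).
Hypothesis i_bound : 0 < i < N.
Variable F : odiag N.
Implicit Types u v s p : node N.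
Local Notation a := (cap_lo i_bound).
Local Notation b := (cap_hi i_bound).
Local Notation lo := (lo i_bound).
Local Notation hi := (hi i_bound).
Local Notation A := (gen_odiag i_bound).
Local Notation G := (composite F A).
Local Notation f := (val F).
Local Notation is_cap := (is_cap i_bound).
Local Notation other_cap := (other_cap i_bound).

Let okF : okada_diagram f. Proof. exact: valP. Qed.

(** Right multiplication of F by A_i: the cap ends become mates, and the two arcs
    that arrived there are joined. *)
Definition rewire_mate u :=
  if is_cap u then other_cap u
  else if is_cap (mate f u) then mate f (other_cap (mate f u)) else mate f u.

Definition rewire_label u :=
  if is_cap u then i
  else if is_cap (mate f u) then minn (label f u) (label f (other_cap (mate f u)))
  else label f u.

(* The passages through the identity strands of A_i, after and before the part of
   a path that lies in F; their words are empty. *)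
Definition coda (m : node N) : seq G := if m is inr k then [:: (inr (inl k) : G)] else [::].
Definition prelude (m : node N) : seq G := if m is inr k then [:: (inr (inr k) : G)] else [::].

Definition left_end u : G := inl u.

Lemma cap_label u : is_cap u -> label f u <= i.+1.
Proof.
by case/orP=> /eqP ->; have := label_abs okF a; have := label_abs okF b; rewrite /=; lia.
Qed.

Lemma route_coda u : ~~ is_cap (mate f u) ->
  route (left_end u) (left_end u :: coda (mate f u)) /\
  opp (last (left_end u) (coda (mate f u))) = outer_end (mate f u).
Proof.
case E: (mate f u) => [k|k] nc /=.
  by split; [apply: Route_halt; rewrite /halts exposedE /= E|rewrite E].
have [/negbTE kl /negbTE kh] : k != lo /\ k != hi.
  by move: nc; rewrite /is_cap !(inj_eq inr_inj) => /norP.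
rewrite mate_gen_l kl kh; split=> //; apply: Route_step.
  by rewrite /halts exposedE /= E.
rewrite /nxt /= E /=; apply: Route_halt.
by rewrite /halts exposedE /= mate_gen_l kl kh.
Qed.

Lemma route_turn u r : is_cap (mate f u) -> route (left_end (other_cap (mate f u))) r ->
  route (left_end u) [:: left_end u, (inr (opp_node (mate f u)) : G) & r].
Proof.
move=> cu R; apply: Route_step.
  by case/orP: cu => /eqP E; rewrite /halts exposedE /= E.
have -> : nxt (left_end u) = inr (opp_node (mate f u)).
  by case/orP: cu => /eqP E; rewrite /nxt /= E.
have En : nxt (inr (opp_node (mate f u)) : G) = left_end (other_cap (mate f u)).
  rewrite /nxt /other_cap; case: (eqVneq (mate f u) a) cu => [->|na] /=.
    by rewrite mate_gen_l eqxx.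
  by rewrite /is_cap (negbTE na) /= => /eqP ->; rewrite /= mate_gen_l hi_neq_lo eqxx.
apply: Route_step; rewrite ?En //.
by case/orP: cu => /eqP E; rewrite /halts exposedE /= E /= mate_gen_l ?hi_neq_lo ?eqxx.
Qed.

Lemma arcw_genE u : arcw (inr u : G) =
  dive (node_abs u) (label (A_gen N i) u) (node_abs (mate (A_gen N i) u)).
Proof. by []. Qed.

Lemma word_coda m : ~~ is_cap m -> word (coda m) = [::].
Proof.
case: m => k //= nc; have [/negbTE kl /negbTE kh] : k != lo /\ k != hi.
  by move: nc; rewrite /is_cap !(inj_eq inr_inj) => /norP.
rewrite /word /= cats0 arcw_genE (mate_gen_l i_bound) (label_gen i_bound) /= lo_eq hi_eq kl kh /=.
by rewrite /dive subnn.
Qed.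

Lemma word_prelude m : ~~ is_cap m -> word (prelude m) = [::].
Proof.
case: m => k //= nc; have [/negbTE kl /negbTE kh] : k != lo /\ k != hi.
  by move: nc; rewrite /is_cap !(inj_eq inr_inj) => /norP.
rewrite /word /= cats0 arcw_genE (mate_gen_r i_bound) (label_gen i_bound) /= lo_eq hi_eq kl kh /=.
by rewrite /dive subnn.
Qed.

(* The part of a path between these passages. *)
Definition core u : seq G :=
  if is_cap (mate f u) then
    [:: left_end u; (inr (opp_node (mate f u)) : G);
        left_end (other_cap (mate f u))]
  else [:: left_end u].

Definition strand u := prelude u ++ core u ++ coda (rewire_mate u).

Lemma rewire_ncap u : ~~ is_cap u -> ~~ is_cap (rewire_mate u).
Proof.
move=> nu; rewrite /rewire_mate (negbTE nu); case: ifP => [cm|/negbT //].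
have Eu : mate f (mate f u) = u by rewrite mateK.
apply/negP=> cm2.
have [E|E] : mate f (other_cap (mate f u)) = mate f u \/
    mate f (other_cap (mate f u)) = other_cap (mate f u).
- move: cm cm2; rewrite /is_cap /other_cap.
  case: (eqVneq (mate f u) a) => [->|_] /=.
    by move=> _ /orP[/eqP->|/eqP->]; [left|right].
  by move/eqP=> -> /orP[/eqP->|/eqP->]; [right|left].
- by move: (other_cap_cap i_bound (mate f u)); rewrite -(mateK okF (other_cap _)) E Eu (negbTE nu).
- by have := mate_neq okF (other_cap (mate f u)); rewrite E eqxx.
Qed.

Lemma route_core u : ~~ is_cap u ->
  route (left_end u) (core u ++ coda (rewire_mate u)) /\
  opp (last (left_end u) (core u ++ coda (rewire_mate u))) = outer_end (rewire_mate u).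
Proof.
move=> nu; have := rewire_ncap nu; rewrite /core /rewire_mate (negbTE nu).
case: ifP => [cm ncm|/negbT nc _]; last exact: route_coda.
have [R E] := route_coda ncm; split; last by [].
exact: route_turn.
Qed.

Lemma route_strand u : ~~ is_cap u ->
  route (outer_end u : G) (strand u) /\
  opp (last (outer_end u : G) (strand u)) = outer_end (rewire_mate u).
Proof.
move=> nu; have [R E] := route_core nu; rewrite /strand.
case: u nu R E => k nu R E //.
have [/negbTE kl /negbTE kh] : k != lo /\ k != hi.
  by move: nu; rewrite /is_cap !(inj_eq inr_inj) => /norP.
split.
  apply: Route_step; first by rewrite /halts exposedE /= mate_gen_r kl kh.
  by rewrite /nxt /= mate_gen_r kl kh.
by move: E; rewrite {1}(route_cons R) [in X in _ -> X](route_cons R).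
Qed.

Lemma route_cap u : is_cap u -> route (outer_end u : G) [:: (outer_end u : G)] /\
  opp (outer_end u : G) = outer_end (other_cap u).
Proof.
rewrite /is_cap /other_cap; case: (eqVneq u a) => [-> _|_ /= /eqP->] /=;
  rewrite mate_gen_r ?hi_neq_lo ?eqxx; split=> //; apply: Route_halt;
  by rewrite /halts exposedE /= mate_gen_r ?hi_neq_lo ?eqxx.
Qed.

Lemma mate_mul_gen u : mate (diagram_mul f (A_gen N i)) u = rewire_mate u.
Proof.
rewrite (mate_mul F A) path_lastE /target /rewire_mate.
case: (boolP (is_cap u)) => [cu|nu].
  have [R E] := route_cap cu; rewrite (route_chain R) /= in E *.
  by rewrite E outer_endK.
have [R E] := route_strand nu; rewrite (route_chain R) E outer_endK.
by rewrite /rewire_mate (negbTE nu).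
Qed.

Lemma label_coda m : ~~ is_cap m -> all (fun e : G => node_abs m <= tlab e) (coda m).
Proof.
case: m => k //= nc; have [kl kh] : k != lo /\ k != hi.
  by move: nc; rewrite /is_cap !(inj_eq inr_inj) => /norP.
by rewrite /tlab /=; have [-> _] := label_gen_idle kl kh; rewrite leqnn.
Qed.

Lemma label_prelude m : ~~ is_cap m -> all (fun e : G => node_abs m <= tlab e) (prelude m).
Proof.
case: m => k //= nc; have [kl kh] : k != lo /\ k != hi.
  by move: nc; rewrite /is_cap !(inj_eq inr_inj) => /norP.
by rewrite /tlab /=; have [_ ->] := label_gen_idle kl kh; rewrite leqnn.
Qed.

Lemma low_all (H : tangle) (e : H) r l : e \in r ->
  (l <= low e r) = all (fun g : H => l <= tlab g) r.
Proof. by move=> er; rewrite leq_low andb_idl // => /allP/(_ e er). Qed.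

Lemma rewire_label_abs u : ~~ is_cap u ->
  rewire_label u <= node_abs u /\ rewire_label u <= node_abs (rewire_mate u).
Proof.
move=> nu; rewrite /rewire_label /rewire_mate (negbTE nu).
have := label_abs okF u; have := label_abs_mate okF u.
have := label_abs_mate okF (other_cap (mate f u)).
by case: ifP => _; lia.
Qed.

Lemma label_mul_gen u : label (diagram_mul f (A_gen N i)) u = rewire_label u.
Proof.
rewrite (label_mul F A) /strand_low /rewire_label.
case: (boolP (is_cap u)) => [cu|nu].
  have [R E] := route_cap cu; rewrite (route_chain R) /= minnn.
  case: u cu {R E} => k cu; first by case/orP: cu.
  exact: (label_gen_cap i_bound (cap_node_abs cu)).
have [R E] := route_strand nu; rewrite (route_chain R).
rewrite -[RHS](_ : rewire_label u = _); last by rewrite /rewire_label (negbTE nu).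
have [le1 le2] := rewire_label_abs nu.
have mem : (outer_end u : G) \in strand u by rewrite (route_cons R) mem_head.
have sub_all (r : seq G) k l : l <= k -> all (fun g : G => k <= tlab g) r ->
    all (fun g : G => l <= tlab g) r.
  by move=> lk; apply: sub_all => g; apply: leq_trans.
have coreE l : all (fun g : G => l <= tlab g) (core u) =
    (l <= rewire_label u).
  rewrite /core /rewire_label (negbTE nu); case: (boolP (is_cap (mate f u))) => cm;
    last by rewrite /= andbT.
  rewrite /= /tlab /= /left_end /= andbT leq_min.
  rewrite (label_gen_cap i_bound); last by case: (mate f u) (cap_node_abs cm).
  have := label_abs_mate okF u; have := label_abs okF (other_cap (mate f u)).
  by rewrite -![sval F]/(val F); case: (other_cap_abs cm) => -[-> ->]; lia.
apply/eqP; rewrite eqn_leq; apply/andP; split.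
  rewrite -coreE; have := leqnn (low (outer_end u : G) (strand u)).
  by rewrite {2}/strand low_all // !all_cat => /and3P[].
rewrite low_all // !all_cat coreE leqnn /=; apply/andP; split.
  exact: sub_all (label_prelude nu).
exact: sub_all (label_coda (rewire_ncap nu)).
Qed.

End GeneratorRoutes.

(** ** The product by a generator is an Okada diagram *)

Lemma dive_cap_up n l c w : l <= c ->
  dive n l c ++ dive c c c.+1 ++ w = dive n l c.+1 ++ w.
Proof.
move=> lc; rewrite /dive subnn subSnn (subSn lc) (nseqS_rcons true (c - l)) -!catA.
by rewrite cat_rcons.
Qed.

Lemma dive_cap_down w c l n : l <= c ->
  w ++ dive c.+1 c c ++ dive c l n = w ++ dive c.+1 l n.
Proof. by move=> lc; rewrite /dive subnn subSnn (subSn lc). Qed.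

Section GeneratorWords.
Variables (N i : nat).
Hypothesis i_bound : 0 < i < N.
Variable F : odiag N.
Implicit Types u v s p : node N.
Local Notation a := (cap_lo i_bound).
Local Notation b := (cap_hi i_bound).
Local Notation A := (gen_odiag i_bound).
Local Notation G := (composite F A).
Local Notation f := (val F).
Local Notation is_cap := (is_cap i_bound).
Local Notation other_cap := (other_cap i_bound).
Local Notation rewire_mate := (rewire_mate i_bound F).
Local Notation rewire_label := (rewire_label i_bound F).
Local Notation strand := (strand i_bound F).

Let okF : okada_diagram f. Proof. exact: valP. Qed.

Lemma arcw_left u : arcw (inl u : G) = dive (node_abs u) (label f u) (node_abs (mate f u)).
Proof. by []. Qed.

Lemma word_strand u : ~~ is_cap u -> word (strand u) =
  if is_cap (mate f u) then
    dive (node_abs u) (label f u) i.+1 ++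
    dive i.+1 (label f (other_cap (mate f u))) (node_abs (rewire_mate u))
  else dive (node_abs u) (label f u) (node_abs (mate f u)).
Proof.
move=> nu; have nr := rewire_ncap F nu.
rewrite /strand !word_cat word_prelude // word_coda // cats0 cat0s /core.
case: ifP => cm; last by rewrite word1 arcw_left.
rewrite 2!word_cons word1 !arcw_left arcw_genE.
have ca : node_abs (opp_node (mate f u)) = node_abs (mate f u) by case: (mate f u).
have cl : label (A_gen N i) (opp_node (mate f u)) = i.
  by apply: (label_gen_cap i_bound); rewrite ca; apply: cap_node_abs.
have cmate : node_abs (mate (A_gen N i) (opp_node (mate f u))) = node_abs (other_cap (mate f u)).
  have := cm; rewrite /is_cap /other_cap; case: (eqVneq (mate f u) a) => [->|_] /=.
    by rewrite (mate_gen_l i_bound) eqxx.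
  by move/eqP=> -> /=; rewrite (mate_gen_l i_bound) hi_neq_lo eqxx.
rewrite ca cl cmate /rewire_mate (negbTE nu) cm.
have lu := label_abs_mate okF u; have lo := label_abs okF (other_cap (mate f u)).
have [[E1 E2]|[E1 E2]] := other_cap_abs cm; rewrite E1 E2 in lu lo *.
  by rewrite dive_cap_up.
by rewrite (dive_cap_down _ _ lo).
Qed.

Hypothesis ncup : mate f a != b.

Lemma mate_cap_ncap u : is_cap u -> ~~ is_cap (mate f u).
Proof.
have nb : mate f b != a by apply: contra ncup => /eqP <-; rewrite mateK.
by case/orP=> /eqP ->; rewrite /is_cap negb_or ?ncup ?nb ?mate_neq ?andbT.
Qed.

(** The arcs of F at the cap ends are nested one way, lie on both sides of the cap,
    or are nested the other way; nesting orders their labels. *)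
Lemma cap_arcs u v : u = mate f a -> v = mate f b ->
  [|| [&& node_pos u < node_pos v, node_pos v < node_pos b & label f a < label f b],
      (node_pos v < node_pos b) && (node_pos a < node_pos u) |
      [&& node_pos a < node_pos u, node_pos u < node_pos v & label f b < label f a]].
Proof.
move=> Eu Ev.
have un : ~~ is_cap u by rewrite Eu; apply: mate_cap_ncap; rewrite /is_cap eqxx.
have vn : ~~ is_cap v by rewrite Ev; apply: mate_cap_ncap; rewrite /is_cap eqxx orbT.
have [/pos_neq ua /pos_neq ub] : u != a /\ u != b.
  by split; apply: contra un => /eqP->; rewrite /is_cap eqxx ?orbT.
have [/pos_neq va /pos_neq vb] : v != a /\ v != b.
  by split; apply: contra vn => /eqP->; rewrite /is_cap eqxx ?orbT.
have /pos_neq uv : u != v.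
  by rewrite Eu Ev; apply: contra (cap_neq i_bound) => /eqP/(mate_inj okF)->.
have ba : b != a by rewrite eq_sym; apply: cap_neq.
have bu : b != u by apply: contra un => /eqP <-; rewrite /is_cap eqxx orbT.
have av : a != v by apply: contra vn => /eqP <-; rewrite /is_cap eqxx.
rewrite Eu in bu; rewrite Ev in av.
have := encloses_mate okF ba bu.
have := label_encloses okF ba bu; have := label_encloses okF (cap_neq _) av.
have [E1 E2 _ _] := pos_cap i_bound; rewrite /encloses -!Eu -!Ev {}E1 {}E2 in ua ub va vb *.
move: (label f a) (label f b) (node_pos u) (node_pos v) ua ub va vb uv => la lb p q.
clear -i_bound; set P := N.*2 - i; have P0 : 0 < P by rewrite /P; lia.
have EP : P.-1 = P - 1 by lia.
rewrite {}EP; clearbody P; clear i_bound.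
have -> : P - 1 < P by lia.
have -> : (P < P - 1) = false by lia.
rewrite addTb addFb.
case hq: (q < P) => /=; case hp: (p < P - 1) => /=; case hpq: (p < q) => /=;
  case hq': (P < q) => /= *; lia.
Qed.
End GeneratorWords.

Section GeneratorProduct.
Variables (N i : nat).
Hypothesis i_bound : 0 < i < N.
Variable F : odiag N.
Implicit Types u v s p : node N.
Local Notation a := (cap_lo i_bound).
Local Notation b := (cap_hi i_bound).
Local Notation A := (gen_odiag i_bound).
Local Notation G := (composite F A).
Local Notation f := (val F).
Local Notation is_cap := (is_cap i_bound).
Local Notation other_cap := (other_cap i_bound).
Local Notation rewire_mate := (rewire_mate i_bound F).
Local Notation rewire_label := (rewire_label i_bound F).
Local Notation strand := (strand i_bound F).

Let okF : okada_diagram f. Proof. exact: valP. Qed.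

(** The peak between two arcs joined by the cap has even height.  In each of the
    three positions of [cap_arcs] the larger label belongs to an arc for which the
    parity of positions decides. *)
Lemma cap_odd : mate f a != b -> ~~ odd (i.+1 - maxn (label f a) (label f b)).
Proof.
move=> ncup; have := cap_arcs ncup erefl erefl.
have oa := odd_label a okF; have ob := odd_label b okF.
have la := label_abs okF a; have lb := label_abs okF b.
have [E1 E2 E3 E4] := pos_cap i_bound; rewrite E3 E4 in la lb.
have pu := mate_positive okF a; have pv := mate_positive okF b.
rewrite oddB; last by rewrite geq_max lb (leq_trans la).
have [oP oP' ba] := odd_pos_cap i_bound.
move: pu pv; rewrite /node_positive oP oP' !negbK => pu pv.
case/or3P=> [/and3P[h1 h2 h3]|/andP[h1 h2]|/and3P[h1 h2 h3]].
- rewrite (maxn_idPr (ltnW h3)) ob (maxn_idPl (ltnW h2)) oP' /=.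
  by case: odd.
- rewrite /maxn; case: ifP => _; first by rewrite ob (maxn_idPl (ltnW h1)) oP' /=; case: odd.
  by rewrite oa (maxn_idPr (ltnW h2)) /= -pu; case: odd.
- rewrite (maxn_idPl (ltnW h3)) oa (maxn_idPr (ltnW h1)) /= -pu.
  by case: odd.
Qed.

Lemma core_ncup u : ~~ is_cap u -> is_cap (mate f u) -> mate f a != b.
Proof.
move=> nu cu; apply: contra nu => /eqP E.
have E' : mate f b = a by rewrite -E mateK.
by rewrite -(mateK okF u); case/orP: cu => /eqP->; rewrite ?E ?E' /is_cap eqxx ?orbT.
Qed.

Lemma maxn_caps u : is_cap u ->
  maxn (label f u) (label f (other_cap u)) = maxn (label f a) (label f b).
Proof.
rewrite /is_cap /other_cap; case: (eqVneq u a) => [-> //|_ /= /eqP->].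
exact: maxnC.
Qed.

Lemma tidy_gen : tidy G.
Proof.
move=> e fe; have E : e = outer_end (end_node e) by rewrite exposed_node.
move: (end_node e) E => u E; rewrite {}E {e fe}.
have Et : target (outer_end u : G) = outer_end (rewire_mate u).
  by rewrite -(mate_mul_gen i_bound F) (mate_mulE F A).
have El : strand_low (outer_end u : G) = rewire_label u.
  by rewrite -(label_mul_gen i_bound F) (label_mul F A).
have Ea v : tabs (outer_end v : G) = node_abs v by rewrite /tabs /= /end_abs outer_endK.
rewrite Et El !Ea /strand_evens Ea.
have [cu|nu] := boolP (is_cap u).
  have [R E] := route_cap F cu; rewrite (route_chain R) word1 /arcw E !Ea.
  have -> : tlab (outer_end u : G) = i.
    case: u cu {Et El R E} => k cu; first by case/orP: cu.
    exact: (label_gen_cap i_bound (cap_node_abs cu)).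
  rewrite /rewire_mate /rewire_label cu evens_dive; exact: reduces_refl.
have [R _] := route_strand F nu; rewrite (route_chain R) word_strand //.
rewrite /rewire_label (negbTE nu); case: ifP => cm; last first.
  rewrite evens_dive /rewire_mate (negbTE nu) cm; exact: reduces_refl.
have [le1 le2] := rewire_label_abs F nu.
have [] := @reduces_dives (node_abs u) (label f u) i.+1 (label f (other_cap (mate f u)))
  (node_abs (rewire_mate u)).
- exact: label_abs.
- by rewrite -label_mate //; apply: cap_label cm.
- exact: cap_label (other_cap_cap _ _).
- by rewrite /rewire_mate (negbTE nu) cm; apply: label_abs_mate.
- rewrite -(label_mate okF u) maxn_caps //; exact: cap_odd (core_ncup nu cm).
by move=> L /reduces_normal; apply; rewrite evens_dive.
Qed.

(** The cap ends are adjacent, so that no other node separates them. *)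
Lemma cap_adjacent u : ~~ is_cap u -> (node_pos a < node_pos u) = (node_pos b < node_pos u) /\
  (node_pos u < node_pos a) = (node_pos u < node_pos b).
Proof.
move=> nu; have [E1 E2 _ _] := pos_cap i_bound.
have [/pos_neq ua /pos_neq ub] : u != a /\ u != b.
  by split; apply: contra nu => /eqP->; rewrite /is_cap eqxx ?orbT.
lia.
Qed.

Lemma rewire_cup : mate f a = b -> rewire_mate =1 mate f.
Proof.
move=> E u; rewrite /rewire_mate; case: ifP => [|/negbT nu].
  rewrite /is_cap /other_cap; case: (eqVneq u a) => [->|_ /= /eqP->] //.
  by rewrite -E mateK.
by case: ifP => // /(core_ncup nu); rewrite E eqxx.
Qed.

Lemma rewire_cup_label : mate f a = b -> forall u, rewire_label u = if is_cap u then i else label f u.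
Proof.
move=> E u; rewrite /rewire_label; case: ifP => // /negbT nu.
by case: ifP => // /(core_ncup nu); rewrite E eqxx.
Qed.

Local Notation D := (diagram_mul f (A_gen N i)).

Lemma mateD u : mate D u = rewire_mate u. Proof. exact: mate_mul_gen. Qed.
Lemma labelD u : label D u = rewire_label u. Proof. exact: label_mul_gen. Qed.

(** When F already joins the cap ends, only the label of that arc changes, to the
    largest value allowed. *)
Lemma okada_mul_cup : mate f a = b -> okada_diagram D.
Proof.
move=> E; have E' : mate f b = a by rewrite -E mateK.
have mD u : mate D u = mate f u by rewrite mateD rewire_cup.
have lD u : label D u = if is_cap u then i else label f u by rewrite labelD rewire_cup_label.
have cap_m u : is_cap (mate f u) = is_cap u.
  apply/idP/idP; last by case/orP=> /eqP->; rewrite ?E ?E' /is_cap eqxx ?orbT.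
  by move/orP=> [] /eqP Em; rewrite -(mateK okF u) Em ?E ?E' /is_cap eqxx ?orbT.
have encD s p : encloses D s p = encloses f s p by rewrite /encloses mD.
have cap_le u : is_cap u -> label f u <= i.
  have := label_abs okF a; have := label_abs_mate okF b; rewrite E' => l1 l2.
  have [_ _ E3 _] := pos_cap i_bound; rewrite E3 in l1 l2.
  by case/orP=> /eqP ->.
have cap_abs u : is_cap u -> minn (node_abs u) (node_abs (mate f u)) = i.
  have [_ _ E3 E4] := pos_cap i_bound.
  by case/orP=> /eqP ->; rewrite ?E ?E' E3 E4 ?(minn_idPl (leqnSn i)) ?(minn_idPr (leqnSn i)).
apply: okada_encloses.
- by move=> u; rewrite mD mate_neq.
- by move=> u; rewrite !mD mateK.
- by move=> u; rewrite mD !lD cap_m label_mate.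
- by move=> s p ps; rewrite !mD !encD => pms; rewrite encloses_mate.
- move=> u; rewrite mD lD; case: ifP => cu; first by rewrite cap_abs // leqnn; lia.
  by rewrite label_gt0 // leq_min label_abs // label_abs_mate // label_odd.
- move=> s p ps; rewrite mD encD !lD => pms enc.
  have lt := label_encloses okF ps pms enc.
  case: ifP => cs; case: ifP => cp //; last by rewrite (leq_trans lt) ?cap_le.
    move: ps pms cp cs; rewrite /is_cap => + + + /orP[] /eqP Es;
      by rewrite Es ?E ?E' => /negbTE-> /negbTE->.
  have Ep : ~~ is_cap p by rewrite cp.
  have [a1 a2] := cap_adjacent Ep; move: enc; rewrite /encloses.
  by case/orP: cs => /eqP->; rewrite ?E ?E' a1; case: (_ < _).
Qed.

Lemma minn_caps u : is_cap u ->
  minn (label f u) (label f (other_cap u)) = minn (label f a) (label f b).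
Proof.
rewrite /is_cap /other_cap; case: (eqVneq u a) => [-> //|_ /= /eqP->].
exact: minnC.
Qed.

Section NoCup.
Hypothesis ncup : mate f a != b.

Lemma mateD_cap u : is_cap u -> mate D u = other_cap u.
Proof. by rewrite mateD /rewire_mate => ->. Qed.

Lemma mateD_turn u : ~~ is_cap u -> is_cap (mate f u) ->
  mate D u = mate f (other_cap (mate f u)).
Proof. by rewrite mateD /rewire_mate => /negbTE-> ->. Qed.

Lemma mateD_away u : ~~ is_cap u -> ~~ is_cap (mate f u) -> mate D u = mate f u.
Proof. by rewrite mateD /rewire_mate => /negbTE-> /negbTE->. Qed.

Lemma labelD_cap u : is_cap u -> label D u = i.
Proof. by rewrite labelD /rewire_label => ->. Qed.

Lemma labelD_turn u : ~~ is_cap u -> is_cap (mate f u) ->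
  label D u = minn (label f a) (label f b).
Proof.
rewrite labelD /rewire_label => /negbTE-> cm; rewrite cm -(label_mate okF u).
exact: minn_caps.
Qed.

Lemma labelD_away u : ~~ is_cap u -> ~~ is_cap (mate f u) -> label D u = label f u.
Proof. by rewrite labelD /rewire_label => /negbTE-> /negbTE->. Qed.

Lemma mate_ncap u : is_cap u -> ~~ is_cap (mate f u).
Proof. exact: mate_cap_ncap. Qed.

Lemma mateD_ncap u : ~~ is_cap u -> ~~ is_cap (mate D u).
Proof. by rewrite mateD; exact: rewire_ncap. Qed.

Lemma turn_mate u : ~~ is_cap u -> is_cap (mate f u) ->
  ~~ is_cap (mate D u) && is_cap (mate f (mate D u)).
Proof.
move=> nu cu; rewrite mateD_turn // mateK // other_cap_cap andbT.
exact/mate_ncap/other_cap_cap.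
Qed.

Lemma away_mate u : ~~ is_cap u -> ~~ is_cap (mate f u) ->
  ~~ is_cap (mate D u) && ~~ is_cap (mate f (mate D u)).
Proof. by move=> nu cu; rewrite mateD_away // mateK // cu nu. Qed.

Lemma turn_turn u v : ~~ is_cap u -> is_cap (mate f u) -> ~~ is_cap v ->
  is_cap (mate f v) -> v = u \/ v = mate D u.
Proof.
move=> nu cu nv cv; rewrite mateD_turn //.
have [E|E] : mate f v = mate f u \/ mate f v = other_cap (mate f u).
  move: cu cv; rewrite /is_cap /other_cap; case: (eqVneq (mate f u) a) => [->|_] /=.
    by move=> _ /orP[] /eqP->; [left|right].
  by move/eqP=> -> /orP[] /eqP->; [right|left].
- by left; apply: (mate_inj okF).
- by right; rewrite -E mateK.
Qed.

Lemma encloses_cap s p : is_cap s -> ~~ is_cap p -> encloses D s p = false.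
Proof.
move=> cs np; rewrite /encloses mateD_cap //; have [E _] := cap_adjacent np.
by move: cs; rewrite /is_cap /other_cap; case: eqP => [-> _|_ /= /eqP->];
  rewrite E addbb.
Qed.

(** Joining two arcs adds up, modulo 2, what they enclose. *)
Lemma encloses_turn s p : ~~ is_cap s -> is_cap (mate f s) -> ~~ is_cap p ->
  encloses D s p = encloses f a p (+) encloses f b p.
Proof.
move=> ns cs np; rewrite /encloses mateD_turn //; have [-> _] := cap_adjacent np.
rewrite addbACA addbb addFb -{1}(mateK okF s).
by move: cs; rewrite /is_cap /other_cap; case: eqP => [-> _|_ /= /eqP->] //; rewrite addbC.
Qed.

Lemma encloses_away s p : ~~ is_cap s -> ~~ is_cap (mate f s) ->
  encloses D s p = encloses f s p.
Proof. by move=> ns cs; rewrite /encloses mateD_away. Qed.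

Lemma encloses_other_cap (H : diagram N) s p : ~~ is_cap s -> ~~ is_cap (mate H s) ->
  is_cap p -> encloses H s (other_cap p) = encloses H s p.
Proof.
move=> ns nm cp; rewrite /encloses; have [_ E1] := cap_adjacent ns.
have [_ E2] := cap_adjacent nm.
by move: cp; rewrite /is_cap /other_cap; case: eqP => [-> _|_ /= /eqP->]; rewrite E1 E2.
Qed.

Lemma ncap_neq u v : is_cap u -> ~~ is_cap v -> u != v.
Proof. by move=> cu; apply: contra => /eqP <-. Qed.

(** An arc away from the cap sees both ends of a joined pair of arcs alike, since it
    sees both cap ends alike. *)
Lemma encloses_away_turn s p : ~~ is_cap s -> ~~ is_cap (mate f s) ->
  ~~ is_cap p -> is_cap (mate f p) ->
  encloses f s p = encloses f s (mate f p) /\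
  encloses f s (mate D p) = encloses f s (mate f p).
Proof.
move=> ns ms np cp; have cop := other_cap_cap i_bound (mate f p).
split; first by rewrite -{1}(mateK okF p) encloses_mate // ncap_neq.
by rewrite mateD_turn // encloses_mate ?ncap_neq // encloses_other_cap.
Qed.

Lemma away_neq p : ~~ is_cap p -> ~~ is_cap (mate f p) ->
  [/\ p != a, p != mate f a, p != b & p != mate f b].
Proof.
move=> np mp; split.
- by apply: contra np => /eqP->; rewrite /is_cap eqxx.
- by apply: contra mp => /eqP->; rewrite mateK // /is_cap eqxx.
- by apply: contra np => /eqP->; rewrite /is_cap eqxx orbT.
- by apply: contra mp => /eqP->; rewrite mateK // /is_cap eqxx orbT.
Qed.

Lemma cap_others s p : is_cap s -> p != s -> p != mate D s -> ~~ is_cap p.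
Proof.
move=> cs ps; rewrite mateD_cap // => pms; apply/negP; move: cs ps pms.
rewrite /is_cap /other_cap; case: (eqVneq s a) => [-> _|_ /= /eqP->] /negbTE-> /negbTE-> //.
Qed.

Lemma noncross_mul s p : p != s -> p != mate D s ->
  encloses D s (mate D p) = encloses D s p.
Proof.
move=> ps pms; have [cs|ns] := boolP (is_cap s).
  have np := cap_others cs ps pms.
  by rewrite !encloses_cap // mateD_ncap.
have [cs|ms] := boolP (is_cap (mate f s)).
  have [cp|np] := boolP (is_cap p).
    by rewrite mateD_cap // encloses_other_cap // mateD_ncap.
  have [cp|mp] := boolP (is_cap (mate f p)).
    by have [E|E] := turn_turn ns cs np cp; rewrite E eqxx in ps pms.
  have /andP[np' _] := away_mate np mp.
  have [pa pma pb pmb] := away_neq np mp.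
  by rewrite !encloses_turn // mateD_away // !encloses_mate.
rewrite !encloses_away //.
have [cp|np] := boolP (is_cap p); first by rewrite mateD_cap // encloses_other_cap.
have [cp|mp] := boolP (is_cap (mate f p)).
  by have [-> ->] := encloses_away_turn ns ms np cp.
by rewrite mateD_away // encloses_mate // -(mateD_away ns ms).
Qed.

(** A joined pair of arcs that encloses the cap consists of two arcs on both sides
    of it, and the arc that starts at the lower cap end then has a label below i. *)
Lemma turn_bound : minn (label f a) (label f b) < i \/
  forall s p, ~~ is_cap s -> is_cap (mate f s) -> is_cap p -> encloses D s p = false.
Proof.
have encE s p : ~~ is_cap s -> is_cap (mate f s) -> is_cap p -> encloses D s p =
    (node_pos (mate f a) < node_pos a) (+) (node_pos (mate f b) < node_pos a).
  move=> ns cs cp; have nD := mateD_ncap ns.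
  have -> : encloses D s p = encloses D s a.
    have := encloses_other_cap ns nD cp; rewrite /other_cap.
    by case: (eqVneq p a) => [-> //|_ <-].
  rewrite /encloses mateD_turn // -{1}(mateK okF s).
  move: cs; rewrite /is_cap /other_cap.
  by case: eqP => [-> _|_ /= /eqP->] //; rewrite addbC.
have [_ _ ba] := odd_pos_cap i_bound.
have na := mate_ncap (_ : is_cap a); have nb := mate_ncap (_ : is_cap b).
case/or3P: (cap_arcs ncup erefl erefl) => [/and3P[h1 h2 h3]|/andP[h1 h2]|/and3P[h1 h2 h3]].
- right=> s p ns cs cp; rewrite encE // (ltn_trans h2 ba).
  by rewrite (ltn_trans h1 (ltn_trans h2 ba)).
- left; rewrite gtn_min; apply/orP; left; rewrite (leq_ltn_trans (label_abs_mate okF a)) //.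
  move: h2; rewrite node_absE; have [E1 _ _ _] := pos_cap i_bound; rewrite E1.
  have := node_pos_lt (mate f a); move: (node_pos _) => q; clear -i_bound.
  by case: ifP; lia.
- right=> s p ns cs cp; rewrite encE // !ltnNge (ltnW h1).
  by rewrite (ltnW (ltn_trans h1 h2)).
Qed.

Lemma odd_turn : odd (minn (label f a) (label f b)) =
  odd (minn (node_abs (mate f a)) (node_abs (mate f b))).
Proof.
have oa := odd_label a okF; have ob := odd_label b okF.
have pu := mate_positive okF a; have pv := mate_positive okF b.
have [oP oP' ba] := odd_pos_cap i_bound.
have opp : node_positive (mate f b) = ~~ node_positive (mate f a).
  by rewrite pu pv /node_positive oP oP' !negbK.
rewrite odd_min_abs //; move: pu pv; rewrite /node_positive oP oP' !negbK => pu pv.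
case/or3P: (cap_arcs ncup erefl erefl) => [/and3P[h1 h2 h3]|/andP[h1 h2]|/and3P[h1 h2 h3]].
- rewrite (minn_idPl (ltnW h3)) oa (maxn_idPl (ltnW (ltn_trans h1 (ltn_trans h2 ba)))).
  by rewrite (maxn_idPr (ltnW h1)) oP -[RHS]negbK pv negbK.
- have -> : odd (minn (label f a) (label f b)) = ~~ odd i.
    rewrite /minn; case: ifP => _; rewrite ?oa ?ob.
      by rewrite (maxn_idPr (ltnW h2)) -pu negbK.
    by rewrite (maxn_idPl (ltnW h1)).
  rewrite (maxn_idPl _) -?pu ?negbK //.
  exact: ltnW (ltn_trans h1 (ltn_trans ba h2)).
- rewrite (minn_idPr (ltnW h3)) ob.
  by rewrite (maxn_idPr (ltnW (ltn_trans ba (ltn_trans h1 h2)))) (maxn_idPr (ltnW h2)).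
Qed.

Lemma okada_mul_ncup : okada_diagram D.
Proof.
have ca : is_cap a by rewrite /is_cap eqxx.
have cb : is_cap b by rewrite /is_cap eqxx orbT.
have [_ _ E3 E4] := pos_cap i_bound.
apply: okada_encloses.
- move=> u; have [cu|nu] := boolP (is_cap u).
    rewrite mateD_cap //; move: cu; rewrite /is_cap /other_cap.
    by case: eqP => [-> _|_ /= /eqP->]; rewrite ?cap_neq // eq_sym cap_neq.
  have [cm|nm] := boolP (is_cap (mate f u)); last by rewrite mateD_away // mate_neq.
  rewrite mateD_turn // -{2}(mateK okF u) (inj_eq (mate_inj okF)).
  move: cm; rewrite /is_cap /other_cap.
  by case: eqP => [-> _|_ /= /eqP->]; rewrite ?cap_neq // eq_sym cap_neq.
- move=> u; have [cu|nu] := boolP (is_cap u).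
    by rewrite !mateD_cap // ?other_cap_cap // other_capK.
  have [cm|nm] := boolP (is_cap (mate f u)).
    have /andP[n1 n2] := turn_mate nu cm.
    by rewrite mateD_turn // {1}mateD_turn // mateK // other_capK // mateK.
  have /andP[n1 n2] := away_mate nu nm.
  by rewrite mateD_away // mateD_away // mateK.
- move=> u; have [cu|nu] := boolP (is_cap u).
    by rewrite mateD_cap // !labelD_cap // other_cap_cap.
  have [cm|nm] := boolP (is_cap (mate f u)).
    by have /andP[n1 n2] := turn_mate nu cm; rewrite !labelD_turn.
  have /andP[n1 n2] := away_mate nu nm.
  by rewrite !labelD_away // mateD_away // label_mate.
- exact: noncross_mul.
- move=> u; have [cu|nu] := boolP (is_cap u).
    rewrite mateD_cap // labelD_cap //; case: (other_cap_abs cu) => -[-> ->];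
    by rewrite ?(minn_idPl (leqnSn i)) ?(minn_idPr (leqnSn i)) leqnn; have /andP[-> _] := i_bound.
  have [cm|nm] := boolP (is_cap (mate f u)); last first.
    rewrite mateD_away // labelD_away // label_gt0 // leq_min label_abs //.
    by rewrite label_abs_mate // label_odd.
  have [l1 l2] := rewire_label_abs F nu; split.
    rewrite leq_min mateD labelD l1 l2 -labelD labelD_turn // leq_min.
    by rewrite !label_gt0.
  rewrite labelD_turn // mateD_turn // odd_turn -{1}(mateK okF u).
  move: cm; rewrite /is_cap /other_cap.
  by case: eqP => [-> _|_ /= /eqP->] //; rewrite minnC.
- move=> s p ps pms; have [cs|ns] := boolP (is_cap s).
    have np := cap_others cs ps pms.
    by rewrite encloses_cap.
  have [cs|ms] := boolP (is_cap (mate f s)).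
    have [cp|np] := boolP (is_cap p).
      rewrite labelD_turn // labelD_cap //.
      by have [-> //|->] := turn_bound.
    have [cp|mp] := boolP (is_cap (mate f p)).
      by have [E|E] := turn_turn ns cs np cp; rewrite E eqxx in ps pms.
    rewrite encloses_turn // labelD_turn // labelD_away // gtn_min.
    have [pa pma pb pmb] := away_neq np mp.
    have := label_encloses okF pa pma; have := label_encloses okF pb pmb.
    by case: (encloses f b p) => [/(_ isT) -> _|_]; rewrite ?orbT // addbF => H /H ->.
  rewrite encloses_away // labelD_away //.
  have s_cap q : is_cap q -> encloses f s q -> label f s < label f a /\ label f s < label f b.
    move=> cq enc; have enc2 : encloses f s (other_cap q) by rewrite encloses_other_cap.
    have la := label_encloses okF (ncap_neq cq ns) (ncap_neq cq ms) enc.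
    have cq2 := other_cap_cap i_bound q.
    have lb := label_encloses okF (ncap_neq cq2 ns) (ncap_neq cq2 ms) enc2.
    by move: cq la lb; rewrite /is_cap /other_cap; case: eqP => [->|_ /= /eqP->].
  have [cp|np] := boolP (is_cap p).
    move=> /s_cap[] // la _; rewrite labelD_cap // (leq_trans la) //.
    by have := label_abs okF a; rewrite E3.
  have [cp|mp] := boolP (is_cap (mate f p)).
    have [-> _] := encloses_away_turn ns ms np cp.
    by move=> /s_cap[] // la lb; rewrite labelD_turn // leq_min la.
  rewrite labelD_away //; apply: label_encloses => //.
  by rewrite -(mateD_away ns ms).
Qed.

End NoCup.

Lemma okada_mul_gen : okada_diagram D.
Proof.
have [/okada_mul_cup //|] := eqVneq (mate f a) b.
exact: okada_mul_ncup.
Qed.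

End GeneratorProduct.

(** ** The weight of the product by a generator *)

Section GeneratorWeight.
Variables (N i : nat).
Hypothesis i_bound : 0 < i < N.
Variable F : odiag N.
Implicit Types u v s p : node N.
Local Notation a := (cap_lo i_bound).
Local Notation b := (cap_hi i_bound).
Local Notation A := (gen_odiag i_bound).
Local Notation G := (composite F A).
Local Notation f := (val F).
Local Notation is_cap := (is_cap i_bound).
Local Notation other_cap := (other_cap i_bound).
Local Notation rewire_mate := (rewire_mate i_bound F).
Local Notation rewire_label := (rewire_label i_bound F).
Local Notation strand := (strand i_bound F).

Let okF : okada_diagram f. Proof. exact: valP. Qed.

Local Notation D := (diagram_mul f (A_gen N i)).

Lemma left_nloop u : ~~ is_cap u -> ~~ loop (inl u : G).
Proof. by move=> nu; have [R _] := route_core F nu; apply: route_nloop R. Qed.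

Lemma right_nxt (e : node N) : loop (inr e : G) ->
  exists2 c, is_cap c & nxt (inr e : G) = inl c.
Proof.
case: e => k lk; last by have := @exposed_nloop G (inr (inr k)) (eqxx _); rewrite lk.
have: ~~ halts (inr (inl k) : G) by apply: (loop_halts lk); apply: in_orbit.
rewrite /halts exposedE /nxt /= (mate_gen_l i_bound).
case: eqP => _; first by exists b; rewrite /is_cap ?eqxx ?orbT.
by case: eqP => _ //; exists a; rewrite /is_cap ?eqxx ?orbT.
Qed.

Lemma loop_through_cap (e : G) : loop e ->
  exists2 c, is_cap c & (inl c : G) \in orbit (@nxt G) e.
Proof.
case: e => u le.
  by exists u; [apply: contraLR le; apply: left_nloop|apply: in_orbit].
have [c cc E] := right_nxt le; exists c => //.
by rewrite -E mem_orbit // in_orbit.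
Qed.

Lemma strand_evens_idle u : (~~ is_cap u -> is_cap (mate f u) -> False) ->
  strand_evens (outer_end u : G) = [::].
Proof.
have Ea v : tabs (outer_end v : G) = node_abs v by rewrite /tabs /= /end_abs outer_endK.
move=> idle; rewrite /strand_evens Ea; have [cu|nu] := boolP (is_cap u).
  have [R E] := route_cap F cu.
  by rewrite (route_chain R) word1 /arcw Ea evens_dive.
have [R _] := route_strand F nu; rewrite (route_chain R) word_strand //.
by case: ifP => cm; [case: idle|rewrite evens_dive].
Qed.

Lemma strand_evens_turn u : ~~ is_cap u -> is_cap (mate f u) ->
  strand_evens (outer_end u : G) = evens (node_abs u) [::]
    (dive (node_abs u) (label f (mate f u)) i.+1 ++
     dive i.+1 (label f (other_cap (mate f u))) (node_abs (mate f (other_cap (mate f u))))).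
Proof.
have Ea v : tabs (outer_end v : G) = node_abs v by rewrite /tabs /= /end_abs outer_endK.
move=> nu cu; rewrite /strand_evens Ea.
have [R _] := route_strand F nu; rewrite (route_chain R) word_strand // cu.
by rewrite /rewire_mate (negbTE nu) cu label_mate.
Qed.

Section Weight.
Variables (K : fieldType) (x y : nat -> K).
Local Open Scope ring_scope.

Lemma no_loop_weight : mate f a != b ->
  weight G x y = \prod_(u | node_positive u) evens_weight y (strand_evens (outer_end u : G)).
Proof.
move=> ncup; rewrite /weight prod_exposed [X in _ * X]big_pred0 ?mulr1 // => e.
apply/negP=> /and3P[_ _ le]; have [c cc ce] := loop_through_cap le.
have [R _] := @route_coda _ _ i_bound F c (mate_cap_ncap ncup cc).
by have := route_nloop R; rewrite (loop_orbit ce) le.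
Qed.

Lemma evens_weight_nil : evens_weight y [::] = 1.
Proof. by rewrite /evens_weight big_nil. Qed.

(** When the label at \overline{i+1} is as large as possible, the arcs joined by the
    cap form no peak.  This is the case that occurs in normal words. *)
Lemma weight_gen_absorb : label f b = i.+1 -> weight G x y = 1.
Proof.
move=> lb; have la := label_abs okF a.
have [_ _ E3 E4] := pos_cap i_bound; rewrite E3 in la.
have ncup : mate f a != b.
  by apply/eqP=> E; move: la; rewrite -label_mate // E lb ltnn.
rewrite no_loop_weight // big1 // => u _.
have [cu|nu] := boolP (is_cap u).
  by rewrite strand_evens_idle ?evens_weight_nil // => /negP[].
have [cm|nm] := boolP (is_cap (mate f u)); last first.
  by rewrite strand_evens_idle ?evens_weight_nil // => _; apply/negP.
rewrite strand_evens_turn //.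
have lu : (label f (mate f u) <= node_abs u)%N by rewrite label_mate // label_abs.
have lv := label_abs_mate okF (other_cap (mate f u)).
move: (node_abs u) (node_abs (mate f (other_cap (mate f u)))) cm lu lv => p q.
rewrite /is_cap /other_cap; case: eqP => [-> _|_ /= /eqP->]; rewrite ?lb => lu lv.
  rewrite /dive subnn [nseq 0 false]/= cat0s -catA -nseqD.
  by rewrite evens_cat evens_down evens_up evens_weight_nil.
rewrite /dive subnn [nseq 0 true]/= cats0 catA -nseqD.
by rewrite evens_cat evens_down evens_up evens_weight_nil.
Qed.

(** One path has the word UUDD, all others are dives. *)
Lemma weight_gen_turn : label f a = i.-1 -> label f b = i.-1 ->
  node_abs (mate f a) = i.-1 -> node_abs (mate f b) = i.-1 -> (1 < i)%N ->
  weight G x y = y i.-1.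
Proof.
move=> la lb ma mb i1.
have ncup : mate f a != b.
  have [_ _ _ E4] := pos_cap i_bound.
  by apply/eqP=> E; move: ma; rewrite E E4; lia.
rewrite no_loop_weight //.
have ca : is_cap a by rewrite /is_cap eqxx.
have cb : is_cap b by rewrite /is_cap eqxx orbT.
have na := mate_cap_ncap ncup ca; have nb := mate_cap_ncap ncup cb.
(* The path through the cap is counted from its positive end t. *)
have [t [nt ct pt]] : exists t, [/\ ~~ is_cap t, is_cap (mate f t) & node_positive t].
  have [oP oP' _] := odd_pos_cap i_bound.
  case E: (odd i).
    by exists (mate f a); rewrite mateK // mate_positive // /node_positive oP E.
  by exists (mate f b); rewrite mateK // mate_positive // /node_positive oP' E.
rewrite (bigD1 t) //= big1 ?mulr1 => [|u /andP[pu ut]].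
  rewrite strand_evens_turn //.
  have -> : node_abs t = i.-1.
    by rewrite -(mateK okF t); case/orP: ct => /eqP->.
  have [-> ->] : label f (mate f t) = i.-1 /\ label f (other_cap (mate f t)) = i.-1.
    by case/orP: ct => /eqP->; rewrite ?other_cap_lo ?other_cap_hi.
  have -> : node_abs (mate f (other_cap (mate f t))) = i.-1.
    by case/orP: ct => /eqP->; rewrite ?other_cap_lo ?other_cap_hi.
  have -> : dive i.-1 i.-1 i.+1 ++ dive i.+1 i.-1 i.-1 = [:: true; true; false; false].
    by rewrite /dive subnn (_ : i.+1 - i.-1 = 2)%N //; lia.
  by rewrite /= /evens_weight big_cons big_nil mulr1.
rewrite strand_evens_idle ?evens_weight_nil // => nu cu.
have [E|E] := turn_turn nt ct nu cu; first by rewrite E eqxx in ut.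
by move: pu; rewrite E mate_positive ?pt //; apply: okada_mul_gen.
Qed.

(** There is a single loop, formed by the cap and the arc of F with the same ends. *)
Lemma weight_gen_cup : mate f a = b -> label f a = i -> weight G x y = x i.
Proof.
move=> E la; have E' : mate f b = a by rewrite -E mateK.
have lb : label f b = i by rewrite -E label_mate.
have nostrand : \prod_(s : G | positive s && exposed s) evens_weight y (strand_evens s) = 1.
  rewrite prod_exposed big1 // => u _.
  rewrite strand_evens_idle ?evens_weight_nil // => nu cu.
  by have := core_ncup nu cu; rewrite E eqxx.
rewrite /weight nostrand mul1r.
have [oP oP' _] := odd_pos_cap i_bound.
(* The loop is counted from the positive cap end c. *)
have [c cc pc] : exists2 c, is_cap c & node_positive c.
  case Eo: (odd i).
    by exists b; rewrite /is_cap ?eqxx ?orbT // /node_positive oP' Eo.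
  by exists a; rewrite /is_cap ?eqxx // /node_positive oP Eo.
have mc : mate f c = other_cap c.
  by case/orP: cc => /eqP->; rewrite ?other_cap_lo ?other_cap_hi.
have coc := other_cap_cap i_bound c.
pose p : G := inl c; pose q : G := inr (opp_node (other_cap c)).
have Ep : nxt p = q.
  rewrite /p /q /nxt /= mc; by case: (other_cap c) coc => k //; case/orP.
have Eq : nxt q = p.
  rewrite /p /q /nxt /=; move: cc; rewrite /is_cap /other_cap.
  case: (eqVneq c a) => [-> _|_ /= /eqP->] /=; rewrite (mate_gen_l i_bound) ?hi_neq_lo ?eqxx //.
have Dp : p = inl c by []. have Dq : q = inr (opp_node (other_cap c)) by [].
clearbody p q.
have orb : orbit (@nxt G) p = [:: p; q].
  by apply: orbit_cons; [apply/and3P; split=> //; apply/eqP|rewrite inE Dp Dq].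
have lp : loop p.
  rewrite /loop orb /= Dp Dq !exposedE.
  by case/orP: cc => /eqP->; rewrite ?other_cap_lo ?other_cap_hi.
rewrite (big_pred1 (froot (@nxt G) p)) => [|e].
  rewrite (loop_weight_orbit _ _ (froot_orbit p)) /loop_weight /loop_low /loop_evens orb.
  have tq : tlab q = i.
    rewrite Dq; apply: (label_gen_cap i_bound).
    by have := cap_node_abs coc; case: (other_cap c).
  have tp : tlab p = i by rewrite Dp /tlab /=; case/orP: cc => /eqP->.
  have Tp : tabs p = node_abs c by rewrite Dp.
  have Tq : tabs q = node_abs (other_cap c).
    by rewrite Dq /tabs /= /end_abs /=; case: (other_cap c).
  have lowE : low p [:: p; q] = i.
    by transitivity (minn (tlab p) (minn (tlab q) (tlab p))); rewrite // tp tq !minnn.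
  have Ap : arcw p = dive (node_abs c) i (node_abs (other_cap c)).
    by rewrite /arcw tp -tabs_nxt Ep Tp Tq.
  have Aq : arcw q = dive (node_abs (other_cap c)) i (node_abs c).
    by rewrite /arcw tq -tabs_nxt Eq Tp Tq.
  rewrite lowE word_cons word1 Ap Aq Tp.
  case: (other_cap_abs cc) => -[-> ->]; rewrite /dive subnn subSnn.
    by rewrite /cyclic_evens /= evens_weight_nil mulr1.
  by rewrite /cyclic_evens /= evens_weight_nil mulr1.
apply/idP/eqP => [/and3P[pe re le]|->]; last by apply: loop_root_froot; rewrite ?lp ?Dp.
suff : p \in orbit (@nxt G) e by rewrite -froot_eq (eqP re) => /eqP.
have [d cd de] := loop_through_cap le.
have pd : node_positive d by have := loop_positive le de; rewrite pe.
suff -> : p = inl d by [].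
rewrite Dp; congr inl; case/orP: cc pc => /eqP->; case/orP: cd pd => /eqP-> //;
  by rewrite /node_positive oP oP'; case: odd.
Qed.

End Weight.

End GeneratorWeight.

(** * The identity diagram *)

Section Identity.
Variable N : nat.
Implicit Types u v s p : node N.

Lemma mate1 u : mate (diagram1 N) u = opp_node u.
Proof. by rewrite /mate ffunE. Qed.

Lemma label1 u : label (diagram1 N) u = node_abs u.
Proof. by rewrite /label ffunE. Qed.

Lemma opp_nodeK : involutive (@opp_node N).
Proof. by case. Qed.

Lemma node_abs_opp u : node_abs (opp_node u) = node_abs u.
Proof. by case: u. Qed.

Lemma okada_diagram1 : okada_diagram (diagram1 N).
Proof.
apply: okada_encloses.
- by case=> k; rewrite mate1.
- by move=> u; rewrite !mate1 opp_nodeK.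
- by move=> u; rewrite mate1 !label1 node_abs_opp.
- move=> s p; rewrite /encloses !mate1; case: s => s; case: p => p;
  rewrite ?(inj_eq inl_inj) ?(inj_eq inr_inj) -?val_eqE /=;
  have := ltn_ord s; have := ltn_ord p; lia.
- by move=> u; rewrite label1 mate1 node_abs_opp minnn leqnn; case: u.
- move=> s p; rewrite /encloses !mate1 !label1; case: s => s; case: p => p;
  rewrite ?(inj_eq inl_inj) ?(inj_eq inr_inj) -?val_eqE /=;
  have := ltn_ord s; have := ltn_ord p; lia.
Qed.

Definition one_odiag : odiag N := exist _ (diagram1 N) okada_diagram1.

Variable F : odiag N.
Local Notation f := (val F).
Local Notation G := (composite F one_odiag).
Let okF : okada_diagram f. Proof. exact: valP. Qed.

Definition right_pass (side : 'I_N -> node N) u : seq G :=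
  if u is inr k then [:: (inr (side k) : G)] else [::].

Lemma arcw_one u : arcw (inr u : G) = [::].
Proof.
rewrite /arcw (_ : tabs (inr u : G) = node_abs u) //.
rewrite (_ : tlab (inr u : G) = node_abs u); last exact: label1.
rewrite (_ : tabs (opp (inr u : G)) = node_abs u) /dive ?subnn //.
by rewrite /tabs /= /end_abs /= mate1 node_abs_opp.
Qed.

Lemma word_right_pass side u : word (right_pass side u) = [::].
Proof. by case: u => k //=; rewrite word1 arcw_one. Qed.

Lemma route_one u : let r := right_pass inr u ++ (inl u : G) :: right_pass inl (mate f u) in
  route (outer_end u : G) r /\ opp (last (outer_end u : G) r) = outer_end (mate f u).
Proof.
have R : route (inl u : G) ((inl u : G) :: right_pass inl (mate f u)) /\
    opp (last (inl u : G) (right_pass inl (mate f u))) = outer_end (mate f u).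
  case E: (mate f u) => [k|k] /=.
    by split; [apply: Route_halt; rewrite /halts exposedE /= E|rewrite E].
  rewrite mate1; split=> //; apply: Route_step; first by rewrite /halts exposedE /= E.
  by rewrite /nxt /= E; apply: Route_halt; rewrite /halts exposedE /= mate1.
case: u R => k //= [R E]; split; last by [].
apply: Route_step; first by rewrite /halts exposedE /= mate1.
by rewrite /nxt /= mate1.
Qed.

Lemma diagram_mulr1 : diagram_mul f (diagram1 N) = f.
Proof.
apply/ffunP=> u; rewrite [LHS]surjective_pairing [RHS]surjective_pairing.
have [R E] := route_one u.
congr pair; rewrite -!/(mate _ _) -!/(label _ _).
  by rewrite (mate_mul F one_odiag) path_lastE /target (route_chain R) E outer_endK.
rewrite (label_mul F one_odiag) /strand_low (route_chain R).
have lm := label_abs_mate okF u; have lu := label_abs okF u.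
case: u R E lm lu => k _ _ lm lu.
  rewrite /= /tlab /=; case: (mate f _) lm => j lm /=; rewrite ?label1 -[sval F]/(val F) /= in lm *; lia.
rewrite /= /tlab /=; case: (mate f _) lm => j lm /=; rewrite ?label1 -[sval F]/(val F) /= in lm lu *; lia.
Qed.

Lemma word_one u : word (chain (outer_end u : G)) =
  dive (node_abs u) (label f u) (node_abs (mate f u)).
Proof.
have [R _] := route_one u; rewrite (route_chain R) word_cat word_right_pass.
by rewrite word_cons word_right_pass cats0.
Qed.

Lemma tabs_outer_end (C D : odiag N) u : tabs (outer_end u : composite C D) = node_abs u.
Proof. by rewrite /tabs /= /end_abs outer_endK. Qed.

Lemma tidy_one : tidy G.
Proof.
move=> e fe; have E : e = outer_end (end_node e) by rewrite exposed_node.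
move: (end_node e) E => u E; rewrite {}E {e fe}.
have <- : outer_end (mate (diagram_mul f (diagram1 N)) u) = target (outer_end u : G).
  exact: (mate_mulE F one_odiag).
have <- : label (diagram_mul f (diagram1 N)) u = strand_low (outer_end u : G).
  exact: (label_mul F one_odiag).
rewrite /strand_evens word_one !tabs_outer_end diagram_mulr1 evens_dive.
exact: reduces_refl.
Qed.

Lemma nloop_one (e : G) : ~~ loop e.
Proof.
case: e => u; last first.
  case: u => k; last by apply: exposed_nloop; rewrite exposedE.
  have [R _] := route_one (inr k).
  have R1 : route (inr (inl k) : G) [:: (inr (inl k) : G)].
    by apply: Route_halt; rewrite /halts exposedE /= mate1.
  exact: route_nloop R1.
have [R _] := route_one u; have := route_nloop R.
rewrite (@loop_orbit _ (outer_end u : G) (inl u : G)) //.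
by apply: (route_sub_orbit R); rewrite mem_cat mem_head orbT.
Qed.

Lemma weight_one (K : fieldType) (x y : nat -> K) : weight G x y = 1%R.
Proof.
rewrite /weight [X in (_ * X)%R]big_pred0 => [|e]; last first.
  by apply/negbTE/negP=> /and3P[_ _]; apply/negP/nloop_one.
rewrite mulr1 big1 // => e /andP[_ fe].
have E : e = outer_end (end_node e) by rewrite exposed_node.
by rewrite E /strand_evens word_one tabs_outer_end evens_dive /evens_weight big_nil.
Qed.

End Identity.

(** * Words in the generators *)

Section Words.
Variable N : nat.
Implicit Types (C D : odiag N) (w v z : seq nat).

Definition letters w := all (fun i => 0 < i < N) w.

(** Right multiplication by A_i; an index out of range acts trivially. *)
Definition act_letter C i : odiag N := insubd C (diagram_mul (val C) (A_gen N i)).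
Definition act C w : odiag N := foldl act_letter C w.
Definition diag w : odiag N := act (one_odiag N) w.
Definition gen i : odiag N := insubd (one_odiag N) (A_gen N i).

Lemma val_gen i : 0 < i < N -> val (gen i) = A_gen N i.
Proof. by move=> hi; rewrite val_insubd okada_gen_diagram. Qed.

Lemma gen_odiagE i (hi : 0 < i < N) : gen_odiag hi = gen i.
Proof. by apply: val_inj; rewrite val_gen. Qed.

Lemma val_act_letter C i : 0 < i < N ->
  val (act_letter C i) = diagram_mul (val C) (A_gen N i).
Proof. by move=> hi; rewrite val_insubd okada_mul_gen. Qed.

Lemma act_cat C w v : act C (w ++ v) = act (act C w) v.
Proof. exact: foldl_cat. Qed.

Lemma act_rcons C w i : act C (rcons w i) = act_letter (act C w) i.
Proof. by rewrite -cats1 act_cat. Qed.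

Lemma letters_cat w v : letters (w ++ v) = letters w && letters v.
Proof. exact: all_cat. Qed.

Lemma tidy_letter C i : 0 < i < N -> tidy (composite C (gen i)).
Proof. by move=> hi; rewrite -(gen_odiagE hi); apply: tidy_gen. Qed.

(** Associativity is known for tidy compositions only, so both facts are proved
    together, one letter at a time. *)
Lemma mul_diag C w : letters w ->
  diagram_mul (val C) (val (diag w)) = val (act C w) /\ tidy (composite C (diag w)).
Proof.
elim/last_ind: w => [_|w i IH]; first by rewrite /diag /= diagram_mulr1; split=> //; apply: tidy_one.
rewrite -cats1 letters_cat /= andbT => /andP[/IH[E t] hi].
have defF : val (act_letter (diag w) i) = diagram_mul (val (diag w)) (val (gen i)).
  by rewrite val_act_letter // val_gen.
have tF : tidy (composite (diag w) (gen i)) by apply: tidy_letter.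
rewrite /diag !act_cat /= -!/(diag w).
rewrite -(diagram_mulA_odiag (esym E) defF) val_gen // val_act_letter //.
split=> //; apply: (tidy_composite (esym E) defF t tF); exact: tidy_letter.
Qed.

Lemma mul_diag_act C w : letters w -> diagram_mul (val C) (val (diag w)) = val (act C w).
Proof. by move=> /(mul_diag C)[]. Qed.

Lemma tidy_diag C w : letters w -> tidy (composite C (diag w)).
Proof. by move=> /(mul_diag C)[]. Qed.

Section Weight.
Variables (K : fieldType) (x y : nat -> K).
Local Open Scope ring_scope.

Definition mul_weight C D : K := weight (composite C D) x y.

Fixpoint act_weight C w : K :=
  if w is i :: w' then mul_weight C (gen i) * act_weight (act_letter C i) w' else 1.

Definition word_weight w : K := act_weight (one_odiag N) w.

Lemma act_weight_cat C w v :
  act_weight C (w ++ v) = act_weight C w * act_weight (act C w) v.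
Proof. by elim: w C => [|i w IH] C /=; rewrite ?mul1r // IH mulrA. Qed.

(** The cocycle identity, iterated along the word. *)
Lemma act_weight_mul C w : letters w ->
  act_weight C w = word_weight w * mul_weight C (diag w).
Proof.
elim/last_ind: w => [_|w i IH]; first by rewrite /word_weight /= mul1r /mul_weight weight_one.
rewrite -cats1 letters_cat /= andbT => /andP[lw hi].
have defF : val (act_letter (diag w) i) = diagram_mul (val (diag w)) (val (gen i)).
  by rewrite val_act_letter // val_gen.
have E := esym (mul_diag_act C lw).
have tF : tidy (composite (diag w) (gen i)) by apply: tidy_letter.
have := weight_cocycle E defF (@tidy_diag C w lw) tF x y.
rewrite -!/(mul_weight _ _) => coc.
rewrite /word_weight !act_weight_cat /= !mulr1 IH // /diag act_cat /= -!/(diag w).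
by rewrite -mulrA coc mulrA.
Qed.

Lemma word_weight_cat w v : letters v ->
  word_weight (w ++ v) = word_weight w * word_weight v * mul_weight (diag w) (diag v).
Proof. by move=> lv; rewrite /word_weight act_weight_cat (act_weight_mul _ lv) mulrA. Qed.

Lemma diag_cat w v : letters v ->
  val (diag (w ++ v)) = diagram_mul (val (diag w)) (val (diag v)).
Proof. by move=> lv; rewrite mul_diag_act // /diag act_cat. Qed.

Variables (R : algType K) (E : nat -> R).

Definition word_prod w : R := \prod_(i <- w) E i.

Lemma word_prod_cat w v : word_prod (w ++ v) = word_prod w * word_prod v.
Proof. exact: big_cat. Qed.

(** The word w is c times w', as a product in the algebra and as a weight, and both
    have the same diagram. *)
Definition rewrites w (c : K) w' :=
  [/\ letters w, letters w', diag w = diag w', word_weight w = c * word_weight w' &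
      word_prod w = c *: word_prod w'].

Lemma rewrites_refl w : letters w -> rewrites w 1 w.
Proof. by move=> lw; split; rewrite ?mul1r ?scale1r. Qed.

Lemma rewrites_trans w1 w2 w3 c d : rewrites w1 c w2 -> rewrites w2 d w3 ->
  rewrites w1 (c * d) w3.
Proof.
case=> l1 l2 D1 W1 P1 [_ l3 D2 W2 P2]; split=> //; first by rewrite D1.
  by rewrite W1 W2 mulrA.
by rewrite P1 P2 scalerA.
Qed.

Lemma rewrites_cat w1 w1' w2 w2' c d : rewrites w1 c w1' -> rewrites w2 d w2' ->
  rewrites (w1 ++ w2) (c * d) (w1' ++ w2').
Proof.
case=> l1 l1' D1 W1 P1 [l2 l2' D2 W2 P2]; split; rewrite ?letters_cat ?l1 ?l1' //.
- by apply: val_inj; rewrite !diag_cat // D1 D2.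
- by rewrite !word_weight_cat // D1 D2 W1 W2; ring.
- by rewrite !word_prod_cat P1 P2 -scalerAl -scalerAr scalerA.
Qed.

End Weight.
End Words.

(** * Multiplication in coordinates *)

Notation coord := (bool * nat)%type.

Section Coordinates.
Implicit Types (c : coord) (m : coord -> coord) (l : coord -> nat).

Definition cap_coord i c := c.1 && ((c.2 == i.-1) || (c.2 == i)).
Definition other_coord i c : coord := (true, if c.2 == i.-1 then i else i.-1).
Definition rewire_coord i m c :=
  if cap_coord i c then other_coord i c
  else if cap_coord i (m c) then m (other_coord i (m c)) else m c.
Definition rewire_lab i m l c :=
  if cap_coord i c then i
  else if cap_coord i (m c) then minn (l c) (l (other_coord i (m c))) else l c.
Definition gen_coord i c : coord :=
  if c.2 == i.-1 then (c.1, i) else if c.2 == i then (c.1, i.-1) else (~~ c.1, c.2).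
Definition gen_lab i c := if (c.2 == i.-1) || (c.2 == i) then i else c.2.+1.

Section Diagrams.
Variable N : nat.
Implicit Types (D : odiag N) (u : node N).

Definition node_coord u : coord := match u with inl k => (false, val k) | inr k => (true, val k) end.

Lemma node_coord_inj : injective node_coord.
Proof. by case=> k [] j [] // /val_inj ->. Qed.

Definition has_coords (f : diagram N) m l := forall u,
  node_coord (mate f u) = m (node_coord u) /\ label f u = l (node_coord u).

(** Diagrams given by formulas in coordinates agree when the formulas do; this
    reduces the identities between products of generators to comparisons of
    indices, without any reference to N. *)
Lemma has_coords_eq (f g : diagram N) m l m' l' : has_coords f m l -> has_coords g m' l' ->
  m =1 m' -> l =1 l' -> f = g.
Proof.
move=> cf cg Em El; apply/ffunP=> u.
have [mf lf] := cf u; have [mg lg] := cg u.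
rewrite [LHS]surjective_pairing [RHS]surjective_pairing.
congr pair; rewrite -!/(mate _ _) -!/(label _ _); last by rewrite lf lg El.
by apply: node_coord_inj; rewrite mf mg Em.
Qed.

Lemma cap_coordE i (hi : 0 < i < N) u : is_cap hi u = cap_coord i (node_coord u).
Proof.
rewrite /is_cap /cap_coord; case: u => k //=.
Qed.

Lemma other_coordE i (hi : 0 < i < N) u : is_cap hi u ->
  node_coord (other_cap hi u) = other_coord i (node_coord u).
Proof.
case/orP=> /eqP->; rewrite ?other_cap_lo ?other_cap_hi /other_coord /= ?eqxx //.
by case: ifP => //; lia.
Qed.

Lemma has_coords_mul i D m l : 0 < i < N -> has_coords (val D) m l ->
  has_coords (diagram_mul (val D) (A_gen N i)) (rewire_coord i m) (rewire_lab i m l).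
Proof.
move=> hi cD u; rewrite (mate_mul_gen hi) (label_mul_gen hi).
rewrite /rewire_mate /rewire_label /rewire_coord /rewire_lab -(cap_coordE hi).
have [mu lu] := cD u; case: ifP => cu; first by rewrite other_coordE.
rewrite -mu -(cap_coordE hi); case: ifP => cm //.
by have [mo lo] := cD (other_cap hi (mate (val D) u)); rewrite mo lo lu other_coordE.
Qed.

Lemma has_coords_gen i : 0 < i < N -> has_coords (A_gen N i) (gen_coord i) (gen_lab i).
Proof.
move=> hi u; rewrite label_gen //; split.
  case: u => k; rewrite ?(mate_gen_l hi) ?(mate_gen_r hi) /gen_coord /= -!val_eqE /=;
    by case: ifP => //; case: ifP.
by rewrite /gen_lab; case: u => k /=; congr (if _ then _ else _); lia.
Qed.

Lemma has_coords_one : has_coords (diagram1 N) (fun c => (~~ c.1, c.2)) (fun c => c.2.+1).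
Proof. by move=> u; rewrite mate1 label1; case: u. Qed.

End Diagrams.

Local Ltac unfold_coords := rewrite /rewire_coord /rewire_lab /gen_coord /gen_lab
  /cap_coord /other_coord /=.

Section One.
Variable i : nat.
Hypothesis i0 : 0 < i.

Let ne : (i == i.-1) = false. Proof. by lia. Qed.
Let en : (i.-1 == i) = false. Proof. by lia. Qed.

Local Ltac coords1 k := unfold_coords; 
  (case: (eqVneq k i.-1) => [|/negbTE ?]; [let H := fresh in intro H; rewrite ?H|(case: (eqVneq k i) => [|/negbTE ?]; [let H := fresh in intro H; rewrite ?H|idtac])]);
  repeat (progress rewrite ?eqxx ?ne ?en /=);
  repeat (match goal with H : (k == _) = false |- _ => progress rewrite ?H ?eqxx ?ne ?en /= end);
  rewrite ?prednK ?minnn //=.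

Lemma one_gen_coord : rewire_coord i (fun c => (~~ c.1, c.2)) =1 gen_coord i.
Proof. by move=> [[] k]; coords1 k. Qed.

Lemma one_gen_lab : rewire_lab i (fun c => (~~ c.1, c.2)) (fun c => c.2.+1) =1 gen_lab i.
Proof. by move=> [[] k]; coords1 k; lia. Qed.

Lemma sq_coord : rewire_coord i (gen_coord i) =1 gen_coord i.
Proof. by move=> [[] k]; coords1 k. Qed.

Lemma sq_lab : rewire_lab i (gen_coord i) (gen_lab i) =1 gen_lab i.
Proof. by move=> [[] k]; coords1 k. Qed.

End One.

Section Two.
Variables i j : nat.
Hypothesis i0 : 0 < i.
Hypothesis ij : i.+1 < j.

Let ne : ((i == i.-1) = false) * ((i.-1 == i) = false) * ((j == j.-1) = false) *
 ((j.-1 == j) = false) * ((i == j) = false) * ((j == i) = false) * ((i == j.-1) = false) *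
 ((j.-1 == i) = false) * ((i.-1 == j.-1) = false) * ((j.-1 == i.-1) = false) *
 ((i.-1 == j) = false) * ((j == i.-1) = false).
Proof. by do !split; lia. Qed.

Local Ltac coords2 k := unfold_coords; 
  (case: (eqVneq k i.-1) => [|/negbTE ?]; [let H := fresh in intro H; rewrite ?H|(case: (eqVneq k i) => [|/negbTE ?]; [let H := fresh in intro H; rewrite ?H|(case: (eqVneq k j.-1) => [|/negbTE ?]; [let H := fresh in intro H; rewrite ?H|(case: (eqVneq k j) => [|/negbTE ?]; [let H := fresh in intro H; rewrite ?H|idtac])])])]);
  repeat (progress rewrite ?eqxx ?ne /=);
  repeat (match goal with H : (k == _) = false |- _ => progress rewrite ?H ?eqxx ?ne /= end);
  rewrite ?prednK ?minnn //=.

Lemma comm_coord : rewire_coord j (gen_coord i) =1 rewire_coord i (gen_coord j).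
Proof. by move=> [[] k]; coords2 k. Qed.

Lemma comm_lab : rewire_lab j (gen_coord i) (gen_lab i) =1 rewire_lab i (gen_coord j) (gen_lab j).
Proof. by move=> [[] k]; coords2 k; lia. Qed.

End Two.

Section Down.
Variable i : nat.
Hypothesis i0 : 0 < i.

Let ne : ((i == i.-1) = false) * ((i.-1 == i) = false) * ((i.+1 == i.-1) = false) *
  ((i.-1 == i.+1) = false) * ((i == i.+1) = false) * ((i.+1 == i) = false).
Proof. by do !split; lia. Qed.

Local Ltac coords3 k := unfold_coords; 
  (case: (eqVneq k i.-1) => [|/negbTE ?]; [let H := fresh in intro H; rewrite ?H|(case: (eqVneq k i) => [|/negbTE ?]; [let H := fresh in intro H; rewrite ?H|(case: (eqVneq k i.+1) => [|/negbTE ?]; [let H := fresh in intro H; rewrite ?H|idtac])])]);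
  repeat (progress rewrite ?eqxx ?ne /=);
  repeat (match goal with H : (k == _) = false |- _ => progress rewrite ?H ?eqxx ?ne /= end);
  rewrite ?prednK ?minnn //=.

Lemma down_coord : rewire_coord i.+1 (rewire_coord i (gen_coord i.+1)) =1 gen_coord i.+1.
Proof. by move=> [[] k]; coords3 k. Qed.

Lemma down_lab :
  rewire_lab i.+1 (rewire_coord i (gen_coord i.+1)) (rewire_lab i (gen_coord i.+1) (gen_lab i.+1))
  =1 gen_lab i.+1.
Proof. by move=> [[] k]; coords3 k; lia. Qed.

End Down.

End Coordinates.

(** * The defining relations *)

Section Relations.
Variable N : nat.
Variables (K : fieldType) (x y : nat -> K) (R : algType K) (E : nat -> R).
Local Open Scope ring_scope.
Hypothesis E_sq : forall i, (0 < i < N)%N -> E i * E i = x i *: E i.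
Hypothesis E_comm : forall i j, (0 < i)%N -> (i.+1 < j < N)%N -> E i * E j = E j * E i.
Hypothesis E_down : forall i, (0 < i)%N -> (i.+1 < N)%N ->
  E i.+1 * E i * E i.+1 = y i *: E i.+1.

Local Notation rewrites := (@rewrites N K x y R E).
Local Notation mulw := (mul_weight x y).
Local Notation wordw := (@word_weight N K x y).
Local Notation one := (one_odiag N).
Implicit Types (w v z : seq nat) (D : odiag N).

Lemma act_letter_one i : (0 < i < N)%N -> act_letter one i = gen N i.
Proof.
move=> hi; apply: val_inj; rewrite val_act_letter // val_gen //; have /andP[i0 _] := hi.
apply: (has_coords_eq (has_coords_mul (D := one) hi (@has_coords_one N)) (has_coords_gen hi)).
  exact: one_gen_coord.
exact: one_gen_lab.
Qed.

Lemma diag1E i : (0 < i < N)%N -> diag N [:: i] = gen N i.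
Proof. exact: act_letter_one. Qed.

Lemma mul_weight_absorb D i (hi : (0 < i < N)%N) :
  label (val D) (cap_hi hi) = i.+1 -> mulw D (gen N i) = 1.
Proof. by move=> lD; rewrite -(gen_odiagE hi); apply: weight_gen_absorb. Qed.

Lemma mul_weight_one i : (0 < i < N)%N -> mulw one (gen N i) = 1.
Proof. by move=> hi; apply: (mul_weight_absorb (hi := hi)); rewrite label1. Qed.

Lemma word_weight1 i : (0 < i < N)%N -> wordw [:: i] = 1.
Proof. by move=> hi; rewrite /word_weight /= mul_weight_one // mulr1. Qed.

Lemma word_weight2 i j : (0 < i < N)%N -> wordw [:: i; j] = mulw (gen N i) (gen N j).
Proof. by move=> hi; rewrite /word_weight /= mul_weight_one // mulr1 mul1r act_letter_one. Qed.

Lemma rewrites_sq i : (0 < i < N)%N -> rewrites [:: i; i] (x i) [:: i].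
Proof.
move=> hi; have /andP[i0 _] := hi; split; rewrite /letters /= ?hi //.
- rewrite diag1E // /diag /= act_letter_one //; apply: val_inj.
  rewrite val_act_letter // val_gen // -val_gen //.
  have cg : has_coords (val (gen N i)) (gen_coord i) (gen_lab i).
    by rewrite val_gen //; apply: has_coords_gen.
  have := has_coords_mul hi cg; rewrite val_gen // => c2.
  by apply: has_coords_eq c2 (has_coords_gen hi) _ _; [apply: sq_coord|apply: sq_lab].
- rewrite word_weight1 // word_weight2 // mulr1 /mul_weight -(gen_odiagE hi).
  apply: weight_gen_cup; first by rewrite /= mate_gen_r // eqxx.
  by apply: (label_gen_cap hi); apply: (cap_node_abs (i_bound := hi)); rewrite /is_cap eqxx.
- by rewrite /word_prod !big_cons big_nil !mulr1 E_sq.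
Qed.

Lemma has_coords_gen2 i j : (0 < i < N)%N -> (0 < j < N)%N ->
  has_coords (val (act_letter (gen N i) j)) (rewire_coord j (gen_coord i))
    (rewire_lab j (gen_coord i) (gen_lab i)).
Proof.
move=> hi hj; rewrite val_act_letter //; apply: has_coords_mul => //.
by rewrite val_gen //; apply: has_coords_gen.
Qed.

Lemma label_gen_hi i j (hj : (0 < j < N)%N) : (0 < i < N)%N -> (j != i) -> (j.+1 != i) ->
  label (val (gen N i)) (cap_hi hj) = j.+1.
Proof.
move=> hi ji j1i; rewrite val_gen // label_gen //= eqSS.
by rewrite (negbTE ji) (negbTE j1i).
Qed.

Lemma rewrites_comm i j : (0 < i)%N -> (i.+1 < j < N)%N -> rewrites [:: i; j] 1 [:: j; i].
Proof.
move=> i0 hij; have hi : (0 < i < N)%N by lia.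
have hj : (0 < j < N)%N by lia.
have ij : (i.+1 < j)%N by lia.
split; rewrite /letters /= ?hi ?hj //.
- rewrite /diag /= !act_letter_one //; apply: val_inj.
  apply: has_coords_eq (has_coords_gen2 hi hj) (has_coords_gen2 hj hi) _ _.
    exact: comm_coord.
  exact: comm_lab.
- rewrite !word_weight2 // mul1r (mul_weight_absorb (hi := hj)) ?(mul_weight_absorb (hi := hi)) //;
    by apply: label_gen_hi => //; lia.
- by rewrite /word_prod !big_cons big_nil !mulr1 scale1r E_comm.
Qed.

Lemma rewrites_commC i j : (0 < i)%N -> (i.+1 < j < N)%N -> rewrites [:: j; i] 1 [:: i; j].
Proof.
move=> i0 hij; have [l1 l2 D W P] := rewrites_comm i0 hij.
by split; rewrite // ?W ?P ?mul1r ?scale1r.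
Qed.

Lemma diag_down i : (0 < i)%N -> (i.+1 < N)%N ->
  diag N [:: i.+1; i; i.+1] = diag N [:: i.+1].
Proof.
move=> i0 h; have hi : (0 < i < N)%N by lia.
have hi1 : (0 < i.+1 < N)%N by [].
set D := act_letter (gen N i.+1) i.
have cD : has_coords (val D) (rewire_coord i (gen_coord i.+1))
    (rewire_lab i (gen_coord i.+1) (gen_lab i.+1)) by apply: has_coords_gen2.
rewrite diag1E // /diag /= act_letter_one // -/D; apply: val_inj.
rewrite val_act_letter // val_gen //.
apply: has_coords_eq (has_coords_mul hi1 cD) (has_coords_gen hi1) _ _.
  exact: down_coord.
exact: down_lab.
Qed.

(** The two products by A_i and by the second A_(i+1) have weights 1 and y_i: the
    diagram of [:: i.+1; i] has at the cap ends the two arcs described in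
    [weight_gen_turn]. *)
Lemma rewrites_down i : (0 < i)%N -> (i.+1 < N)%N ->
  rewrites [:: i.+1; i; i.+1] (y i) [:: i.+1].
Proof.
move=> i0 h; have hi : (0 < i < N)%N by lia.
have hi1 : (0 < i.+1 < N)%N by [].
set D := act_letter (gen N i.+1) i.
have cD : has_coords (val D) (rewire_coord i (gen_coord i.+1))
    (rewire_lab i (gen_coord i.+1) (gen_lab i.+1)) by apply: has_coords_gen2.
split; rewrite /letters /= ?hi ?h //; first exact: diag_down.
- rewrite word_weight1 // mulr1 /word_weight /= mul_weight_one // mul1r mulr1 act_letter_one //.
  rewrite (mul_weight_absorb (hi := hi)); last by rewrite val_gen // label_gen // eqxx.
  rewrite mul1r -/D /mul_weight -(gen_odiagE hi1).
  have ne : (i == i.-1) = false by lia.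
  have en : (i.-1 == i) = false by lia.
  have en1 : (i.-1 == i.+1) = false by lia.
  have ne1 : (i.+1 == i.-1) = false by lia.
  have ei : (i.+1 == i) = false by lia.
  have ie : (i == i.+1) = false by lia.
  have coordE u : node_abs u = ((node_coord u).2).+1 by case: u.
  have [m1 l1] := cD (cap_lo hi1); have [m2 l2] := cD (cap_hi hi1).
  apply: weight_gen_turn => //.
  + by rewrite l1 /rewire_lab /cap_coord /= ne eqxx.
  + rewrite l2 /rewire_lab /cap_coord /gen_coord /other_coord /gen_lab /=.
    by do 5!rewrite ?ne ?en ?en1 ?ne1 ?ei ?ie ?eqxx /=; lia.
  + rewrite coordE m1 /rewire_coord /cap_coord /other_coord /=.
    by do 5!rewrite ?ne ?en ?en1 ?ne1 ?ei ?ie ?eqxx /=; lia.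
  + rewrite coordE m2 /rewire_coord /cap_coord /other_coord /gen_coord /=.
    by do 5!rewrite ?ne ?en ?en1 ?ne1 ?ei ?ie ?eqxx /=; lia.
- by rewrite /word_prod !big_cons big_nil !mulr1 mulrA E_down.
Qed.

End Relations.

(** * Normal forms *)

(** The factor g_i g_(i-1) ... g_(i-c+1) of g_s, for c = c_(i+1). *)
Definition block i c : seq nat := [seq i - k | k <- iota 0 c].
Definition normal_word (c : nat -> nat) n := flatten [seq block i (c i) | i <- iota 0 n].
Definition is_code (c : nat -> nat) := forall i, c i <= i.

Lemma blockD i a b : block i (a + b) = block i a ++ block (i - a) b.
Proof.
rewrite /block iotaD map_cat add0n; congr (_ ++ _).
rewrite -[a in iota a b]addn0 iotaDl -map_comp; apply: eq_map => k /=.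
by rewrite subnDA.
Qed.

Lemma block1 i : block i 1 = [:: i].
Proof. by rewrite /block /= subn0. Qed.

Lemma blockS i c : block i c.+1 = rcons (block i c) (i - c).
Proof. by rewrite -addn1 blockD block1 cats1. Qed.

Lemma mem_block i c k : c <= i -> k \in block i c -> i - c < k <= i.
Proof. by move=> ci /mapP[j]; rewrite mem_iota => hj ->; lia. Qed.

Lemma normal_wordS c n : normal_word c n.+1 = normal_word c n ++ block n (c n).
Proof. by rewrite /normal_word -addn1 iotaD map_cat flatten_cat /= cats0. Qed.

Lemma eq_normal_word c c' n : (forall i, i < n -> c i = c' i) ->
  normal_word c n = normal_word c' n.
Proof.
move=> E; congr flatten; apply/eq_in_map => i; rewrite mem_iota add0n => /= /E ->.
by [].
Qed.

Section NormalForm.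
Variable N : nat.
Variables (K : fieldType) (x y : nat -> K) (R : algType K) (E : nat -> R).
Local Open Scope ring_scope.
Hypothesis E_sq : forall i, (0 < i < N)%N -> E i * E i = x i *: E i.
Hypothesis E_comm : forall i j, (0 < i)%N -> (i.+1 < j < N)%N -> E i * E j = E j * E i.
Hypothesis E_down : forall i, (0 < i)%N -> (i.+1 < N)%N ->
  E i.+1 * E i * E i.+1 = y i *: E i.+1.

Local Notation rewrites := (@rewrites N K x y R E).
Implicit Types (w v z : seq nat) (D : odiag N).

Lemma rewrites1_trans w1 w2 w3 d : rewrites w1 1 w2 -> rewrites w2 d w3 -> rewrites w1 d w3.
Proof. by move=> r1 r2; rewrite -[d]mul1r; apply: rewrites_trans r1 r2. Qed.

Lemma rewrites_catl v w c w' : letters N v -> rewrites w c w' -> rewrites (v ++ w) c (v ++ w').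
Proof. by move=> lv r; rewrite -[c]mul1r; apply: rewrites_cat => //; apply: rewrites_refl. Qed.

Lemma rewrites_catr v w c w' : letters N v -> rewrites w c w' -> rewrites (w ++ v) c (w' ++ v).
Proof. by move=> lv r; rewrite -[c]mulr1; apply: rewrites_cat => //; apply: rewrites_refl. Qed.

Lemma rewrites_far v w : letters N v -> letters N w ->
  (forall i j, i \in v -> j \in w -> j.+1 < i)%N -> rewrites (v ++ w) 1 (w ++ v).
Proof.
have far1 v' j : letters N v' -> (0 < j < N)%N -> (forall i, i \in v' -> j.+1 < i)%N ->
    rewrites (v' ++ [:: j]) 1 (j :: v').
  elim: v' => [|i v' IH] /= => [_ hj _|/andP[hi lv] hj far].
    by apply: rewrites_refl; rewrite /letters /= hj.
  apply: (@rewrites1_trans _ ([:: i] ++ j :: v')).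
    rewrite -[i :: _]/([:: i] ++ (v' ++ [:: j])).
    apply: rewrites_catl; first by rewrite /letters /= hi.
    by apply: IH => // k kv; apply: far; rewrite inE kv orbT.
  apply: (@rewrites_catr v' [:: i; j] 1 [:: j; i]) => //.
  apply: rewrites_commC => //; first by case/andP: hj.
  by rewrite far ?mem_head //; case/andP: hi.
elim: w v => [|j w IH] v lv lw far; first by rewrite cats0; apply: rewrites_refl.
have /andP[hj lw'] : (0 < j < N)%N && letters N w by [].
apply: (@rewrites1_trans _ ((j :: v) ++ w)).
  rewrite -[j :: w]cat1s catA; apply: rewrites_catr => //.
  by apply: far1 => // i iv; apply: far; rewrite ?mem_head.
rewrite -[(j :: v) ++ w]/([:: j] ++ (v ++ w)) -[(j :: w) ++ v]/([:: j] ++ (w ++ v)).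
apply: rewrites_catl; first by rewrite /letters /= hj.
by apply: IH => // i k iv kw; apply: far => //; rewrite inE kw orbT.
Qed.

Definition small n w := all (fun i => 0 < i < n)%N w.

Lemma small_letters n w : (n <= N)%N -> small n w -> letters N w.
Proof. by move=> nN /allP h; apply/allP=> i /h; lia. Qed.

Lemma small_block n c : (c <= n)%N -> small n.+1 (block n c).
Proof. by move=> cn; apply/allP=> k /(mem_block cn); lia. Qed.

Lemma small_normal c n : is_code c -> small n (normal_word c n).
Proof.
move=> cc; elim: n => [|n IH] //; rewrite normal_wordS /small all_cat -!/(small _ _).
rewrite small_block // andbT; apply: sub_all IH => i; lia.
Qed.

Lemma small_cat n w v : small n (w ++ v) = small n w && small n v.
Proof. exact: all_cat. Qed.

(** A letter i after the block n, n - 1, ..., n - b + 1 either commutes to its front,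
    is absorbed by its last letter, cuts it after a relation i (i - 1) i = y i, or
    extends it. *)
Lemma block_letter n b i : (n < N)%N -> (b <= n)%N -> (0 < i <= n)%N ->
  exists v c k, [/\ small n v, (c <= n)%N & rewrites (block n b ++ [:: i]) k (v ++ block n c)].
Proof.
move=> nN bn hi; have hiN : (0 < i < N)%N by lia.
have lb c : (c <= n)%N -> letters N (block n c).
  by move=> cn; apply: small_letters (small_block cn).
have li : letters N [:: i] by rewrite /letters /= hiN.
have [lt|gt|E1] := ltngtP i (n - b)%N.
- exists [:: i], b, 1; split=> //; first by rewrite /small /= andbT; lia.
  apply: rewrites_far => // [|k j /(mem_block bn) hk]; first exact: lb.
  by rewrite inE => /eqP ->; lia.
- have [E1|gt1] : (i = (n - b).+1 \/ (n - b).+1 < i)%N by lia.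
    exists [::], b, (x i); split=> //.
    have [b' Eb] : exists b', b = b'.+1 by case: b bn gt E1 lb => // *; [lia|eexists].
    have -> : block n b = block n b' ++ [:: i] by rewrite Eb blockS cats1; congr rcons; lia.
    rewrite -catA; apply: rewrites_catl; first by apply: lb; lia.
    exact: rewrites_sq.
  exists (block (i - 2) (i - 2 - (n - b))), (n - i).+1, (y i.-1).
  have hc : (i - 2 - (n - b) <= i - 2)%N by lia.
  have sm : small n (block (i - 2) (i - 2 - (n - b))).
    by apply/allP=> k /(mem_block hc); lia.
  split=> //; first by lia.
  have -> : block n b = block n (n - i) ++ [:: i; i.-1] ++ block (i - 2) (i - 2 - (n - b)).
    have {1}-> : b = (n - i + (2 + (i - 2 - (n - b))))%N by lia.
    rewrite blockD blockD (_ : n - (n - i) = i)%N; last by lia.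
    by rewrite (_ : block i 2 = [:: i; i.-1]) // /block /= subn0 subn1.
  set t := block (i - 2) _ in sm *; have lt := small_letters (ltnW nN) sm.
  have lA : letters N (block n (n - i)) by apply: lb; lia.
  have lii : letters N [:: i; i.-1] by rewrite /letters /= hiN; lia.
  have -> : (block n (n - i) ++ [:: i; i.-1] ++ t) ++ [:: i] =
      (block n (n - i) ++ [:: i; i.-1]) ++ (t ++ [:: i]) by rewrite -!catA.
  have far_t k : k \in t -> (k.+1 < i)%N by move=> /(mem_block hc); lia.
  apply: (@rewrites1_trans _ ((block n (n - i) ++ [:: i; i.-1]) ++ ([:: i] ++ t))).
    apply: rewrites_catl; first by rewrite letters_cat lA lii.
    have [l1 l2 D W P] : rewrites ([:: i] ++ t) 1 (t ++ [:: i]).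
      by apply: rewrites_far => // j k; rewrite inE => /eqP-> /far_t.
    by split; rewrite // ?W ?P ?mul1r ?scale1r.
  rewrite -[y _]mulr1; apply: (rewrites_trans (w2 := (block n (n - i) ++ [:: i]) ++ t)).
    rewrite -!catA; apply: rewrites_catl => //.
    have -> : [:: i; i.-1] ++ [:: i] ++ t = [:: i; i.-1; i] ++ t by [].
    apply: rewrites_catr => //.
    have Ei : i.-1.+1 = i by lia.
    by have := rewrites_down x E_down (i := i.-1); rewrite Ei; apply; lia.
  have -> : block n (n - i).+1 = block n (n - i) ++ [:: i].
    by rewrite blockS cats1; congr rcons; lia.
  apply: rewrites_far => //; first by rewrite letters_cat lA li.
  move=> j k; rewrite mem_cat inE => /orP[/mem_block hj /far_t|/eqP-> /far_t //].
  by have := hj; lia.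
- exists [::], b.+1, 1; split=> //; first by lia.
  rewrite blockS -E1 cats1; apply: rewrites_refl.
  by rewrite -cats1 letters_cat li lb.
Qed.

(** Induction on the largest letter: letters are appended to a normal word one at a
    time, and [block_letter] keeps a single block with the letter n. *)
Lemma normal_form n w : (n <= N)%N -> small n w ->
  exists c k, is_code c /\ rewrites w k (normal_word c n).
Proof.
elim: n w => [|n IH] w nN sw.
  exists (fun=> 0%N), 1; split=> //; case: w sw => [|i w] /=; last by rewrite ltn0 andbF.
  by move=> _; apply: rewrites_refl.
have nN' := ltnW nN.
elim/last_ind: w sw => [_|w i IHw].
  exists (fun=> 0%N), 1; split=> //.
  have -> : normal_word (fun=> 0%N) n.+1 = [::].
    by elim: n.+1 => // m IHm; rewrite normal_wordS IHm.
  exact: rewrites_refl.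
rewrite -cats1 small_cat /= andbT => /andP[/IHw[c [k [cc rw]]] hi].
have [|v [b [k' [sv bn rb]]]] := @block_letter n (c n) i nN (cc n); first by lia.
have sn : small n (normal_word c n ++ v) by rewrite small_cat small_normal.
have [c' [k'' [cc' r']]] := IH _ nN' sn.
exists (fun j => if j == n then b else c' j), (k * (k' * k'')); split.
  by move=> j; case: eqP => [->|_].
have ci : letters N [:: i] by rewrite /letters /= andbT; lia.
apply: (rewrites_trans (w2 := normal_word c n.+1 ++ [:: i])).
  exact: rewrites_catr.
rewrite normal_wordS -catA.
apply: (rewrites_trans (w2 := normal_word c n ++ v ++ block n b)).
  by apply: rewrites_catl => //; apply: small_letters (small_normal _ cc).
rewrite normal_wordS eqxx catA.
rewrite (@eq_normal_word (fun j => if j == n then b else c' j) c') => [|j jn]; last by rewrite ltn_eqF.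
apply: rewrites_catr => //; exact: small_letters (small_block bn).
Qed.

End NormalForm.

(** * Injectivity of normal words *)

Section NormalDiagrams.
Variable N : nat.
Implicit Types (D : odiag N) (k : 'I_N) (u : node N).

(** The strands of index at least n are those of the identity diagram; indices
    count from 0, so that products of the generators 1, ..., n - 1 have this form. *)
Definition trivial_from n D := forall k, n <= k ->
  mate (val D) (inr k) = inl k /\ label (val D) (inr k) = k.+1.

(** The largest k <= n such that the label at the right node k is k + 1 is n - b.
    This statistic recovers the length b of the last block. *)
Definition peak n b D := forall k, (k = n - b :> nat -> label (val D) (inr k) = k.+1) /\
  (n - b < k <= n -> label (val D) (inr k) <= k).

Lemma mate_act D i (hi : 0 < i < N) u :
  mate (val (act_letter D i)) u = rewire_mate hi D u.
Proof. by rewrite val_act_letter // mate_mul_gen. Qed.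

Lemma label_act D i (hi : 0 < i < N) u :
  label (val (act_letter D i)) u = rewire_label hi D u.
Proof. by rewrite val_act_letter // label_mul_gen. Qed.

Lemma is_cap_inr i (hi : 0 < i < N) k : is_cap hi (inr k) = (k == i.-1 :> nat) || (k == i :> nat).
Proof. by rewrite /is_cap !(inj_eq inr_inj) -!val_eqE. Qed.

Lemma is_cap_inl i (hi : 0 < i < N) k : is_cap hi (inl k) = false.
Proof. by []. Qed.

Lemma label_act_le D i (hi : 0 < i < N) u : ~~ is_cap hi u ->
  label (val (act_letter D i)) u <= label (val D) u.
Proof.
move=> nu; rewrite (label_act _ hi) /rewire_label (negbTE nu); case: ifP => // _.
exact: geq_minl.
Qed.

Lemma trivial_act n D i : 0 < i < n -> trivial_from n D -> trivial_from n (act_letter D i).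
Proof.
move=> hin tD k nk; have kN := ltn_ord k; have hi : 0 < i < N by lia.
have [mk lk] := tD k nk; have nc : is_cap hi (inr k) = false by rewrite is_cap_inr; lia.
by rewrite (mate_act _ hi) (label_act _ hi) /rewire_mate /rewire_label nc mk is_cap_inl.
Qed.

Lemma peak0 n D : trivial_from n D -> peak n 0 D.
Proof.
move=> tD k; rewrite subn0; split=> [kn|]; last by case: ltngtP.
by have [] := tD k; rewrite ?kn.
Qed.

Lemma peak_act n b D : b < n < N -> peak n b D -> peak n b.+1 (act_letter D (n - b)).
Proof.
move=> hb pD k; have hi : 0 < n - b < N by lia.
have capE := is_cap_inr hi k; split=> [kE|hk].
  have cE : is_cap hi (inr k) by rewrite capE kE; lia.
  by rewrite (label_act _ hi) /rewire_label cE; lia.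
have [Ek|nk] := eqVneq (k : nat) (n - b).
  by rewrite (label_act _ hi) /rewire_label capE Ek eqxx orbT.
have nc : ~~ is_cap hi (inr k) by rewrite capE; lia.
apply: leq_trans (label_act_le D nc) _.
by have [_ ->] := pD k; lia.
Qed.

Lemma peak_block n b D : b <= n < N -> trivial_from n D -> peak n b (act D (block n b)).
Proof.
move=> + tD; elim: b => [|b IH] hb; first exact: peak0.
rewrite blockS act_rcons; apply: peak_act; first by lia.
by apply: IH; lia.
Qed.

Lemma peak_inj n b b' D : b <= n < N -> b' <= n -> peak n b D -> peak n b' D -> b = b'.
Proof.
wlog lt : b b' / b < b'.
  move=> W hb hb' pb pb'; case: (ltngtP b b') => // h; first exact: W.
  by apply/esym; apply: W => //; lia.
move=> hb hb' pb pb'.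
have kN : n - b < N by lia.
have [E _] := pb (Ordinal kN); have [_ L] := pb' (Ordinal kN).
have hk : n - b' < n - b <= n by lia.
by have := L hk; rewrite E //= ltnn.
Qed.

Lemma trivial_block n c D : c <= n < N -> trivial_from n D ->
  trivial_from n.+1 (act D (block n c)).
Proof.
move=> + tD; elim: c => [|c IH] hc.
  by move=> k nk; apply: tD; lia.
rewrite blockS act_rcons; apply: trivial_act; first by lia.
by apply: IH; lia.
Qed.

Lemma trivial_one n : trivial_from n (one_odiag N).
Proof. by move=> k _; rewrite mate1 label1. Qed.

Lemma trivial_normal c n : is_code c -> n <= N -> trivial_from n (diag N (normal_word c n)).
Proof.
move=> cc; elim: n => [|n IH] nN; first exact: trivial_one.
rewrite normal_wordS /diag act_cat; apply: trivial_block; last exact/IH/ltnW.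
by rewrite cc.
Qed.

Section Weight.
Variables (K : fieldType) (x y : nat -> K).

(** At each step the label at the upper cap end is as large as possible. *)
Lemma act_weight_block n b D : b <= n < N -> trivial_from n D ->
  act_weight x y D (block n b) = 1%R.
Proof.
move=> + tD; elim: b => [|b IH] hb //.
rewrite blockS -cats1 act_weight_cat IH; last by lia.
have nb : 0 < n - b < N by lia.
rewrite mul1r /= mulr1; apply: (mul_weight_absorb x y (hi := nb)).
have hb' : b <= n < N by lia.
by have [-> //] := peak_block hb' tD (hi nb).
Qed.

Lemma word_weight_normal c n : is_code c -> n <= N -> word_weight N x y (normal_word c n) = 1%R.
Proof.
move=> cc; elim: n => [|n IH] nN //.
rewrite normal_wordS /word_weight act_weight_cat -/(word_weight N x y _) IH; last exact: ltnW.
by rewrite mul1r act_weight_block ?cc //; apply: trivial_normal => //; apply: ltnW.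
Qed.

End Weight.

Section Unwind.
Variables (n : nat) (nN : 0 < n < N).
Implicit Type P : diagram N.
Local Notation lo := (lo nN).
Local Notation hi := (hi nN).

(** The inverse of the multiplication by A_n on the diagrams that are trivial from n
    on: the strand inr (n - 1) of the factor is found as the mate of inl n in the
    product. *)
Definition unwind P : diagram N :=
  [ffun u => if u == inr hi then (inl hi, n.+1) else if u == inl hi then (inr hi, n.+1)
   else if u == inr lo then P (inl hi)
   else if mate P u == inl hi then (inr lo, label P u) else P u].

Lemma unwind_act D : trivial_from n D -> unwind (val (act_letter D n)) = val D.
Proof.
move=> tD; set P := val (act_letter D n).
have okD : okada_diagram (val D) := valP D.
have [mh lh] := tD hi (leqnn n).
have mh' : mate (val D) (inl hi) = inr hi by rewrite -mh mateK.
have lh' : label (val D) (inl hi) = n.+1 by rewrite -mh label_mate.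
have ll : label (val D) (inr lo) <= n by have := label_abs okD (inr lo) => /=; lia.
have mP u : mate P u = rewire_mate nN D u := mate_act D nN u.
have lP u : label P u = rewire_label nN D u := label_act D nN u.
have hl : (inr hi == inr lo :> node N) = false by rewrite (inj_eq inr_inj) hi_neq_lo.
have lhi : (inr lo == inr hi :> node N) = false by rewrite eq_sym.
have PE u : P u = (mate P u, label P u) by rewrite -surjective_pairing.
apply/ffunP=> u; rewrite ffunE [RHS]surjective_pairing -!/(mate _ _) -!/(label _ _).
case: eqP => [->|/eqP n1]; first by rewrite mh lh.
case: eqP => [->|/eqP n2]; first by rewrite mh' lh'.
case: eqP => [->|/eqP n3].
  rewrite PE mP lP /rewire_mate /rewire_label mh' /is_cap /= !eqxx orbT.
  by rewrite other_cap_hi lh' (minn_idPr _) //; apply: leqW.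
have nc : is_cap nN u = false by rewrite /is_cap (negbTE n1) (negbTE n3).
have nm1 : (mate (val D) u == inr hi) = false.
  by apply: contraNF n2 => /eqP E; rewrite -(mateK okD u) E mh.
rewrite mP lP /rewire_mate /rewire_label nc /is_cap nm1 orbF -/(cap_lo nN).
case: (eqVneq (mate (val D) u) (cap_lo nN)) => [E|nE].
  rewrite ?E other_cap_lo mh eqxx lh; congr pair.
  by rewrite -(label_mate okD) E (minn_idPl _) //; apply: leqW.
rewrite PE mP lP /rewire_mate /rewire_label nc /is_cap nm1 orbF -/(cap_lo nN) (negbTE nE).
by case: eqP => // E; rewrite -(mateK okD u) E mh' eqxx in n1.
Qed.

End Unwind.

Lemma act_down D i : 0 < i -> i.+1 < N -> act D [:: i.+1; i; i.+1] = act D [:: i.+1].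
Proof.
move=> i0 iN; have l1 : letters N [:: i.+1] by rewrite /letters /= iN.
have l3 : letters N [:: i.+1; i; i.+1] by rewrite /letters /= iN i0 ltnW.
apply: val_inj; rewrite -(mul_diag_act D l3) -(mul_diag_act D l1).
by rewrite (diag_down i0 iN).
Qed.

(** By the relation A_(j+1) A_j A_(j+1) = A_(j+1), the last letter of a block of length
    at least 2 can be cancelled. *)
Lemma act_block_back D n b : b.+1 < n < N ->
  act_letter (act D (block n b.+2)) (n - b) = act D (block n b.+1).
Proof.
move=> hb; rewrite -[b.+2]addn2 -[b.+1 in RHS]addn1 !blockD !act_cat -act_rcons.
have -> : block (n - b) 2 = [:: (n - b.+1).+1; n - b.+1].
  by rewrite /block /= subn0 -subnDA addn1 subnSK //; lia.
have -> : n - b = (n - b.+1).+1 by lia.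
rewrite block1 -cats1 -[_ ++ _]/[:: (n - b.+1).+1; n - b.+1; (n - b.+1).+1].
by apply: act_down; lia.
Qed.

Lemma act_block_inj n b D D' : b <= n < N -> trivial_from n D -> trivial_from n D' ->
  act D (block n b) = act D' (block n b) -> D = D'.
Proof.
move=> + tD tD'; elim: b => [|b IH] hb // E.
case: b hb IH E => [|b] hb IH E; last first.
  apply: IH; first by lia.
  have hb' : b.+1 < n < N by lia.
  by rewrite -!(act_block_back _ hb') E.
have nN : 0 < n < N by lia.
apply: val_inj; rewrite -(unwind_act nN tD) -(unwind_act nN tD').
by move: E; rewrite block1 /= => ->.
Qed.

(** The last block is recovered letter by letter: its length by [peak_inj], then the
    diagram before it by [act_block_inj]. *)
Lemma diag_normal_inj c c' n : is_code c -> is_code c' -> n <= N ->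
  diag N (normal_word c n) = diag N (normal_word c' n) -> forall i, i < n -> c i = c' i.
Proof.
move=> cc cc'; elim: n => [|n IH] nN // E.
have tc := trivial_normal cc (ltnW nN); have tc' := trivial_normal cc' (ltnW nN).
have hc : c n <= n < N by rewrite cc.
have hc' : c' n <= n < N by rewrite cc'.
move: E; rewrite !normal_wordS /diag !act_cat -!/(diag _ _) => E.
have cn : c n = c' n.
  have p' := peak_block hc' tc'; rewrite -E in p'.
  exact: peak_inj hc (cc' n) (peak_block hc tc) p'.
move: E; rewrite -cn => /(act_block_inj hc tc tc') /(IH (ltnW nN)) IH' i.
by rewrite ltnS leq_eqVlt => /orP[/eqP-> //|/IH'].
Qed.

End NormalDiagrams.

(** * Surjectivity of normal words *)

Section Unwinding.
Variables (N n : nat) (nN : 0 < n < N) (P : diagram N).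
Local Notation lo := (lo nN).
Local Notation hi := (hi nN).
Implicit Types u v s p : node N.
Hypothesis okP : okada_diagram P.
Hypothesis trP : forall k : 'I_N, n < k -> mate P (inr k) = inl k /\ label P (inr k) = k.+1.
Hypothesis mate_hi : mate P (inr hi) = inr lo.
Hypothesis label_hi : label P (inr hi) = n.

Local Notation Q := (unwind nN P).
Let v0 := mate P (inl hi).
Definition inner u := node_abs u <= n.
Definition far u := n.+1 < node_abs u.

Let abs_pos u : [/\ node_pos u < N.*2, far u = (n < node_pos u < N.*2.-1 - n) &
  inner u = (node_pos u < n) || (N.*2.-1 - n < node_pos u)].
Proof. by rewrite /far /inner; case: u => k /=; have := ltn_ord k; split; lia. Qed.

Let pos_lo : node_pos (inr lo) = N.*2 - n. Proof. by rewrite /=; lia. Qed.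
Let pos_inr : node_pos (inr hi) = N.*2.-1 - n. Proof. by []. Qed.
Let pos_inl : node_pos (inl hi) = n. Proof. by []. Qed.

Let mate_lo : mate P (inr lo) = inr hi. Proof. by rewrite -mate_hi mateK. Qed.

Let mate_far u : far u -> mate P u = opp_node u /\ label P u = node_abs u.
Proof.
rewrite /far; case: u => k hk; have [|m l] := trP (k := k); rewrite //=.
by rewrite -l -m mateK // label_mate.
Qed.

Let not_far u : ~~ far u -> [\/ u = inr hi, u = inl hi | inner u].
Proof.
rewrite /far /inner; case: u => k hk; have [E|le] := eqVneq (k : nat) n.
- by apply: Or32; congr inl; apply: val_inj.
- by apply: Or33; move: hk le => /=; lia.
- by apply: Or31; congr inr; apply: val_inj.
- by apply: Or33; move: hk le => /=; lia.
Qed.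

Let far_opp u : far (opp_node u) = far u. Proof. by rewrite /far node_abs_opp. Qed.

Let far_mate u : far (mate P u) = far u.
Proof.
apply/idP/idP=> F; last by have [-> _] := mate_far F; rewrite far_opp.
have [E _] := mate_far F; rewrite -(mateK okP u) E.
by rewrite far_opp.
Qed.

Let inner_mate u : inner u -> u != inr lo -> u != v0 -> inner (mate P u).
Proof.
move=> iu n1 n2; have nf : ~~ far (mate P u) by rewrite far_mate /far -leqNgt ltnW.
case: (not_far nf) => // E; last by rewrite /v0 -E mateK // eqxx in n2.
by rewrite -(mateK okP u) E mate_hi eqxx in n1.
Qed.

Let v0_lo : v0 != inr lo.
Proof. by rewrite -mate_hi (inj_eq (mate_inj okP)). Qed.

Let inner_v0 : inner v0.
Proof.
have nf : ~~ far v0 by rewrite far_mate /far /= ltnn.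
case: (not_far nf) => // E; last by have := mate_neq okP (inl hi); rewrite -/v0 E eqxx.
by have := mate_hi; rewrite -E mateK.
Qed.

Let inner_lo : inner (inr lo). Proof. by rewrite /inner /=; lia. Qed.

Let kindP u : [\/ u = inr hi \/ u = inl hi, u = inr lo \/ u = v0, far u |
  [/\ inner u, inner (mate P u), u != inr lo & u != v0]].
Proof.
case F: (far u); first by apply: Or43.
case: (not_far (negbT F)) => [->|->|I]; [by apply: Or41; left|by apply: Or41; right|].
have [->|n1] := eqVneq u (inr lo); first by apply: Or42; left.
have [->|n2] := eqVneq u v0; first by apply: Or42; right.
by apply: Or44; split=> //; apply: inner_mate.
Qed.

Let inner_neq u : inner u -> (u == inr hi = false) * (u == inl hi = false).
Proof. by move=> I; split; apply/eqP=> E; move: I; rewrite E /inner /= ltnn. Qed.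

Let far_neq u : far u -> (u == inr hi = false) * (u == inl hi = false) *
  (u == inr lo = false) * (u == v0 = false).
Proof.
move=> F; do !split; apply/eqP=> E; move: F; rewrite E /far ?/= ?ltnn //; first by lia.
by move: inner_v0; rewrite /inner; lia.
Qed.

Let unwindE u : Q u = if u == inr hi then (inl hi, n.+1) else if u == inl hi then (inr hi, n.+1)
   else if u == inr lo then P (inl hi)
   else if mate P u == inl hi then (inr lo, label P u) else P u.
Proof. by rewrite ffunE. Qed.

Let mate_eq_hi u : (mate P u == inl hi) = (u == v0).
Proof. by rewrite -{1}(mateK okP (inl hi)) (inj_eq (mate_inj okP)). Qed.

Let unwind_hi u : u = inr hi \/ u = inl hi -> Q u = (opp_node u, n.+1).
Proof. by rewrite unwindE => -[->|->]; rewrite eqxx. Qed.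

Let unwind_lo : Q (inr lo) = (v0, label P (inl hi)).
Proof.
rewrite unwindE (inner_neq inner_lo).1 (inner_neq inner_lo).2 eqxx.
exact: surjective_pairing.
Qed.

Let unwind_v0 : Q v0 = (inr lo, label P (inl hi)).
Proof.
rewrite unwindE !(inner_neq inner_v0) (negbTE v0_lo) mate_eq_hi eqxx.
by rewrite label_mate.
Qed.

Let unwind_far u : far u -> Q u = (opp_node u, node_abs u).
Proof.
move=> F; rewrite unwindE !(far_neq F) mate_eq_hi !(far_neq F).
by rewrite (surjective_pairing (P u)) -!/(mate _ _) -!/(label _ _); have [-> ->] := mate_far F.
Qed.

Let unwind_inner u : inner u -> u != inr lo -> u != v0 -> Q u = P u.
Proof.
by move=> I n1 n2; rewrite unwindE !(inner_neq I) (negbTE n1) mate_eq_hi (negbTE n2).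
Qed.

Let mateQ_hi u : u = inr hi \/ u = inl hi -> mate Q u = opp_node u /\ label Q u = n.+1.
Proof. by rewrite /mate /label => /unwind_hi ->. Qed.
Let mateQ_lo u : u = inr lo \/ u = v0 ->
  mate Q u = (if u == inr lo then v0 else inr lo) /\ label Q u = label P (inl hi).
Proof.
by rewrite /mate /label => -[->|->]; rewrite ?eqxx ?(negbTE v0_lo) ?unwind_lo ?unwind_v0.
Qed.
Let mateQ_far u : far u -> mate Q u = opp_node u /\ label Q u = node_abs u.
Proof. by rewrite /mate /label => /unwind_far ->. Qed.
Let mateQ_inner u : inner u -> u != inr lo -> u != v0 -> mate Q u = mate P u /\ label Q u = label P u.
Proof. by rewrite /mate /label => I n1 n2; rewrite unwind_inner. Qed.

Let mate_plain u : inner u -> u != inr lo -> u != v0 ->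
  mate P u != inr lo /\ mate P u != v0.
Proof.
move=> I n1 n2; rewrite -mate_hi !(inj_eq (mate_inj okP)).
by rewrite !(inner_neq I).
Qed.

Let mateQK : involutive (mate Q).
Proof.
move=> u; have [h|h|h|[I Im n1 n2]] := kindP u.
- have [-> _] := mateQ_hi h; have [|-> _] := @mateQ_hi (opp_node u).
    by case: h => ->; [right|left].
  exact: opp_nodeK.
- have [-> _] := mateQ_lo h; case: h => ->; rewrite ?eqxx ?(negbTE v0_lo).
    by have [|-> _] := @mateQ_lo v0; [right|rewrite (negbTE v0_lo)].
  by have [|-> _] := @mateQ_lo (inr lo); [left|rewrite eqxx].
- have [-> _] := mateQ_far h; have [|-> _] := @mateQ_far (opp_node u); first by rewrite far_opp.
  exact: opp_nodeK.
- have [-> _] := mateQ_inner I n1 n2; have [m1 m2] := mate_plain I n1 n2.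
  by have [-> _] := mateQ_inner Im m1 m2; rewrite mateK.
Qed.

Let labelQ_mate u : label Q (mate Q u) = label Q u.
Proof.
have [h|h|h|[I Im n1 n2]] := kindP u.
- have [-> ->] := mateQ_hi h; have [|_ ->//] := @mateQ_hi (opp_node u).
  by case: h => ->; [right|left].
- have [-> ->] := mateQ_lo h; case: h => ->; rewrite ?eqxx ?(negbTE v0_lo).
    by have [|_ ->] := @mateQ_lo v0; [right|].
  by have [|_ ->] := @mateQ_lo (inr lo); [left|].
- have [-> ->] := mateQ_far h; have [|_ ->] := @mateQ_far (opp_node u); first by rewrite far_opp.
  exact: node_abs_opp.
- have [-> ->] := mateQ_inner I n1 n2; have [m1 m2] := mate_plain I n1 n2.
  by have [_ ->] := mateQ_inner Im m1 m2; rewrite label_mate.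
Qed.

Let mateQ_eq u v : (mate Q u == v) = (u == mate Q v).
Proof. exact: can2_eq. Qed.

Let mateQ_neq u : mate Q u != u.
Proof.
have [h|h|h|[I Im n1 n2]] := kindP u.
- by have [-> _] := mateQ_hi h; case: h => ->.
- by have [-> _] := mateQ_lo h; case: h => ->; rewrite ?eqxx ?(negbTE v0_lo) // eq_sym.
- by have [-> _] := mateQ_far h; case: (u).
- by have [-> _] := mateQ_inner I n1 n2; apply: mate_neq.
Qed.

Let plain u := [&& inner u, u != inr lo & u != v0].

Let kindQ u : [\/ u = inr hi \/ u = inl hi, u = inr lo \/ u = v0, far u | plain u].
Proof.
have [h|h|h|[I Im n1 n2]] := kindP u; [exact: Or41|exact: Or42|exact: Or43|].
by apply: Or44; rewrite /plain I n1.
Qed.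

Let plain_hi u : u = inr hi \/ u = inl hi -> plain u = false /\ far u = false.
Proof. by rewrite /plain /inner /far => -[] ->; rewrite /= !ltnn. Qed.
Let plain_lo u : u = inr lo \/ u = v0 -> plain u = false /\ far u = false.
Proof.
rewrite /plain => -[] ->; rewrite !eqxx /= ?andbF; split=> //.
  by move: inner_lo; rewrite /inner /far; lia.
by move: inner_v0; rewrite /inner /far; lia.
Qed.
Let plain_far u : far u -> plain u = false.
Proof. by rewrite /plain /inner /far; lia. Qed.
Let far_plain u : plain u -> far u = false.
Proof. by case/and3P; rewrite /inner /far; lia. Qed.
Let mateQ_plain u : plain u -> mate Q u = mate P u /\ label Q u = label P u.
Proof. by case/and3P; apply: mateQ_inner. Qed.

Let kind_mate u : plain (mate Q u) = plain u /\ far (mate Q u) = far u.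
Proof.
have [h|h|h|h] := kindQ u.
- have [-> _] := mateQ_hi h; have [-> ->] := plain_hi h.
  by apply: plain_hi; case: h => ->; [right|left].
- have [-> _] := mateQ_lo h; have [-> ->] := plain_lo h.
  by apply: plain_lo; case: ifP => _; [right|left].
- have [-> _] := mateQ_far h; rewrite far_opp h (plain_far h).
  by rewrite plain_far ?far_opp.
- have [-> _] := mateQ_plain h; rewrite far_mate h far_plain //.
  have /and3P[I n1 n2] := h; have [m1 m2] := mate_plain I n1 n2.
  by rewrite /plain m1 m2 inner_mate.
Qed.

Let label_lo : label P (inl hi) <= n.
Proof. by apply: leq_trans (label_abs_mate okP _) _; apply: inner_v0. Qed.

Let boundsQ u : 0 < label Q u <= minn (node_abs u) (node_abs (mate Q u)) /\
  odd (label Q u) = odd (minn (node_abs u) (node_abs (mate Q u))).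
Proof.
have [h|h|h|h] := kindQ u.
- have [-> ->] := mateQ_hi h; rewrite node_abs_opp minnn.
  by case: h => -> /=; rewrite leqnn.
- have [-> ->] := mateQ_lo h.
  have -> : minn (node_abs u) (node_abs (if u == inr lo then v0 else inr lo)) = node_abs v0.
    have le : node_abs v0 <= node_abs (inr lo : node N) by apply: leq_trans inner_v0 _; rewrite /=; lia.
    by case: h => ->; rewrite ?eqxx ?(negbTE v0_lo); [apply/minn_idPr|apply/minn_idPl].
  rewrite label_gt0 // label_abs_mate // label_odd // (minn_idPr _) //.
  by apply: leq_trans inner_v0 _; rewrite /=.
- have [-> ->] := mateQ_far h; rewrite node_abs_opp minnn leqnn.
  by split=> //; move: h; rewrite /far; lia.
- have [-> ->] := mateQ_plain h; rewrite label_odd // leq_min.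
  by rewrite label_gt0 // label_abs // label_abs_mate.
Qed.

Let enc_mid s p p' : far s = false -> s != inr hi -> s != inl hi ->
  mate P s != inr hi -> mate P s != inl hi ->
  ~~ inner p -> ~~ inner p' -> encloses P s p = encloses P s p'.
Proof.
move=> f n1 n2 m1 m2; have {}f : ~~ far s by rewrite f.
have fm : ~~ far (mate P s) by rewrite far_mate.
have Is : inner s by have [E|E|//] := not_far f; rewrite E eqxx in n1 n2.
have Im : inner (mate P s) by have [E|E|//] := not_far fm; rewrite E eqxx in m1 m2.
have [lp _ ip] := abs_pos p; have [lp' _ ip'] := abs_pos p'.
have [ls _ is_] := abs_pos s; have [lm _ im] := abs_pos (mate P s).
move: Is Im; rewrite /encloses ip ip' is_ im.
clear -lp lp' ls lm; lia.
Qed.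

Let encQ s p : p != s -> p != mate Q s ->
  encloses Q s (mate Q p) = encloses Q s p /\ (encloses Q s p -> label Q s < label Q p).
Proof.
have encC s' p' : encloses Q (mate Q s') p' = encloses Q s' p'.
  by rewrite /encloses mateQK addbC.
(* Both claims are symmetric in the two ends of the arc of s. *)
wlog base : s / [\/ s = inr hi, s = inr lo, far s | plain s].
  move=> W ps pms; have [[h|h]|[h|h]|h|h] := kindQ s.
  - by apply: W => //; apply: Or41.
  - rewrite -!(encC s) -(labelQ_mate s); apply: W => //; last by rewrite mateQK.
    by apply: Or41; have [-> _] := mateQ_hi (or_intror h); rewrite h.
  - by apply: W => //; apply: Or42.
  - rewrite -!(encC s) -(labelQ_mate s); apply: W => //; last by rewrite mateQK.
    by apply: Or42; have [-> _] := mateQ_lo (or_intror h); rewrite h (negbTE v0_lo).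
  - by apply: W => //; apply: Or43.
  - by apply: W => //; apply: Or44.
move=> ps pms; have [pm fm] := kind_mate p.
case: base ps pms => [->|->|h|h] ps pms.
- have [m l] := mateQ_hi (or_introl (erefl (inr hi : node N))).
  have val q : q != inr hi -> q != inl hi -> encloses Q (inr hi) q = far q.
    move=> /pos_neq q1 /pos_neq q2; have [lq fq _] := abs_pos q.
    rewrite /encloses m fq; move: q1 q2; rewrite pos_inr pos_inl.
    clear -lq nN; lia.
  rewrite m in pms; have p2 : mate Q p != inr hi /\ mate Q p != inl hi.
    by rewrite !mateQ_eq m (proj1 (mateQ_hi (or_intror (erefl (inl hi))))).
  rewrite !val ?fm ?(proj1 p2) ?(proj2 p2) //; split=> // fp.
  by have [_ ->] := mateQ_far fp; rewrite l.
- have [m l] := mateQ_lo (or_introl (erefl (inr lo : node N))).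
  rewrite eqxx in m; rewrite m in pms.
  have val q : q != inr lo -> q != v0 -> encloses Q (inr lo) q =
      if plain q then encloses P (inl hi) q else node_pos v0 < n.
    move=> q1 q2; have [lq fq iq] := abs_pos q; have [l0 _ i0] := abs_pos v0.
    move: inner_v0; rewrite /plain q1 q2 /= andbT /encloses m -/v0 pos_inl pos_lo i0 iq.
    move: (pos_neq q1) (pos_neq q2); rewrite pos_lo.
    by clear -lq l0 nN; case: ifP; lia.
  have p2 : mate Q p != inr lo /\ mate Q p != v0.
    rewrite !mateQ_eq m; have [-> _] := mateQ_lo (or_intror (erefl v0)).
    by rewrite (negbTE v0_lo).
  rewrite !val ?pm ?(proj1 p2) ?(proj2 p2) //; case: ifP => pp.
    have [-> ->] := mateQ_plain pp; have /and3P[Ip _ _] := pp.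
    have ph : p != inl hi by rewrite (inner_neq Ip).
    split; first exact: encloses_mate.
    by rewrite l; apply: label_encloses.
  split=> // _; rewrite l; have [h|h|h|h] := kindQ p.
  + by have [_ ->] := mateQ_hi h.
  + by case: h => E; [rewrite E eqxx in ps|rewrite E eqxx in pms].
  + have [_ ->] := mateQ_far h; apply: leq_ltn_trans label_lo _.
    exact: ltnW.
  + by rewrite h in pp.
- have [m l] := mateQ_far h; have [mP lP] := mate_far h.
  have val q : encloses Q s q = encloses P s q by rewrite /encloses m mP.
  rewrite !val l -lP; rewrite m -mP in pms.
  case fp : (far p).
    have [-> ->] := mateQ_far fp; have [<- <-] := mate_far fp.
    by split; [apply: encloses_mate|apply: label_encloses].
  have out q : far q = false -> encloses P s q = false.
    have [lq fq _] := abs_pos q; have [ls fs _] := abs_pos s.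
    have [lo fo _] := abs_pos (opp_node s).
    move: h (h); rewrite -{2}(far_opp s) fs fo fq /encloses mP.
    by clear -lq ls lo; lia.
  by rewrite !out ?fm.
- have [m l] := mateQ_plain h.
  have val q : encloses Q s q = encloses P s q by rewrite /encloses m.
  rewrite !val l; rewrite m in pms.
  case pp : (plain p).
    have [-> ->] := mateQ_plain pp.
    by split; [apply: encloses_mate|apply: label_encloses].
  have /and3P[I n1 n2] := h; have Im := inner_mate I n1 n2.
  have [m1 m2] := mate_plain I n1 n2.
  have mid q q' : ~~ inner q -> ~~ inner q' -> encloses P s q = encloses P s q'.
    by apply: enc_mid; rewrite ?far_plain ?(inner_neq I) ?(inner_neq Im).
  have ih : ~~ inner (inr hi) by rewrite /inner /= ltnn.
  have il : ~~ inner (inl hi) by rewrite /inner /= ltnn.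
  have val2 q : plain q = false -> encloses P s q = encloses P s (inr hi).
    move=> pq; have [E|[->|->]|fq|fq] := kindQ q.
    + by apply: mid => //; case: E => ->.
    + by rewrite -mate_hi encloses_mate // eq_sym ?(inner_neq I) ?(inner_neq Im).
    + rewrite /v0 encloses_mate ?(mid (inl hi) (inr hi)) //; by rewrite eq_sym ?(inner_neq I) ?(inner_neq Im).
    + by apply: mid; rewrite // /inner -ltnNge; apply: ltnW.
    + by rewrite fq in pq.
  rewrite !val2 ?pm //; split=> // e.
  have le : label P s < n.
    by rewrite -label_hi; apply: label_encloses e => //; rewrite eq_sym ?(inner_neq I) ?(inner_neq Im).
  have [E|E|fq|fq] := kindQ p.
  + by have [_ ->] := mateQ_hi E; apply: leqW.
  + have [_ ->] := mateQ_lo E; apply: label_encloses => //; rewrite 1?eq_sym ?(inner_neq I) ?(inner_neq Im) //.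
    by rewrite (mid _ (inr hi)).
  + have [_ ->] := mateQ_far fq; apply: ltn_trans le _; exact: ltnW.
  + by rewrite fq in pp.
Qed.

(** The cap of P at the right nodes n - 1 and n is opened: its lower end is joined to
    the mate v0 of inl n, and n to n.  The nodes fall into the pair of the new
    strand, the pair of the lower end, the far strands and the remaining nodes,
    and each condition is checked on these classes. *)
Lemma okada_unwind : okada_diagram Q.
Proof.
by apply: okada_encloses => // s p ps pms; have [] := encQ ps pms.
Qed.

Definition unwound : odiag N := exist _ Q okada_unwind.

Lemma trivial_unwound : trivial_from n unwound.
Proof.
move=> k; rewrite leq_eqVlt => /orP[/eqP E|lt].
  have -> : k = hi by apply: val_inj; rewrite /= E.
  exact: mateQ_hi (or_introl erefl).
by apply: mateQ_far; rewrite /far /=.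
Qed.

Lemma act_unwound u :
  mate (val (act_letter unwound n)) u = mate P u /\
  label (val (act_letter unwound n)) u = label P u.
Proof.
rewrite (mate_act _ nN) (label_act _ nN) /rewire_mate /rewire_label.
rewrite -[val unwound]/Q /is_cap -[cap_lo nN]/(inr lo) -[cap_hi nN]/(inr hi).
have [mh lh] := mateQ_hi (or_introl (erefl (inr hi : node N))).
have [ml ll] := mateQ_lo (or_introl (erefl (inr lo : node N))); rewrite eqxx in ml.
have lP_lo : label P (inr lo) = n by rewrite -mate_hi label_mate.
have hl : (inr hi == inr lo :> node N) = false by rewrite (inj_eq inr_inj) hi_neq_lo.
have [[->|->]|[->|->]|h|h] := kindQ u.
- by rewrite eqxx orbT other_cap_hi mate_hi label_hi.
- have [-> ->] := mateQ_hi (or_intror (erefl (inl hi : node N))).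
  rewrite /= eqxx orbT other_cap_hi ml ll; split=> //.
  by apply/minn_idPr; apply: leqW; apply: label_lo.
- by rewrite eqxx other_cap_lo mate_lo lP_lo.
- have [-> ->] := mateQ_lo (or_intror (erefl v0)).
  rewrite (negbTE v0_lo) (inner_neq inner_v0) eqxx other_cap_lo mh lh mateK // label_mate //.
  by split=> //; apply/minn_idPl; apply: leqW; apply: label_lo.
- have [-> ->] := mateQ_far h; have [-> ->] := mate_far h.
  have h' : far (opp_node u) by rewrite far_opp.
  by rewrite !(far_neq h) !(far_neq h').
- have [-> ->] := mateQ_plain h; have /and3P[I n1 n2] := h.
  have [m1 _] := mate_plain I n1 n2; have Im := inner_mate I n1 n2.
  by rewrite (negbTE n1) (negbTE m1) !(inner_neq I) !(inner_neq Im).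
Qed.

End Unwinding.

Section Surjectivity.
Variable N : nat.
Implicit Types (D : odiag N) (u : node N) (k : 'I_N).

Lemma odiag_eq D D' : (forall u, mate (val D) u = mate (val D') u) ->
  (forall u, label (val D) u = label (val D') u) -> D = D'.
Proof.
move=> Em El; apply/val_inj/ffunP=> u.
rewrite [LHS]surjective_pairing [RHS]surjective_pairing -!/(mate _ _) -!/(label _ _).
by rewrite Em El.
Qed.

(** An arc other than the cap that starts at the lower node encloses the upper one
    or ends at a smaller absolute value than its label. *)
Lemma cap_of_labels D i (hi : 0 < i < N) : label (val D) (cap_lo hi) = i ->
  label (val D) (cap_hi hi) <= i -> mate (val D) (cap_hi hi) = cap_lo hi.
Proof.
move=> la lb; have okD : okada_diagram (val D) := valP D.
apply/eqP; rewrite -(inj_eq (mate_inj okD)) mateK //; apply/negPn/negP=> nm.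
have [pa pb aa _] := pos_cap hi.
have bl : cap_hi hi != mate (val D) (cap_lo hi) := nm.
have ba : cap_hi hi != cap_lo hi by rewrite eq_sym cap_neq.
have := label_encloses okD ba bl; rewrite la.
have := label_abs_mate okD (cap_lo hi); rewrite la.
have := pos_neq bl; have := mate_neq okD (cap_lo hi) => /pos_neq.
rewrite /encloses pa pb; move: (label _ _) lb (mate _ _) => l lb m.
have := node_pos_lt m; rewrite node_absE; move: (node_pos m) lb (hi) => p; clear; case: ifP; case: (ltnP p); lia.
Qed.
(** With a cap at i, the product by A_(i+1) moves the mate of the next node to the
    lower end of the cap, and the product by A_i brings it back.  The label moved is
    at most i, by parity, and is left unchanged. *)
Lemma split_letter D i (hi : 0 < i < N) (hi1 : 0 < i.+1 < N) :
  label (val D) (cap_lo hi) = i -> label (val D) (cap_hi hi) <= i ->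
  label (val D) (cap_hi hi1) <= i.+1 ->
  D = act_letter (act_letter D i.+1) i.
Proof.
move=> la lb lc; have okD : okada_diagram (val D) := valP D.
set a := cap_lo hi in la; set b := cap_hi hi in lb; set c := cap_hi hi1 in lc.
have bE : cap_lo hi1 = b by congr inr; apply: val_inj.
have mb : mate (val D) b = a by apply: cap_of_labels.
have ma : mate (val D) a = b by have := mateK okD b; rewrite mb.
have lbE : label (val D) b = i by have := label_mate okD b; rewrite mb => <-.
have ab : a != b := cap_neq hi.
have bc : b != c by rewrite -bE cap_neq.
have ac : a != c by rewrite (inj_eq inr_inj) -val_eqE /=; move: (hi); clear; lia.
have lcE : label (val D) c <= i.
  have := odd_label c okD; have := label_abs_mate okD c.
  have mc : mate (val D) c != b by rewrite -ma (inj_eq (mate_inj okD)) eq_sym.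
  have := pos_neq mc; have := mate_positive okD c; rewrite /node_positive.
  have [_ pb _ _] := pos_cap hi; have [_ pc _ _] := pos_cap hi1.
  rewrite -/b in pb; rewrite -/c in pc; rewrite pb pc node_absE.
  have := node_pos_lt (mate (val D) c); move: (node_pos (mate _ _)) => p.
  move: (label _ _) lc (hi1) => l; clear; case: ifP; lia.
have cap1 u : is_cap hi1 u = (u == b) || (u == c) by rewrite /is_cap bE.
have cap0 u : is_cap hi u = (u == a) || (u == b) by [].
have oab : (other_cap hi a = b) * (other_cap hi b = a) by rewrite other_cap_lo other_cap_hi.
have obc : (other_cap hi1 b = c) * (other_cap hi1 c = b) by rewrite -bE other_cap_lo other_cap_hi.
have ba := negbTE ab; rewrite eq_sym in ba; have cb := negbTE bc; rewrite eq_sym in cb.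
have ca := negbTE ac; rewrite eq_sym in ca.
move/negbTE in ab; move/negbTE in bc; move/negbTE in ac.
pose v := mate (val D) c; have mv : mate (val D) v = c by rewrite mateK.
have lv : label (val D) v = label (val D) c by rewrite label_mate.
have va : (v == a) = false by apply/eqP=> E; move: mv; rewrite E ma => /eqP; rewrite bc.
have vb : (v == b) = false by apply/eqP=> E; move: mv; rewrite E mb => /eqP; rewrite ac.
have vc : (v == c) = false by apply/negbTE/mate_neq.
have mcE : mate (val D) c = v by [].
have eqs := (ab, ba, ac, ca, bc, cb, va, vb, vc, ma, mb, mv, mcE, oab, obc, eqxx, cap0, cap1).
set D1 := act_letter D i.+1.
have m1 u := mate_act D hi1 u; have l1 u := label_act D hi1 u.
rewrite -/D1 /rewire_mate /rewire_label in m1 l1.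
have lD : ((label (val D) a = i) * (label (val D) b = i)) by [].
have other u : u != a -> u != b -> u != c -> u != v ->
  [/\ mate (val D1) u = mate (val D) u, label (val D1) u = label (val D) u,
   mate (val D) u != a & mate (val D) u != b].
  move=> /negbTE na /negbTE nb /negbTE nc /negbTE nv.
  have mbu : (mate (val D) u == b) = false by rewrite -ma (inj_eq (mate_inj okD)).
  have mau : (mate (val D) u == a) = false by rewrite -mb (inj_eq (mate_inj okD)).
  have mcu : (mate (val D) u == c) = false by rewrite -mv (inj_eq (mate_inj okD)).
  by rewrite m1 l1 !cap1 nb nc mbu mcu mau.
apply: odiag_eq => u; rewrite ?(mate_act _ hi) ?(label_act _ hi) /rewire_mate /rewire_label;
  rewrite -?/D1.
- have [->|na] := eqVneq u a; first by rewrite ?eqs.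
  have [->|nb] := eqVneq u b; first by rewrite ?eqs.
  have [->|nc] := eqVneq u c; first by rewrite ?m1 ?eqs /= ?eqs.
  have [->|nv] := eqVneq u v; first by rewrite ?m1 ?eqs /= ?eqs.
  have [-> _ n1 n2] := other u na nb nc nv.
  by rewrite !cap0 (negbTE na) (negbTE nb) (negbTE n1) (negbTE n2).
- have [->|na] := eqVneq u a; first by rewrite ?eqs.
  have [->|nb] := eqVneq u b; first by rewrite ?eqs.
  have [->|nc] := eqVneq u c.
    rewrite ?m1 ?l1 ?eqs /= ?eqs; move: lcE la => /= h ->; move: h; move: (label _ c) => l; clear; lia.
  have [->|nv] := eqVneq u v.
    rewrite ?m1 ?l1 ?eqs /= ?eqs /= lv lbE; move: lcE => /=; move: (label _ c) => l; clear; lia.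
  have [-> -> n1 n2] := other u na nb nc nv.
  by rewrite !cap0 (negbTE na) (negbTE nb) (negbTE n1) (negbTE n2).
Qed.

Lemma trivial_fromS n D k : trivial_from n.+1 D -> k = n :> nat ->
  label (val D) (inr k) = k.+1 -> trivial_from n D.
Proof.
move=> tD kn lk j; rewrite leq_eqVlt => /orP[/eqP jn|]; last exact: tD.
have -> : j = k by apply: val_inj; rewrite /= -jn kn.
split=> //; have okD : okada_diagram (val D) := valP D.
have mk := mate_neq okD (inr k); have := label_abs_mate okD (inr k); rewrite lk.
have far (h : 'I_N) : n < h -> mate (val D) (inr k) != inl h /\ mate (val D) (inr k) != inr h.
  move=> nh; have [mh _] := tD h nh.
  have E : mate (val D) (inl h) = inr h by rewrite -mh mateK.
  split; apply/eqP=> Ek; have := mateK okD (inr k); rewrite Ek ?E ?mh // => -[hk].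
  by move: nh; rewrite hk kn ltnn.
case: (mate _ _) mk far => h mk far lh; have [hn|nh|E] := ltngtP n h.
- by have [/eqP] := far h hn.
- by move: lh nh; rewrite /= kn; clear; lia.
- by congr inl; apply: val_inj; rewrite /= -E kn.
- by have [_ /eqP] := far h hn.
- by move: lh nh; rewrite /= kn; clear; lia.
- by case/eqP: mk; congr inr; apply: val_inj; rewrite /= -E kn.
Qed.

(** The inverse of appending a block: a cap at the peak allows to split off letters
    until the cap is at the right nodes n - 1 and n, where it is opened. *)
Lemma pull_block n b D : b <= n < N -> trivial_from n.+1 D -> peak n b D ->
  exists D', trivial_from n D' /\ D = act D' (block n b).
Proof.
elim: b D => [|b IH] D hb tD pD.
  have nN : n < N by case/andP: hb.
  exists D; split=> //; apply: (trivial_fromS (k := Ordinal nN)) => //.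
  by have [-> //] := pD (Ordinal nN); rewrite subn0.
have hi0 : 0 < n - b < N by lia.
have [lo_lab _] := pD (lo hi0); have [_ hi_lab] := pD (hi hi0).
have {lo_lab} la : label (val D) (cap_lo hi0) = n - b.
  by rewrite lo_lab /=; clear -hb hi0; lia.
have {hi_lab} lb : label (val D) (cap_hi hi0) <= n - b.
  by apply: hi_lab => /=; clear -hb hi0; lia.
case: b hb pD hi0 la lb IH => [|b] hb pD hi0 la lb IH.
  rewrite subn0 in hi0 la lb.
  have mh := cap_of_labels la lb.
  have lh : label (val D) (cap_hi hi0) = n.
    by have := label_mate (valP D) (cap_hi hi0); rewrite mh la => <-.
  have okD : okada_diagram (val D) := valP D.
  exists (unwound okD tD mh lh); split; first exact: trivial_unwound.
  rewrite block1; apply: odiag_eq => u; rewrite [act _ _]/=.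
    by rewrite (proj1 (act_unwound _ _ _ _ _)).
  by rewrite (proj2 (act_unwound _ _ _ _ _)).
have hi1 : 0 < (n - b.+1).+1 < N by lia.
have lc : label (val D) (cap_hi hi1) <= (n - b.+1).+1.
  have [_ /=] := pD (hi hi1); apply; clear -hb; lia.
have E := split_letter la lb lc.
have i1 : (n - b.+1).+1 = n - b by lia.
have {hi1 lc} hi1 : 0 < n - b < N by rewrite -i1.
rewrite i1 in E; set D1 := act_letter D (n - b) in E.
have [|||D' [tD' DE]] := IH D1; first by lia.
- by apply: trivial_act => //; clear -hb; lia.
- move=> k; split=> [kE|kE].
    have ck : is_cap hi1 (inr k) by rewrite is_cap_inr kE -i1 eqxx.
    by rewrite (label_act _ hi1) /rewire_label ck kE -i1.
  have [kn|nk] := eqVneq (k : nat) (n - b).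
    have ck : is_cap hi1 (inr k) by rewrite is_cap_inr kn eqxx orbT.
    by rewrite (label_act _ hi1) /rewire_label ck kn.
  have ck : ~~ is_cap hi1 (inr k) by rewrite is_cap_inr negb_or nk andbT; clear -kE hb; lia.
  apply: leq_trans (label_act_le D ck) _.
  by have [_] := pD k; apply; clear -kE hb; lia.
- exists D'; split=> //.
  by rewrite blockS act_rcons -DE; exact: E.
Qed.

Lemma trivial_from0 D : trivial_from 0 D -> D = one_odiag N.
Proof.
move=> tD; have okD : okada_diagram (val D) := valP D.
have mE k : mate (val D) (inl k) = inr k by have [<- _] := tD k isT; rewrite mateK.
apply: odiag_eq => -[k|k]; rewrite ?mate1 ?label1 ?mE //.
- by have [] := tD k isT.
- by rewrite -(label_mate okD) mE; have [] := tD k isT.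
- by have [] := tD k isT.
Qed.

Lemma peak_exists n D : n < N -> exists2 b, b <= n & peak n b D.
Proof.
move=> nN; have okD : okada_diagram (val D) := valP D.
(* The candidates for the peak; 0 is one, because its label can only be 1. *)
pose top (q : nat) := (q <= n) && [exists j : 'I_N, (j == q :> nat) && (label (val D) (inr j) == q.+1)].
have top0 : exists q, top q.
  exists 0; have N0 : 0 < N by apply: leq_ltn_trans nN.
  rewrite /top /=; apply/existsP; exists (Ordinal N0); rewrite eqxx /= eqn_leq.
  by rewrite label_gt0 // andbT; apply: (label_abs okD (inr _)).
have bnd q : top q -> q <= n by case/andP.
case: (ex_maxnP top0 bnd) => q /andP[qn /existsP[j /andP[/eqP jq /eqP lj]]] qmax.
exists (n - q); first exact: leq_subr.
move=> k; rewrite subKn //; split=> [kq|/andP[qk kn]].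
  have -> : k = j by apply: val_inj; rewrite /= kq jq.
  by rewrite lj jq.
rewrite -ltnS ltn_neqAle (label_abs okD (inr k)) andbT.
apply: contraL qk => lk; rewrite -leqNgt; apply: qmax.
by rewrite /top kn; apply/existsP; exists k; rewrite eqxx.
Qed.

Lemma diag_surj n D : n <= N -> trivial_from n D ->
  exists2 c, is_code c & D = diag N (normal_word c n).
Proof.
elim: n D => [|n IH] D nN tD; first by exists (fun=> 0); last exact: trivial_from0.
have [b bn pD] := peak_exists D nN.
have [|D' [tD' ->]] := pull_block _ tD pD; first by rewrite bn.
have [c cc ->] := IH _ (ltnW nN) tD'.
exists (fun j => if j == n then b else c j) => [j|]; first by case: eqP => [->|_].
rewrite normal_wordS eqxx /diag act_cat.
by rewrite (@eq_normal_word (fun j => if j == n then b else c j) c) // => j jn; rewrite ltn_eqF.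
Qed.

Lemma diag_normal_surj D : exists2 c, is_code c & D = diag N (normal_word c N).
Proof. by apply: diag_surj => // k; rewrite leqNgt ltn_ord. Qed.

End Surjectivity.

(** * Permutations and codes *)

Section Codes.
Variable N : nat.
Implicit Types (s t : 'S_N) (i j k : 'I_N).

Lemma widen_ord_inj m n (mn : m <= n) : injective (widen_ord mn).
Proof. by move=> u v /(congr1 (@nat_of_ord n)) E; apply: val_inj. Qed.

Lemma inv_code_le s i : inv_code s i <= i.
Proof.
have lt : [set k : 'I_N | (k < i)%N && (s^-1%g i < s^-1%g k)%N] \subset [set k : 'I_N | k < i].
  by apply/subsetP=> k; rewrite !inE => /andP[].
apply: leq_trans (subset_leq_card lt) _; apply: eq_leq.
have iN : i <= N by apply: ltnW.
rewrite -[RHS]card_ord -(card_image (f := widen_ord iN)); last exact: widen_ord_inj.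
apply: eq_card => k; rewrite !inE; apply/idP/imageP => [ki|[h _ ->]]; last exact: (ltn_ord h).
by exists (Ordinal ki) => //; apply: val_inj.
Qed.

Lemma perm_val_card (p : 'S_N) i : #|[set k | p k < p i]| = p i.
Proof.
have iN : p i <= N by apply: ltnW.
rewrite -[RHS]card_ord -(card_image (f := fun h => (p^-1)%g (widen_ord iN h))); last first.
  by move=> u v /perm_inj /widen_ord_inj.
apply: eq_card => k; rewrite !inE; apply/idP/imageP => [ki|[h _ ->]].
  by exists (Ordinal ki) => //; rewrite -[k in LHS](permK p); congr (_ _); apply: val_inj.
by rewrite permKV; apply: (ltn_ord h).
Qed.

(** The code recovers the relative order of the values of the inverse permutation:
    for i the largest index, the k < i with larger value form an upper set of a
    known order, and upper sets of the same cardinal are equal. *)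
Lemma inv_code_inj s t : inv_code s =1 inv_code t -> s = t.
Proof.
move=> E; set p := (s^-1)%g; set q := (t^-1)%g.
suff H n i j : i < n -> j < n -> (p i < p j) = (q i < q j).
  suff pq : p = q by rewrite -(invgK s) -/p pq invgK.
  apply/permP=> i; apply: val_inj; rewrite /= -[LHS]perm_val_card -[RHS]perm_val_card.
  by apply: eq_card => k; rewrite !inE; apply: (H N).
elim: n i j => // n IH.
have step i j : i = n :> nat -> j < n -> (p i < p j) = (q i < q j).
  move=> Ei jn; pose U (r : 'S_N) := [set k : 'I_N | (k < i)%N && (r i < r k)%N].
  (* Otherwise k and h would be ordered differently by p and q. *)
  have up : (U p \subset U q) || (U q \subset U p).
    apply/negPn/negP; rewrite negb_or => /andP[/subsetPn[k + kq] /subsetPn[h + hp]].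
    move: kq hp; rewrite !inE => + + /andP[ki pk] /andP[hi qh].
    rewrite ki hi /= -!leqNgt => qk ph.
    have : p h < p k by apply: leq_ltn_trans pk.
    have : q k < q h by apply: leq_ltn_trans qh.
    by rewrite -IH -?Ei // => /ltn_trans l /l; rewrite ltnn.
  have cU : #|U p| = #|U q| by apply: E.
  have eU : U p = U q.
    by case/orP: up => sub; [|apply/esym]; apply/eqP; rewrite eqEcard sub cU leqnn.
  by move/setP: eU => /(_ j); rewrite !inE Ei jn.
have neq (r : 'S_N) i j : i != j -> (r i < r j) = ~~ (r j < r i).
  move=> ij; rewrite -leqNgt ltn_neqAle andb_idl // => _.
  by apply: contra ij => /eqP/val_inj/perm_inj ->.
move=> i j; rewrite !ltnS leq_eqVlt (leq_eqVlt j) => /orP[/eqP Ei|li] /orP[/eqP Ej|lj].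
- by have -> : i = j by [apply: val_inj; rewrite /= Ei Ej]; rewrite !ltnn.
- exact: step.
- have ij : i != j by apply/eqP=> h; rewrite h Ej ltnn in li.
  by rewrite !(neq _ _ _ ij) step.
- exact: IH.
Qed.

Definition code_of s n := if insub n is Some i then inv_code s i else 0.

Lemma code_ofE s i : code_of s i = inv_code s i.
Proof. by rewrite /code_of valK. Qed.

Lemma code_of_code s : is_code (code_of s).
Proof. by move=> n; rewrite /code_of; case: insubP => // i _ <-; apply: inv_code_le. Qed.

(** There are as many codes as permutations, namely 1 * 2 * ... * N. *)
Lemma code_surj (c : nat -> nat) : is_code c -> exists s, forall h : nat, h < N -> code_of s h = c h.
Proof.
move=> cc; pose F i := [pred j : 'I_N | j <= i].
pose f s : {ffun 'I_N -> 'I_N} := [ffun i => insubd i (inv_code s i)].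
have fE s i : f s i = inv_code s i :> nat.
  by rewrite ffunE val_insubd (leq_ltn_trans (inv_code_le s i)).
have finj : injective f.
  by move=> s t E; apply: inv_code_inj => i; rewrite -!fE E.
have sub : codom f \subset family F.
  by apply/subsetP=> g /codomP[s ->]; apply/familyP=> i; rewrite inE fE inv_code_le.
have card : #|codom f| = #|family F|.
  rewrite card_codom // card_Sn card_family foldrE big_map big_enum /=.
  rewrite fact_prod big_add1 big_mkord; apply: eq_bigr => i _.
  have iN : i.+1 <= N by [].
  rewrite -[LHS]card_ord -(card_image (f := widen_ord iN)); last exact: widen_ord_inj.
  apply: eq_card => k; rewrite ?inE; apply/imageP/idP => [[h _ ->]|ki]; first exact: (ltn_ord h).
  by exists (Ordinal (ki : k < i.+1)) => //; apply: val_inj.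
have /codomP[s fs] : [ffun i : 'I_N => insubd i (c i)] \in codom f.
  rewrite (subset_cardP card sub); apply/familyP=> i.
  by rewrite !inE ffunE val_insubd (leq_ltn_trans (cc i)) // cc.
exists s => i iN; have -> : code_of s i = f s (Ordinal iN) by rewrite fE -code_ofE.
by rewrite -fs ffunE val_insubd (leq_ltn_trans (cc _)).
Qed.

Definition perm_word s := normal_word (code_of s) N.

Lemma perm_prodE (T : Type) (one : T) mul g s : perm_prod one mul g s =
  \big[mul/one]_(i <- iota 0 N) \big[mul/one]_(k <- iota 0 (code_of s i)) g (i - k).
Proof.
have iotaE n : iota 0 n = index_iota 0 n by rewrite /index_iota subn0.
rewrite /perm_prod [in RHS]iotaE big_mkord; apply: eq_bigr => i _.
by rewrite code_ofE iotaE big_mkord.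
Qed.

Lemma E_permE (K : fieldType) (X : N.-1.-tuple K) (Y : N.-2.-tuple K) s :
  E_perm X Y s = word_prod (okada_gen X Y) (perm_word s).
Proof.
rewrite /E_perm perm_prodE /word_prod big_flatten big_map; apply: eq_bigr => i _.
by rewrite big_map.
Qed.

(** Products of diagrams are associative on Okada diagrams only, so that products
    are compared with concatenated words from right to left. *)
Lemma big_diag (I : eqType) (r : seq I) (f : I -> diagram N) (w : I -> seq nat) :
  (forall z, z \in r -> letters N (w z) /\ f z = val (diag N (w z))) ->
  letters N (flatten [seq w z | z <- r]) /\
  \big[@diagram_mul N/diagram1 N]_(z <- r) f z = val (diag N (flatten [seq w z | z <- r])).
Proof.
elim: r => [|i r IH] h; first by rewrite big_nil.
have [li fi] := h i (mem_head i r).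
have [j jr|lr fr] := IH; first by apply: h; rewrite inE jr orbT.
by rewrite big_cons /= letters_cat li lr diag_cat // -fi fr.
Qed.

Lemma A_permE s : A_perm s = val (diag N (perm_word s)).
Proof.
rewrite /A_perm perm_prodE; apply: (proj2 (big_diag _)) => i; rewrite mem_iota => /andP[_ iN].
have lb : small i.+1 (block i (code_of s i)) := small_block (code_of_code s i).
split; first exact: small_letters lb.
have -> : block i (code_of s i) = flatten [seq [:: i - k] | k : nat <- iota 0 (code_of s i)].
  by rewrite /block; elim: (iota _ _) => //= k r ->.
apply: (proj2 (big_diag _)) => k kr.
have /andP[ik0 ikN] : 0 < i - k < N.
  have : i - k \in block i (code_of s i) by apply: map_f.
  by move/(allP lb); lia.
by rewrite /letters /= ik0 ikN diag1E ?val_gen // ik0.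
Qed.

Lemma A_perm_inj : injective (@A_perm N).
Proof.
move=> s t; rewrite !A_permE => /val_inj /diag_normal_inj H.
apply: inv_code_inj => i; rewrite -!code_ofE.
by apply: (H (code_of_code s) (code_of_code t)).
Qed.

Lemma E_diagramE (K : fieldType) (X : N.-1.-tuple K) (Y : N.-2.-tuple K) c : is_code c ->
  E_diagram X Y (val (diag N (normal_word c N))) =
  word_prod (okada_gen X Y) (normal_word c N).
Proof.
move=> cc; have [s sc] := code_surj cc.
have Es : A_perm s = val (diag N (normal_word c N)).
  by rewrite A_permE /perm_word (eq_normal_word sc).
rewrite /E_diagram; case: pickP => [t /eqP|/(_ s)]; last by rewrite Es eqxx.
by rewrite -Es => /A_perm_inj ->; rewrite E_permE /perm_word (eq_normal_word sc).
Qed.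

End Codes.

(** * Reversal of strands *)

Section Reversal.
Variable G : tangle.
Local Notation nxt := (@nxt G).
Implicit Types e f : G.

Lemma orbit_opp e f : f \in orbit nxt e -> opp f \in orbit nxt (opp e).
Proof.
rewrite -fconnect_orbit => /iter_findex <-; elim: (findex _ _ _) => [|i IH]; first exact: in_orbit.
set g := iter i nxt e in IH *; rewrite -[iter _ _ _]/(nxt g).
have E : nxt (opp (nxt g)) = opp g by rewrite nxt_opp /nxt gluK.
rewrite -fconnect_orbit in IH; rewrite -fconnect_orbit; apply: (connect_trans IH).
by rewrite (fconnect_sym (@nxt_inj G)) -E fconnect1.
Qed.

Lemma loop_opp e : loop (opp e) = loop e.
Proof.
wlog le : e / loop e.
  move=> W; case le : (loop e); first by rewrite W.
  by apply: contraFF le => lo; rewrite -[e]oppK W.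
rewrite le; apply/hasPn=> f fe; apply/negP=> ef.
have := loop_halts le (f := opp f); rewrite /halts oppK ef => H.
by have := H _; rewrite -[e]oppK orbit_opp // => /(_ isT).
Qed.

(** The loop or path through e traversed backwards; it starts at glu e because the
    arc of e then comes last. *)
Lemma rev_orbit e : orbit nxt (glu e) = map opp (rev (orbit nxt e)).
Proof.
have [p Ep] : exists p, orbit nxt e = rcons (belast e (behead (orbit nxt e))) p.
  by exists (last e (behead (orbit nxt e))); rewrite -lastI -orbit_head.
have cyc := cycle_orbit (@nxt_inj G) e.
have El : nxt p = e.
  move: cyc; rewrite {1}orbit_head /= rcons_path => /andP[_ /eqP <-].
  by move: Ep; rewrite {1}orbit_head lastI => /rcons_inj[<-].
have pE : opp p = glu e by rewrite -El /nxt gluK.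
have hd : map opp (rev (orbit nxt e)) = glu e :: behead (map opp (rev (orbit nxt e))).
  by rewrite Ep rev_rcons /= pE.
have uq : uniq (map opp (rev (orbit nxt e))).
  by rewrite (map_inj_uniq (can_inj (@oppK G))) rev_uniq orbit_uniq.
rewrite hd; apply: orbit_cons; last by move: uq; rewrite {1}hd => /andP[].
rewrite -hd cycle_map rev_cycle.
apply: sub_cycle cyc => f g /= /eqP <-.
by rewrite nxt_opp /nxt gluK.
Qed.

Lemma opp_orbit_glu e : opp e \in orbit nxt (glu e).
Proof. by rewrite orbit_sym -nxt_opp mem_orbit // in_orbit. Qed.

Lemma loop_low_opp e : loop_low (opp e) = loop_low e.
Proof.
suff le f : loop_low f <= loop_low (opp f).
  by apply/eqP; rewrite eqn_leq le andbT; have := le (opp e); rewrite oppK.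
have := leqnn (loop_low f); rewrite {2}/loop_low leq_low => /andP[_ /allP h].
rewrite leq_low tlab_opp h ?in_orbit //=; apply/allP=> g gf.
by rewrite -tlab_opp h // -[f]oppK orbit_opp.
Qed.

Lemma loop_evens_opp e : perm_eq (loop_evens (opp e)) (loop_evens e).
Proof.
rewrite perm_sym -(permPr (loop_evens_orbit (opp_orbit_glu e))) perm_sym.
rewrite /loop_evens rev_orbit -rflip_word tabs_glu; have [lev up] := loop_word e.
exact: cyclic_evens_rflip (above_le (leq0n _) up) lev.
Qed.

Section Weight.
Variables (K : fieldType) (x y : nat -> K).

Lemma loop_weight_opp e : loop_weight x y (opp e) = loop_weight x y e.
Proof. by rewrite /loop_weight /evens_weight loop_low_opp (perm_big _ (loop_evens_opp e)). Qed.

End Weight.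

Lemma strand_low_target e : exposed e -> strand_low (target e) = strand_low e.
Proof.
suff le f : exposed f -> strand_low f <= strand_low (target f).
  move=> fe; apply/eqP; rewrite eqn_leq le // andbT.
  by have := le _ (target_exposed fe); rewrite targetK.
move=> ff; have R := chain_exposed ff.
have := leqnn (strand_low f); rewrite {2}/strand_low leq_low => /andP[_ /allP h].
rewrite leq_low; apply/andP; split.
  by rewrite /target tlab_opp h // (route_cons R) /= mem_last.
rewrite chain_target // all_map all_rev; apply/allP=> g /h.
by rewrite /= tlab_opp.
Qed.

(** The weight of a path does not depend on its direction. *)
Lemma tidy_strand_evens e : tidy G -> exposed e ->
  perm_eq (strand_evens (target e)) (strand_evens e).
Proof.
move=> tG fe; have ft := target_exposed fe; have R := chain_exposed fe.
have T := tG _ fe; have T' := tG _ ft; rewrite targetK // in T'.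
have up : above (strand_low e) (tabs e) (word (chain e)).
  have [] // := @path_word G (strand_low e) e (behead (chain e)) (route_path R).
    by have := leqnn (strand_low e); rewrite {2}/strand_low leq_low => /andP[_]; rewrite {1}(route_cons R).
  by rewrite -(route_cons R).
have le1 : strand_low e <= tabs e := above_start up.
have lt : strand_low (target e) = strand_low e := strand_low_target fe.
have le2 : strand_low e <= tabs (target e).
  rewrite -lt; apply: leq_trans (tlab_abs _).
  by have := leqnn (strand_low (target e)); rewrite {2}/strand_low leq_low => /andP[].
rewrite lt in T'; rewrite /strand_evens chain_target // -rflip_word.
apply: (evens_reverse le1 le2 up T).
by move: T'; rewrite /strand_evens chain_target // -rflip_word.
Qed.

End Reversal.

(** Two transversals of a fixed-point free involution give the same product. *)
Lemma big_involution (T : finType) (R : Type) (one : R) (op : Monoid.com_law one)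
    (f : T -> T) (A B : pred T) (F : T -> R) : involutive f ->
  (forall u, A (f u) = ~~ A u) -> (forall u, B (f u) = ~~ B u) ->
  (forall u, F (f u) = F u) -> \big[op/one]_(u | A u) F u = \big[op/one]_(u | B u) F u.
Proof.
move=> fK fA fB fF; rewrite (bigID B) [RHS](bigID A) /=; congr (op _ _).
  by apply: eq_bigl => u; rewrite andbC.
rewrite (reindex_inj (can_inj fK)) /=; apply: eq_big => u //.
by rewrite fA fB negbK andbC.
Qed.

(** * The walks of a composition *)

Section Walks.
Variables (N : nat) (C D : odiag N).
Local Notation C' := (val C).
Local Notation D' := (val D).
Local Notation G := (composite C D).
Local Notation nxt := (@nxt G).
Implicit Types (e f : G) (u v : node N).

(** Every diagram is a product of generators. *)
Lemma tidy_odiag : tidy G.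
Proof.
have [c cc ->] := diag_normal_surj D.
by apply: tidy_diag; apply: small_letters (small_normal _ cc).
Qed.

Lemma path_lastK : involutive (path_last C' D').
Proof.
by move=> u; rewrite path_lastE outer_end_path_last targetK ?exposed_outer_end // outer_endK.
Qed.

Lemma positive_path_last u : node_positive (path_last C' D' u) = ~~ node_positive u.
Proof.
have := positive_target (exposed_outer_end C D u); rewrite -outer_end_path_last.
by rewrite /positive /= /end_positive !outer_endK.
Qed.

Lemma starts_beforeC u v : u != v -> starts_before v u = ~~ starts_before u v.
Proof.
by case: u v => i [] j //= ij; rewrite -leqNgt ltn_neqAle andb_idl // => _;
  apply: contra ij => /eqP/val_inj ->.
Qed.

Lemma path_walk_even_steps (K : fieldType) (y : nat -> K) u :
  (\prod_(p < size (walk_word (path_walk C' D' u)) | paired_evenly (path_walk C' D' u) p)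
     y (height (path_walk C' D' u) p) = evens_weight y (strand_evens (outer_end u : G)))%R.
Proof.
have fe := exposed_outer_end C D u; have R := chain_exposed fe.
rewrite /path_walk /walk_word /=.
have tu : tabs (outer_end u : G) = node_abs u by rewrite /tabs /= /end_abs outer_endK.
rewrite path_endsE -[flatten _]/(word (chain (outer_end u : G))) -tu.
rewrite even_steps_prod //.
have [] // := @path_word G 0 (outer_end u) (behead (chain (outer_end u : G))) (route_path R).
  exact/allP.
by rewrite -(route_cons R).
Qed.

Section Weight.
Variables (K : fieldType) (x y : nat -> K).
Local Open Scope ring_scope.

Definition even_steps (W : walk) : K :=
  \prod_(p < size (walk_word W) | paired_evenly W p) y (height W p).

(** The leftmost and lowest end and the positive end are two transversals of the
    involution that exchanges the ends of the paths. *)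
Lemma prod_path_walks : \prod_(W <- path_walks C' D') even_steps W =
  \prod_(s : G | positive s && exposed s) evens_weight y (strand_evens s).
Proof.
rewrite prod_exposed big_map big_filter big_enum_cond /=.
pose F u := evens_weight y (strand_evens (outer_end u : G)).
rewrite (eq_bigr F) => [|u _]; last exact: path_walk_even_steps.
have neq u : u != path_last C' D' u.
  by apply/eqP=> E; have := positive_path_last u; rewrite -E; case: node_positive.
apply: (big_involution _ path_lastK) => u.
- by rewrite path_lastK starts_beforeC.
- exact: positive_path_last.
- rewrite /F outer_end_path_last /evens_weight; apply: perm_big.
  exact: tidy_strand_evens tidy_odiag (exposed_outer_end C D u).
Qed.

Lemma on_loopE e : on_loop C' D' e = loop e.
Proof.
by rewrite /on_loop /loop -all_predC; apply: eq_all => f; rewrite /= exposedE.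
Qed.

Lemma loop_labelE e : loop_label C' D' e = loop_low (e : G).
Proof. by []. Qed.

Lemma loop_startP e : is_loop_start C' D' e -> loop e /\ tlab e = loop_low e.
Proof. by case/and3P=> le /eqP E _; rewrite -on_loopE. Qed.

(** The walk of a loop starts in the middle of its first arc, at the lowest level:
    it is a rotation of the word of the loop. *)
Lemma loop_walk_even_steps e : is_loop_start C' D' e ->
  even_steps (loop_walk C' D' e) = evens_weight y (loop_evens e).
Proof.
move=> /loop_startP[le ll]; rewrite /even_steps /loop_walk loop_labelE /walk_word /=.
set l := loop_low (e : G); set p := nseq _ false; set q := nseq _ true ++ _.
have Ew : word (orbit nxt e) = p ++ (nseq (tabs (opp e) - tlab e) true ++
    word (behead (orbit nxt e))).
  by rewrite {1}orbit_head word_cons /arcw /dive -catA.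
have Eq : nseq (tabs (opp e) - tlab e) true ++ word (behead (orbit nxt e)) ++ p = q.
  by [].
rewrite -Eq catA; move: Ew; set q' := nseq _ true ++ _ => Ew.
have [lev up] := loop_word e; rewrite Ew level_cat above_cat -/l in lev up.
have lp : level (tabs e) p = l.
  by rewrite /p level_down /l -ll; apply: subKn; apply: (tlab_abs e).
rewrite lp in lev up; case/andP: up => up uq.
rewrite even_steps_prod; last first.
  by rewrite above_cat (above_le _ uq) // lev (above_le _ up).
rewrite /evens_weight /loop_evens Ew; apply/esym/perm_big.
exact: cyclic_evens_rot.
Qed.

End Weight.

(** The ends of the strand through e, in both directions. *)
Definition near e f := (f \in orbit nxt e) || (opp f \in orbit nxt e).

Lemma near_refl e : near e e.
Proof. by rewrite /near in_orbit. Qed.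

Lemma near_opp e f : near e (opp f) = near e f.
Proof. by rewrite /near oppK orbC. Qed.

Lemma opp_near e f : near (opp e) f = near e f.
Proof.
suff H e' f' : near e' f' -> near (opp e') f'.
  by apply/idP/idP=> /H //; rewrite oppK.
rewrite /near => /orP[/orbit_opp->|/orbit_opp]; rewrite ?orbT //.
by rewrite oppK => ->.
Qed.

Lemma near_sym e f : near e f = near f e.
Proof.
suff H e' f' : near e' f' -> near f' e' by apply/idP/idP; apply: H.
case/orP=> [ef|ef]; first by rewrite /near orbit_sym ef.
by rewrite -opp_near /near orbit_sym ef.
Qed.

Lemma near_trans e f g : near e f -> near f g -> near e g.
Proof.
case/orP=> /orbit_eq E; last rewrite -opp_near.
  by rewrite /near !E.
by rewrite /near !E.
Qed.

Lemma near_low e f : near e f -> loop_low f = loop_low e.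
Proof. by case/orP=> /loop_low_orbit ->; rewrite ?loop_low_opp. Qed.

Lemma near_loop e f : near e f -> loop f = loop e.
Proof. by case/orP=> /loop_orbit <-; rewrite ?loop_opp. Qed.

Lemma low_near e f : near e f -> loop_low e <= tlab f.
Proof.
move=> ef; rewrite -(near_low ef).
by have := leqnn (loop_low f); rewrite {2}/loop_low leq_low => /andP[].
Qed.

Lemma low_attained e : exists2 f, f \in orbit nxt e & tlab f = loop_low e.
Proof.
suff /hasP[f fe /eqP E] : has (fun f => tlab f == loop_low e) (orbit nxt e) by exists f.
apply: contraT => /hasPn no.
have lt f : f \in orbit nxt e -> loop_low e < tlab f.
  move=> fe; rewrite ltn_neqAle eq_sym no //= low_near //.
  by rewrite /near fe.
have := ltnn (loop_low e); rewrite {2}/loop_low leq_low lt ?in_orbit //=.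
by move/negbT/negP; case; apply/allP=> f /lt.
Qed.

Lemma in_left_opp e : in_left (opp e) = in_left e.
Proof. by case: e. Qed.

Lemma arc_max_opp e : arc_max C' D' (opp e) = arc_max C' D' e.
Proof. by rewrite /arc_max -[other_end _ _ (opp e)]/(opp (opp e)) oppK maxnC. Qed.

Lemma arc_min_opp e : arc_min C' D' (opp e) = arc_min C' D' e.
Proof. by rewrite /arc_min -[other_end _ _ (opp e)]/(opp (opp e)) oppK minnC. Qed.

Lemma loop_abs_inj e f : loop e -> loop f -> in_left e = in_left f -> tabs e = tabs f -> e = f.
Proof.
move=> /(contraL (@exposed_nloop G e)) + /(contraL (@exposed_nloop G f)).
rewrite !exposedE; case: e f => [[i|i]|[i|i]] [[j|j]|[j|j]] //= _ _ _ [/val_inj ->] //.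
Qed.

Lemma loop_abs_neq e : loop e -> tabs (opp e) != tabs e.
Proof.
move=> le; apply/eqP=> E; have : opp e = e.
  by apply: loop_abs_inj => //; rewrite ?loop_opp // in_left_opp.
by move=> Eo; have := positive_opp e; rewrite Eo; case: positive.
Qed.

Definition lowest e f := tlab f == loop_low e.

Lemma all_near e (P : pred G) : (forall f, P (opp f) = P f) ->
  all P (orbit nxt e) = [forall f, near e f ==> P f].
Proof.
move=> PC; apply/allP/forallP => [h f|h f fe].
  by apply/implyP=> /orP[/h //|/h]; rewrite PC.
by apply: (implyP (h f)); rewrite /near fe.
Qed.

(** The conditions that select the starting arc do not distinguish the two ends of
    an arc, so that they can be read on the loop without orientation. *)
Lemma loop_startE e : is_loop_start C' D' e =
  [&& loop e, lowest e e &
    if in_left e then (tabs (opp e) < tabs e) &&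
      [forall f, near e f ==> (in_left f && lowest e f ==> (arc_max C' D' f <= arc_max C' D' e))]
    else [&& tabs e < tabs (opp e), [forall f, near e f ==> ~~ (in_left f && lowest e f)] &
      [forall f, near e f ==> (lowest e f ==> (arc_min C' D' e <= arc_min C' D' f))]]].
Proof.
rewrite /is_loop_start on_loopE loop_labelE; congr [&& _, _ & _].
by rewrite -all_predC -!all_near // => f;
  rewrite /= /lowest ?tlab_opp ?in_left_opp ?arc_min_opp ?arc_max_opp.
Qed.

(** An inner end is determined by its side and its absolute value. *)
Lemma loop_start_uniq e f : is_loop_start C' D' e -> is_loop_start C' D' f -> near e f -> e = f.
Proof.
rewrite !loop_startE => /and3P[le loe +] /and3P[lf lof +] ef.
have fe : near f e by rewrite near_sym.
have lowE g : lowest f g = lowest e g by rewrite /lowest (near_low ef).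
have maxE (g : G) : tabs (opp g) < tabs g -> arc_max C' D' g = tabs g by move=> /ltnW/maxn_idPl.
have minE (g : G) : tabs g < tabs (opp g) -> arc_min C' D' g = tabs g by move=> /ltnW/minn_idPl.
case Ee : (in_left e); case Ef : (in_left f).
- case/andP=> /maxE e1 /forallP/(_ f) + /andP[/maxE f1 /forallP/(_ e)].
  rewrite ef fe Ee Ef lowE -lowE loe lof e1 f1 /= => l1 l2.
  by apply: loop_abs_inj; rewrite ?Ee ?Ef //; apply/eqP; rewrite eqn_leq l1 l2.
- by case/andP=> _ _ /and3P[_ /forallP/(_ e)]; rewrite fe Ee lowE loe.
- by case/and3P=> _ /forallP/(_ f) + _ _; rewrite ef Ef -lowE lof.
- case/and3P=> /minE e1 _ /forallP/(_ f) + /and3P[/minE f1 _ /forallP/(_ e)].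
  rewrite ef fe lowE -lowE loe lof e1 f1 /= => l1 l2.
  by apply: loop_abs_inj; rewrite ?Ee ?Ef //; apply/eqP; rewrite eqn_leq l1 l2.
Qed.

Lemma loop_start_exists s : loop s -> exists2 e : G, is_loop_start C' D' e & near s e.
Proof.
move=> ls; have lowE e g : near s e -> lowest e g = lowest s g.
  by move=> se; rewrite /lowest (near_low se).
pose P f := [&& near s f, in_left f & lowest s f].
have [f0 Pf0|noP] := pickP P.
  case: (@arg_maxnP G f0 P (arc_max C' D') Pf0) => e0 /and3P[se0 le0 loe0] emax.
  have {se0 le0 loe0 emax} [e [se le loe lt emax]] : exists e, [/\ near s e, in_left e,
      lowest s e, tabs (opp e) < tabs e & forall f, P f -> arc_max C' D' f <= arc_max C' D' e].
    have ls0 : loop e0 by rewrite (near_loop se0).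
    case: (ltngtP (tabs (opp e0)) (tabs e0)) (loop_abs_neq ls0) => // lt _.
      by exists e0; split=> // f /emax.
    exists (opp e0); rewrite near_opp in_left_opp /lowest tlab_opp oppK; split=> // f /emax.
    by rewrite arc_max_opp.
  exists e => //; rewrite loop_startE (near_loop se) ls lowE // loe le lt /=.
  apply/forallP=> f; apply/implyP=> ef; apply/implyP=> /andP[lf lof].
  by apply: emax; rewrite /P lf -(lowE e) // lof (near_trans se ef).
(* Without a lowest arc on the left, the start is a lowest arc on the right. *)
have [f0 f0s lof0] := low_attained s; pose Q f := near s f && lowest s f.
have Qf0 : Q f0 by rewrite /Q /near f0s /lowest lof0 /=.
case: (@arg_minnP G f0 Q (arc_min C' D') Qf0) => e0 /andP[se0 loe0] emin.
have {se0 loe0 emin} [e [se loe lt emin]] : exists e, [/\ near s e,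
    lowest s e, tabs e < tabs (opp e) & forall f, Q f -> arc_min C' D' e <= arc_min C' D' f].
  have ls0 : loop e0 by rewrite (near_loop se0).
  case: (ltngtP (tabs (opp e0)) (tabs e0)) (loop_abs_neq ls0) => // lt _; last first.
    by exists e0; split=> // f /emin.
  exists (opp e0); rewrite near_opp /lowest tlab_opp oppK; split=> // f /emin.
  by rewrite arc_min_opp.
have le : in_left e = false by have := noP e; rewrite /P se loe andbT.
exists e => //; rewrite loop_startE (near_loop se) ls lowE // loe le lt /=.
apply/andP; split; apply/forallP=> f; apply/implyP=> ef; have sf := near_trans se ef.
  by rewrite lowE //; have := noP f; rewrite /P sf => /= ->.
by apply/implyP=> lof; apply: emin; rewrite /Q sf -(lowE e).
Qed.

Section LoopWeight.
Variables (K : fieldType) (x y : nat -> K).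
Local Open Scope ring_scope.

(** Starting ends and positive roots are two ways to choose one end on every loop. *)
Lemma prod_loops : \prod_(W <- Loops C' D') (x (walk_start W) * even_steps y W) =
  \prod_(s : G | loop_root s) loop_weight x y s.
Proof.
rewrite big_map big_filter big_enum_cond /=.
(* The end of the same arc that belongs to the positive direction. *)
pose pos e : G := if positive e then e else opp e.
have pos_pos e : positive (pos e) by rewrite /pos; case: ifP => // p; rewrite positive_opp p.
have near_pos e f : near e (pos f) = near e f by rewrite /pos; case: ifP; rewrite ?near_opp.
have rootP e : near (froot nxt e) e.
  rewrite near_sym /near -fconnect_orbit connect_root //.
rewrite (partition_big (fun e => froot nxt (pos e)) (@loop_root G)) /=; last first.
  move=> e /loop_startP[le _].
  have ce : froot nxt (pos e) \in orbit nxt (pos e) by rewrite -fconnect_orbit connect_root.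
  have lp : loop (pos e) by rewrite (near_loop (e := e)) // near_pos near_refl.
  by rewrite /loop_root (loop_positive lp ce) pos_pos roots_root ?(loop_orbit ce) //;
    apply: fconnect_sym (@nxt_inj G).
apply: eq_bigr => s /and3P[ps rs ls]; have [e se ne] := loop_start_exists ls.
rewrite (big_pred1 e) => [|f].
  rewrite loop_walk_even_steps // -[walk_start _]/(loop_low e) -/(loop_weight x y e).
  case/orP: ne => h; first exact: loop_weight_orbit.
  by rewrite -loop_weight_opp; apply: loop_weight_orbit.
have sym := fconnect_sym (@nxt_inj G).
apply/andP/eqP => [[sf /eqP E]|->].
  apply/esym/loop_start_uniq => //; apply: near_trans (_ : near _ s) _.
    by rewrite near_sym.
  by rewrite -near_pos -E.
split=> //; have npe : near s (pos e) by rewrite near_pos.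
have : pos e \in orbit nxt s.
  case/orP: npe => // /(loop_positive ls).
  by rewrite positive_opp pos_pos ps.
by rewrite -fconnect_orbit -root_connect // (eqP rs) eq_sym.
Qed.

Lemma weight_walks : weight G x y =
  (\prod_(W <- Loops C' D') x (walk_start W)) * \prod_(W <- Walks C' D') even_steps y W.
Proof.
rewrite /weight -prod_loops big_split /= /Walks big_cat /= prod_path_walks.
by rewrite mulrCA.
Qed.

End LoopWeight.

End Walks.

(** * The product formula *)

Local Open Scope ring_scope.

Section Generators.
Variables (K : fieldType) (N : nat) (X : N.-1.-tuple K) (Y : N.-2.-tuple K).
Local Notation E := (okada_gen X Y).

Lemma gen_sq i : (0 < i < N)%N -> E i * E i = X`_i.-1 *: E i.
Proof.
move=> hi; have i0 : (0 < i)%N by lia.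
have iN : (i.-1 < N.-1)%N by lia.
have := okada_gen_sq X Y (Ordinal iN).
by rewrite [nat_of_ord _]/(i.-1) (prednK i0) expr2.
Qed.

Lemma gen_comm i j : (0 < i)%N -> (i.+1 < j < N)%N -> E i * E j = E j * E i.
Proof.
move=> i0 hj; have j0 : (0 < j)%N by lia.
have iN : (i.-1 < N.-1)%N by lia.
have jN : (j.-1 < N.-1)%N by lia.
have far : (i.-1.+2 <= j.-1)%N || (j.-1.+2 <= i.-1)%N by lia.
have := @okada_gen_comm K N X Y (Ordinal iN) (Ordinal jN) far.
rewrite [nat_of_ord (Ordinal iN)]/(i.-1) [nat_of_ord (Ordinal jN)]/(j.-1).
by rewrite (prednK i0) (prednK j0) => ->.
Qed.

Lemma gen_down i : (0 < i)%N -> (i.+1 < N)%N -> E i.+1 * E i * E i.+1 = Y`_i.-1 *: E i.+1.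
Proof.
move=> i0 hi; have iN : (i.-1 < N.-1)%N by lia.
have jN : (i < N.-1)%N by lia.
have jE : nat_of_ord (Ordinal jN) = i by [].
have := @okada_gen_down K N X Y (Ordinal iN) (Ordinal jN) (esym (prednK i0)).
by rewrite [nat_of_ord (Ordinal iN)]/(i.-1) jE (prednK i0) => ->.
Qed.

(** The word of C followed by that of D rewrites to a normal word; compare weights,
    products and diagrams. *)
Lemma diagram_prod (C D : odiag N) :
  E_diagram X Y (val C) * E_diagram X Y (val D) =
  mul_weight (fun a => X`_a.-1) (fun h => Y`_h.-1) C D
    *: E_diagram X Y (diagram_mul (val C) (val D)).
Proof.
have [c cc ->] := diag_normal_surj C; have [d dc ->] := diag_normal_surj D.
have lc := small_letters (leqnn N) (small_normal N cc).
have sd := small_normal N dc; have ld := small_letters (leqnn N) sd.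
have scd : small N (normal_word c N ++ normal_word d N) by rewrite small_cat small_normal.
have [b [k [bc [_ _ Dg W P]]]] :=
  normal_form (x := fun a => X`_a.-1) (y := fun h => Y`_h.-1) gen_sq gen_comm gen_down (leqnn N) scd.
move: W; rewrite (word_weight_cat _ _ _ ld) (word_weight_normal _ _ cc (leqnn N)).
rewrite (word_weight_normal _ _ dc (leqnn N)) (word_weight_normal _ _ bc (leqnn N)) !mul1r mulr1.
move=> ->; rewrite (E_diagramE X Y cc) (E_diagramE X Y dc) -(diag_cat _ ld) Dg (E_diagramE X Y bc).
by rewrite -P word_prod_cat.
Qed.

End Generators.

(* The parameters x_a and y_h are X`_a.-1 and Y`_h.-1. *)
Theorem corollary6p15 (K : fieldType) (N : nat) (X : N.-1.-tuple K)
    (Y : N.-2.-tuple K) (C D : diagram N) :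
  okada_diagram C -> okada_diagram D ->
  E_diagram X Y C * E_diagram X Y D =
  ((\prod_(W <- Loops C D) X`_(walk_start W).-1) *
   (\prod_(W <- Walks C D)
      \prod_(p < size (walk_word W) | paired_evenly W p) Y`_(height W p).-1))
    *: E_diagram X Y (diagram_mul C D).
Proof.
move=> okC okD; have := diagram_prod X Y (exist _ C okC) (exist _ D okD).
by rewrite /mul_weight weight_walks.
Qed.
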